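(* Let $\omega(n)=|n|^{\frac32}$ and let $g\in BV(\mathbb T)\setminus H^{\frac12+}(\mathbb T)$, $\mathbb T=\mathbb R/(2\pi\mathbb Z)$. Then $$\frac{11}8\le D_t(\omega,g)\le\frac{13}8$$ for a.e. $t$ characterized by Khinchin–Lévy numbers, namely for every $t\neq0$ such that $\frac{4}{27}\left(\frac{t}{2\pi}\right)^{-2}$ is Khinchin–Lévy (a condition satisfied by a.e. $t$).
   Context: $BV(\mathbb T)$ is the set of functions of bounded variation; $H^{\frac12+}=\bigcup_{s>1/2}H^s$. $e^{itL_\omega}g(x)=\sum_{n\in\mathbb Z}\widehat g(n)e^{it\omega(n)+inx}$, and $D_t(\omega,g)$ is the maximum of the fractal dimensions of the graphs of the real and imaginary parts of $e^{itL_\omega}g$ as functions of $x$ (continuous representatives). The fractal (upper box-counting) dimension of a bounded set $E$ is $\limsup_{\epsilon\to0}\frac{\log\mathcal N(E,\epsilon)}{\log(1/\epsilon)}$, with $\mathcal N(E,\epsilon)$ the minimum number of $\epsilon$-balls needed to cover $E$. A number $\beta\notin\mathbb Q$ is called Khinchin–Lévy if there is a strictly increasing sequence $\{q_n\}_{n\in\mathbb N}$ of natural numbers such that for every $\epsilon>0$, $q_{n+1}\le q_n^{1+\epsilon}$ for all $n>N_\epsilon$, and for each $n$ there is an $a_n$ coprime to $q_n$ with $|\beta-\frac{a_n}{q_n}|\le\frac1{q_n^2}$; a.e. $\beta\in\mathbb R$ is Khinchin–Lévy. *)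

(* Defs.v *)
From HB Require Import structures.
From mathcomp Require Import all_boot all_order all_algebra.
From mathcomp Require Import all_classical all_reals all_analysis.
From mathcomp Require Import complex.
Set Implicit Arguments.
Unset Strict Implicit.
Unset Printing Implicit Defensive.
Import Order.TTheory GRing.Theory Num.Theory.
Import numFieldNormedType.Exports.
Local Open Scope classical_set_scope.
Local Open Scope ring_scope.
Local Open Scope complex_scope.

(* Functions on the torus R / (2 pi Z) are 2 pi-periodic functions on R, and
   [0, 2 pi] with Lebesgue measure is the fundamental domain. *)

Local Notation Re := complex.Re.
Local Notation Im := complex.Im.

Section Torus.
Context {R : realType}.
Implicit Types (g u : R -> R[i]) (omega : int -> R) (s t : R).

Local Notation mu := (@lebesgue_measure R).
Local Notation per := `[0, 2 * pi]%classic.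
Local Notation normc := ComplexField.Normc.normc.

Definition expi (theta : R) : R[i] := cos theta +i* sin theta.

Definition BV_torus g : Prop :=
  [/\ periodic g (2 * pi),
      bounded_variation 0 (2 * pi) (fun x => Re (g x)) &
      bounded_variation 0 (2 * pi) (fun x => Im (g x))].

Definition L2_torus g : Prop :=
  [/\ periodic g (2 * pi),
      measurable_fun per (fun x => Re (g x)),
      measurable_fun per (fun x => Im (g x)) &
      (\int[mu]_(x in per) (normc (g x) ^+ 2)%:E < +oo)%E].

Definition torus_integral (f : R -> R[i]) : R[i] :=
  Rintegral mu per (fun x => Re (f x)) +i* Rintegral mu per (fun x => Im (f x)).

Definition fourier g (n : int) : R[i] :=
  ((2 * pi)^-1)%:C * torus_integral (fun x => g x * expi (- (n%:~R * x))).

(* Only the case 0 <= s is used, where H^s is a space of L^2 functions. *)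
Definition Sobolev s g : Prop :=
  L2_torus g /\
  (\esum_(n in [set: int])
     ((1 + n%:~R ^+ 2) `^ s * normc (fourier g n) ^+ 2)%:E < +oo)%E.

Definition Sobolev_half_plus g : Prop := exists2 s, 2^-1 < s & Sobolev s g.

(* The partial sum over |n| <= N of the series defining e^{i t L_omega} g. *)
Definition evolution_partial_sum omega t g (N : nat) (x : R) : R[i] :=
  \sum_(k < N.*2.+1) let n := k%:Z - N%:Z in
    fourier g n * expi (t * omega n + n%:~R * x).

(* u is the continuous representative of e^{i t L_omega} g, the series being
   summed in L^2 of the torus. *)
Definition is_evolution omega t g u : Prop :=
  [/\ periodic u (2 * pi),
      continuous (fun x => Re (u x)),
      continuous (fun x => Im (u x)) &
      (\int[mu]_(x in per)
          (normc (evolution_partial_sum omega t g N x - u x) ^+ 2)%:E)%E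
        @[N --> \oo] --> 0%E].

(* A continuous representative is unique if it exists; the value is 0 if there
   is none. *)
Definition evolution omega t g : R -> R[i] :=
  xget (fun=> 0) [set u | is_evolution omega t g u].

End Torus.

Section FractalDimension.
Context {R : realType}.

(* Euclidean, unlike the canonical [ball] of R * R. *)
Definition eball (c : R * R) (e : R) : set (R * R) :=
  [set p | Num.sqrt ((p.1 - c.1) ^+ 2 + (p.2 - c.2) ^+ 2) < e].

(* +oo when no finite family of e-balls covers E. *)
Definition covering_number (E : set (R * R)) (e : R) : \bar R :=
  ereal_inf [set k%:R%:E | k in
    [set k : nat | exists c : 'I_k -> R * R, E `<=` \bigcup_i eball (c i) e]].

Definition fractal_dim (E : set (R * R)) : \bar R :=
  limf_esup (fun e : R => lne (covering_number E e) * (ln e^-1)^-1%:E)%E 0^'+.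

(* The graph over one period. *)
Definition graph_torus (f : R -> R) : set (R * R) :=
  [set p | p.1 \in `[0, 2 * pi] /\ p.2 = f p.1].

Definition D_t (t : R) (omega : int -> R) (g : R -> R[i]) : \bar R :=
  maxe (fractal_dim (graph_torus (fun x => Re (evolution omega t g x))))
       (fractal_dim (graph_torus (fun x => Im (evolution omega t g x)))).

End FractalDimension.

Definition Khinchin_Levy {R : realType} (beta : R) : Prop :=
  irrational beta /\
  exists q : nat -> nat,
    [/\ forall n, (0 < q n)%N,
        forall n, (q n < q n.+1)%N,
        forall e : R, 0 < e -> exists N : nat, forall n : nat, (N < n)%N ->
          (q n.+1)%:R <= (q n)%:R `^ (1 + e) &
        forall n, exists a : int, coprimez a (q n)%:Z /\
          `|beta - a%:~R / (q n)%:R| <= 1 / (q n)%:R ^+ 2].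

Definition omega32 {R : realType} (n : int) : R := `|n%:~R| `^ (3 / 2).

(* Main.v *)
Require Import Defs.
From HB Require Import structures.
From mathcomp Require Import all_boot all_order all_algebra.
From mathcomp Require Import all_classical all_reals all_analysis.
From mathcomp Require Import complex.
From mathcomp Require Import measurable_realfun.
From mathcomp Require Import ring lra.
From mathcomp Require Import zify.
Set Implicit Arguments.
Unset Strict Implicit.
Unset Printing Implicit Defensive.
Import Order.TTheory GRing.Theory Num.Theory.
Import numFieldNormedType.Exports.
Local Open Scope classical_set_scope.
Local Open Scope ring_scope.
Local Open Scope complex_scope.

(* The sum of [expi (t n^(3/2) + n x)] over [N <= n < 2 N] is [O(N^(5/8 + e))]
   uniformly in [x].  The terms split into about [sqrt N] blocks according to the
   multiple of [2 pi] that is closest to the frequency; stationary phase replaces each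
   block by a Fresnel integral, up to [O(1)].  The stationary points turn the phases of
   the blocks into the cubic polynomial [2 pi beta (k + theta)^3] with
   [beta = 4/27 (t / (2 pi))^-2], and for Khinchin-Levy [beta] two Weyl differencings and
   the divisor bound save the remaining quarter of a power of [sqrt N].

   The Fourier coefficients of a function of bounded variation behave like those of an
   average of jumps divided by [n], so that the dyadic blocks of the evolution are
   [O(N^(e - 3/8))].  The evolution is thus Hoelder of every order [a < 3/8], whence the
   upper bound [2 - a] of the dimension of the graphs.

   If both dimensions were below [D < 11/8], covering the graphs by [h^(-D)] balls bounds
   the sum of the increments over a grid of step [h] by [O(h^(1 - D))]; with the Hoelder
   bound, the mean square of [u (x + h) - u x] is [O(h^(a + 2 - D))], with an exponent
   larger than 1.  By Parseval the Fourier coefficients decay fast enough for [g] to be in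
   [H^s] for some [s > 1/2].

   For almost every [t], Borel-Cantelli shows that [beta] is approximated no better than
   [q^(-2 - e)], and Dirichlet's theorem then forces the denominators of its good
   approximations to be spaced as in the Khinchin-Levy condition. *)

(** Bounded variation gives only an average of translates of one kernel, so the exponential sums are
    needed in the supremum norm, uniformly in [x]. The variable [x] merely moves the stationary
    points s = 2 (2 pi m - x) / (3 t): inserted into t s^3 / 2 they give 2 pi (4/27) (t / (2 pi))^-2
    (m - x / (2 pi))^3, which is the origin of [beta]. There [x] is a shift of the cubic variable,
    and two differencings turn it into a constant phase. A block contributes about N^(1/4), so sqrt
    N blocks without cancellation give N^(3/4); the saving of N^(1/8) leads to 5/8, and division by
    n to 5/8 - 1 = -3/8. The length of the cubic sum is dictated by N and not adapted to [beta]. The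
    spacing of the denominators is what provides, for every large length M, some q with q <= M <=
    q^(1 + e). The lower bound rests on the same 3/8: a + 2 - D > 1 means D < 1 + a, and a may
    approach 3/8. It needs covers at every small scale, which are available because the dimension is
    a limit superior. *)

Local Notation Re := complex.Re.
Local Notation Im := complex.Im.
Local Notation nc := ComplexField.Normc.normc.

(** * Complex numbers, mean value estimates and Abel summation *)

Section ComplexBasics.
Context {R : realType}.
Implicit Types (z w : R[i]) (a b x y : R).

Lemma nc_ge0 z : 0 <= nc z.
Proof. by case: z => a b; rewrite /= sqrtr_ge0. Qed.

Lemma ncM z w : nc (z * w) = nc z * nc w.
Proof. exact: ComplexField.Normc.normcM. Qed.

Lemma ncD z w : nc (z + w) <= nc z + nc w.
Proof. exact: le_normcD. Qed.

Lemma ncN z : nc (- z) = nc z.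
Proof. exact: normcN. Qed.

Lemma ncBC z w : nc (z - w) = nc (w - z).
Proof. by rewrite -opprB ncN. Qed.

Lemma ncB z w : nc (z - w) <= nc z + nc w.
Proof. by rewrite -(ncN w) ncD. Qed.

Lemma nc_triangle z u w : nc (z - w) <= nc (z - u) + nc (u - w).
Proof. by rewrite (le_trans _ (ncD _ _))// addrA subrK. Qed.

Lemma nc0 : nc (0 : R[i]) = 0.
Proof. exact: ComplexField.Normc.normc0. Qed.

Lemma nc_sqr z : nc z ^+ 2 = Re z ^+ 2 + Im z ^+ 2.
Proof. by case: z => a b /=; rewrite sqr_sqrtr// addr_ge0 ?sqr_ge0. Qed.

Lemma nc_real a : nc a%:C = `|a|.
Proof. by rewrite /= expr0n addr0 sqrtr_sqr. Qed.

Lemma nc_i : nc ('i : R[i]) = 1.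
Proof. by rewrite /= expr0n add0r expr1n sqrtr1. Qed.

Lemma nc_Re z : `|Re z| <= nc z.
Proof.
by rewrite -ler_sqr ?nnegrE ?nc_ge0// nc_sqr real_normK ?num_real// lerDl sqr_ge0.
Qed.

Lemma nc_Im z : `|Im z| <= nc z.
Proof.
by rewrite -ler_sqr ?nnegrE ?nc_ge0// nc_sqr real_normK ?num_real// lerDr sqr_ge0.
Qed.

Lemma nc_ReIm z : nc z <= `|Re z| + `|Im z|.
Proof.
rewrite -ler_sqr ?nnegrE ?nc_ge0 ?addr_ge0// nc_sqr sqrrD !real_normK ?num_real//.
by rewrite lerD2r lerDl mulrn_wge0 ?mulr_ge0.
Qed.

Lemma ReD z w : Re (z + w) = Re z + Re w. Proof. exact: raddfD. Qed.
Lemma ImD z w : Im (z + w) = Im z + Im w. Proof. exact: raddfD. Qed.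
Lemma ReB z w : Re (z - w) = Re z - Re w. Proof. exact: raddfB. Qed.
Lemma ImB z w : Im (z - w) = Im z - Im w. Proof. exact: raddfB. Qed.

Lemma complexE2 z w : Re z = Re w -> Im z = Im w -> z = w.
Proof. by case: z w => [a b] [c d] /= -> ->. Qed.

Lemma Re_rM a z : Re (a%:C * z) = a * Re z.
Proof. by case: z => c d /=; rewrite mul0r subr0. Qed.

Lemma Im_rM a z : Im (a%:C * z) = a * Im z.
Proof. by case: z => c d /=; rewrite mul0r addr0. Qed.

Lemma cReM z w : Re (z * w) = Re z * Re w - Im z * Im w.
Proof. by case: z w => [a b] [c d]. Qed.

Lemma cImM z w : Im (z * w) = Re z * Im w + Im z * Re w.
Proof. by case: z w => [a b] [c d]. Qed.

Lemma realCM a b : (a * b)%:C = a%:C * b%:C :> R[i]. Proof. exact: rmorphM. Qed.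
Lemma realCB a b : (a - b)%:C = a%:C - b%:C :> R[i]. Proof. exact: rmorphB. Qed.

Lemma nc_sum (I : Type) (r : seq I) (P : pred I) (F : I -> R[i]) :
  nc (\sum_(i <- r | P i) F i) <= \sum_(i <- r | P i) nc (F i).
Proof.
elim/big_rec2: _ => [|i u v _ h]; first by rewrite nc0.
by rewrite (le_trans (ncD _ _))// lerD2l.
Qed.

Lemma Re_sum (I : Type) (r : seq I) (P : pred I) (F : I -> R[i]) :
  Re (\sum_(i <- r | P i) F i) = \sum_(i <- r | P i) Re (F i).
Proof. exact: raddf_sum. Qed.

Lemma expiD a b : expi (a + b) = expi a * expi b.
Proof. by apply: complexE2; rewrite ?cReM ?cImM /= ?cosD ?sinD; ring. Qed.

Lemma expi0 : expi (0 : R) = 1.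
Proof. by rewrite /expi cos0 sin0. Qed.

Lemma nc_expi a : nc (expi a) = 1.
Proof. by rewrite /= cos2Dsin2 sqrtr1. Qed.

Lemma expi_conj a : expi (- a) = (expi a)^*%C.
Proof. by apply: complexE2; rewrite /= ?cosN ?sinN. Qed.

Lemma nc_conj z : nc z^*%C = nc z.
Proof. by case: z => a b /=; rewrite sqrrN. Qed.

Lemma expi2pi : expi (2 * pi : R) = 1.
Proof. by rewrite /expi mulr_natl cos2pi sin2pi. Qed.

Lemma expi2pin (n : nat) : expi (2 * pi * n%:R : R) = 1.
Proof.
elim: n => [|n ih]; first by rewrite mulr0 expi0.
rewrite (_ : n.+1%:R = n%:R + 1); last by rewrite natr1.
by rewrite mulrDr expiD ih mulr1 expi2pi mulr1.
Qed.

Lemma expi2piz (n : int) : expi (2 * pi * n%:~R : R) = 1.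
Proof.
case: n => n; first exact: expi2pin.
by rewrite NegzE mulrNz mulrN expi_conj expi2pin; apply: complexE2; rewrite /= ?oppr0.
Qed.

Lemma sqr_nc_expiB1 a : nc (expi a - 1) ^+ 2 = 2 - 2 * cos a.
Proof.
rewrite nc_sqr /= subr0; have := cos2Dsin2 a; lra.
Qed.

End ComplexBasics.

Section MeanValue.
Context {R : realType}.
Implicit Types (f M : R -> R) (a b : R).

Lemma is_derive_continuous_within f (df : R -> R) a b :
  (forall x, a <= x <= b -> is_derive x 1 f (df x)) ->
  {within `[a, b], continuous f}.
Proof.
move=> h; apply: derivable_within_continuous => x; rewrite in_itv /= => xab.
by have [] := h x xab.
Qed.

Lemma mvt_ge0 f (df : R -> R) a b : a <= b ->
  (forall x, a <= x <= b -> is_derive x 1 f (df x)) ->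
  (forall x, a <= x <= b -> 0 <= df x) -> f a <= f b.
Proof.
move=> ab h d0.
have [|c] := @MVT_segment R f df a b ab _ (is_derive_continuous_within h).
  by move=> x; rewrite in_itv /= => /andP[xa xb]; apply: h; rewrite !ltW.
by rewrite in_itv /= => cab /eqP; rewrite subr_eq => /eqP ->; rewrite lerDr mulr_ge0 ?d0 ?subr_ge0.
Qed.

(** [M - f] and [M + f] have nonnegative derivatives. An explicit comparison function thus replaces
    the estimate of an integral of [|df|]. *)
Lemma mvt_dominated f (df : R -> R) M (dM : R -> R) a b : a <= b ->
  (forall x, a <= x <= b -> is_derive x 1 f (df x)) ->
  (forall x, a <= x <= b -> is_derive x 1 M (dM x)) ->
  (forall x, a <= x <= b -> `|df x| <= dM x) -> `|f b - f a| <= M b - M a.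
Proof.
move=> ab hf hM d; rewrite ler_norml; apply/andP; split.
  have : M a + f a <= M b + f b; last by lra.
  apply: (@mvt_ge0 (M + f) (fun x => dM x + df x)) => // x xab.
    by have ? := hf x xab; have ? := hM x xab; apply: is_deriveD.
  by have := d x xab; rewrite ler_norml; lra.
have : M a - f a <= M b - f b; last by lra.
apply: (@mvt_ge0 (M - f) (fun x => dM x - df x)) => // x xab.
  by have ? := hf x xab; have ? := hM x xab; apply: is_deriveB.
by have := d x xab; rewrite ler_norml; lra.
Qed.

Lemma mvt_lipschitz f (df : R -> R) (C : R) a b :
  (forall x, Num.min a b <= x <= Num.max a b -> is_derive x 1 f (df x)) ->
  (forall x, Num.min a b <= x <= Num.max a b -> `|df x| <= C) ->
  `|f b - f a| <= C * `|b - a|.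
Proof.
wlog ab : a b / a <= b.
  move=> H; have /orP[ab|ba] := le_total a b; first exact: H.
  move=> hf hd; rewrite distrC (distrC b); apply: H => // x; rewrite minC maxC;
  [apply: hf|apply: hd].
rewrite (min_idPl ab) (max_idPr ab) => hf hd.
rewrite (@ger0_norm _ (b - a)) ?subr_ge0// mulrBr.
apply: (@mvt_dominated f df (fun x => C * x) (fun=> C)) => // x xab.
apply: is_derive_eq; by rewrite /GRing.scale/= ?mulr1.
Qed.

Lemma sin_cos_lipschitz a b : (`|sin b - sin a| <= `|b - a|) /\ (`|cos b - cos a| <= `|b - a|).
Proof.
split; rewrite -[leRHS]mul1r.
  by apply: (@mvt_lipschitz _ cos) => x _; rewrite ler_norml cos_geN1 cos_le1.
apply: (@mvt_lipschitz _ (- sin)) => x _.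
by rewrite normrN ler_norml sin_geN1 sin_le1.
Qed.

Lemma nc_expiB a b : nc (expi b - expi a) <= 2 * `|b - a|.
Proof.
rewrite (le_trans (nc_ReIm _))// ReB ImB /= mulr2n mulrDl mul1r.
by have [? ?] := sin_cos_lipschitz a b; rewrite lerD.
Qed.

End MeanValue.

Section Abel.
Context {R : realType}.
Implicit Types (w S z : nat -> R[i]) (B : R).

Lemma abel_summation w S n :
  \sum_(k < n) w k * (S k.+1 - S k) =
  w n * S n - w 0%N * S 0%N - \sum_(k < n) (w k.+1 - w k) * S k.+1.
Proof.
elim: n => [|n ih]; first by rewrite !big_ord0 subrr subr0.
by rewrite !big_ord_recr /= ih; ring.
Qed.

Lemma abel_bound w S n B : (forall k, (k <= n)%N -> nc (S k) <= B) ->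
  nc (\sum_(k < n) w k * (S k.+1 - S k)) <=
  B * (nc (w n) + nc (w 0%N) + \sum_(k < n) nc (w k.+1 - w k)).
Proof.
move=> SB; rewrite abel_summation (le_trans (ncB _ _))// mulrDr.
apply: lerD; last first.
  rewrite (le_trans (nc_sum _ _ _))// mulr_sumr; apply: ler_sum => k _.
  by rewrite ncM mulrC ler_wpM2r ?nc_ge0 ?SB.
by rewrite (le_trans (ncB _ _))// mulrDr !ncM !(mulrC _ (nc (S _))) lerD// ler_wpM2r ?nc_ge0 ?SB.
Qed.

(** The variation of a monotone weight telescopes and is at most [c n + c 0] in either direction;
    increasing weights [sqrt (s k)] and decreasing weights [1 / n] both occur. *)
Lemma abel_monotone (c : nat -> R) z n B :
  (forall k, (k <= n)%N -> 0 <= c k) ->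
  ((forall k, (k < n)%N -> c k <= c k.+1) \/ (forall k, (k < n)%N -> c k.+1 <= c k)) ->
  (forall k, (k <= n)%N -> nc (\sum_(j < k) z j) <= B) ->
  nc (\sum_(k < n) (c k)%:C * z k) <= B * (2 * (c n + c 0%N)).
Proof.
move=> c0 mono zB; pose S k := \sum_(j < k) z j.
have B0 : 0 <= B by rewrite (le_trans _ (zB 0%N _))// nc_ge0.
have -> : \sum_(k < n) (c k)%:C * z k = \sum_(k < n) (c k)%:C * (S k.+1 - S k).
  by apply: eq_bigr => k _; rewrite /S big_ord_recr /=; ring.
rewrite (le_trans (@abel_bound (fun k => (c k)%:C) S n B zB))// ler_wpM2l//.
have E : \sum_(k < n) nc ((c k.+1)%:C - (c k)%:C) <= c n + c 0%N.
  under eq_bigr => k _ do rewrite -realCB nc_real.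
  case: mono => mono.
    under eq_bigr => k _ do rewrite ger0_norm ?subr_ge0 ?mono//.
    rewrite -(big_mkord xpredT (fun k => c k.+1 - c k)) telescope_sumr//.
    by have := c0 0%N isT; lra.
  under eq_bigr => k _ do rewrite ler0_norm ?subr_le0 ?mono// opprB.
  under eq_bigr => k _ do rewrite -opprB.
  rewrite sumrN -(big_mkord xpredT (fun k => c k.+1 - c k)) telescope_sumr//.
  by have := c0 n (leqnn n); lra.
rewrite !nc_real !ger0_norm ?c0//; lra.
Qed.

End Abel.

(** * The divisor bound *)

Section DivisorBound.
Local Open Scope nat_scope.

Lemma coprime_dvd_gcd m n d : coprime m n -> d %| m * n -> d = gcdn d m * gcdn d n.
Proof.
move=> cop dmn; apply/eqP; rewrite eqn_dvd; apply/andP; split.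
  rewrite muln_gcdl dvdn_gcd dvdn_mulr//= muln_gcdr dvdn_gcd dvdn_mull//=.
rewrite Gauss_dvd ?dvdn_gcdl//.
exact: coprime_dvdl (dvdn_gcdr d m) (coprime_dvdr (dvdn_gcdr d n) cop).
Qed.

Lemma size_divisorsM m n : 0 < m -> 0 < n -> coprime m n ->
  size (divisors (m * n)) <= size (divisors m) * size (divisors n).
Proof.
move=> m0 n0 cop; rewrite -(size_allpairs muln); apply: uniq_leq_size.
  exact: divisors_uniq.
move=> d; rewrite -dvdn_divisors ?muln_gt0 ?m0// => dmn.
apply/allpairsP; exists (gcdn d m, gcdn d n); split => /=.
- by rewrite -dvdn_divisors// dvdn_gcdr.
- by rewrite -dvdn_divisors// dvdn_gcdr.
- exact: coprime_dvd_gcd.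
Qed.

Lemma size_divisors_expn p k : prime p -> size (divisors (p ^ k)) <= k.+1.
Proof.
move=> pp; rewrite -[leqRHS](size_iota 0) -(size_map (expn p) (iota _ _)).
apply: uniq_leq_size; first exact: divisors_uniq.
move=> d; rewrite -dvdn_divisors ?expn_gt0 ?prime_gt0// => /(dvdn_pfactor _ _ pp)[j jk ->].
by apply/mapP; exists j => //; rewrite mem_iota.
Qed.

(** [j.+1 <= K * (j %/ K).+1 <= K * 2 ^ (j %/ K)], raised to the power [K]. With [j] the exponent of
    a prime, this is the loss at a small prime. *)
Lemma expnS_le_exp2 K j : 0 < K -> j.+1 ^ K <= K ^ K * 2 ^ j.
Proof.
move=> K0; rewrite (@leq_trans ((K * (2 ^ (j %/ K))) ^ K))//.
  rewrite leq_exp2r// (@leq_trans (K * (j %/ K).+1))//.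
    by rewrite mulnC ltn_ceil.
  by rewrite leq_mul2l ltn_expl// orbT.
by rewrite expnMn leq_mul2l -expnM leq_exp2l// leq_trunc_div orbT.
Qed.

(** A prime power [p ^ k] has [k.+1] divisors, and [k.+1 ^ K <= p ^ k] as soon as [p >= 2 ^ K]; each
    of the finitely many smaller primes costs a factor [K ^ K]. *)
Lemma size_divisors_bound K : 0 < K ->
  exists2 C, 0 < C & forall n, 0 < n -> size (divisors n) ^ K <= C * n.
Proof.
move=> K0; pose P := 2 ^ K; pose C0 := K ^ K.
have C00 : 0 < C0 by rewrite expn_gt0 K0.
have split p n : prime p -> 0 < n ->
    exists k m, [/\ n = p ^ k * m, 0 < m, coprime p m & (p %| n -> m < n)].
  move=> pp n0; exists (logn p n), (n`_(p^')); split.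
  - by rewrite -p_part partnC.
  - exact: part_gt0.
  - exact: (pnat_coprime (pnat_id pp) (part_pnat _ _)).
  - move=> pn; rewrite -{2}(partnC p n0) ltn_Pmull ?part_gt0//.
    by rewrite p_part -{1}(expn0 p) ltn_exp2l ?prime_gt1// logn_gt0 mem_primes pp n0.
have expmono a b k : a <= b -> a ^ k <= b ^ k by case: k => // k ab; rewrite leq_exp2r.
have step p k m C1 C2 : prime p -> 0 < m -> coprime p m ->
    k.+1 ^ K <= C1 * p ^ k -> size (divisors m) ^ K <= C2 * m ->
    size (divisors (p ^ k * m)) ^ K <= C1 * C2 * (p ^ k * m).
  move=> pp m0 cop h1 h2.
  rewrite mulnACA; apply: leq_trans (leq_mul h1 h2).
  rewrite -expnMn leq_exp2r//.
  apply: leq_trans (size_divisorsM _ _ _) _ => //; rewrite ?expn_gt0 ?prime_gt0//.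
    by case: k {h1} => [|k]; rewrite ?expn0 ?coprime1n// coprime_pexpl.
  by rewrite leq_mul2r size_divisors_expn// orbT.
suff H b : forall n, 0 < n -> (forall p, prime p -> p %| n -> P - b <= p) ->
    size (divisors n) ^ K <= C0 ^ b * n.
  exists (C0 ^ P) => [|n n0]; first by rewrite expn_gt0 C00.
  by apply: H => // p _ _; rewrite subnn.
elim: b => [|b ihb].
  elim/ltn_ind => n ih n0 hn; rewrite expn0.
  have [n1|] := leqP n 1; first by have -> : n = 1 by [lia]; rewrite exp1n.
  move=> n1; have pp := pdiv_prime n1.
  have [k [m [e m0 cop mn]]] := split _ _ pp n0.
  suff : size (divisors (pdiv n ^ k * m)) ^ K <= 1 * 1 * (pdiv n ^ k * m) by rewrite -e.
  apply: step => //.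
    rewrite mul1n (@leq_trans (P ^ k))//.
      by rewrite -expnM mulnC expnM leq_exp2r// ltn_expl.
    by apply: expmono; rewrite (leq_trans _ (hn _ pp (pdiv_dvd n)))// subn0.
  rewrite -[1](expn0 C0) ih// ?mn ?pdiv_dvd// => p p_p pm; apply: hn => //.
  by rewrite e dvdn_mull.
move=> n n0 hn.
have [pp|npp] := boolP (prime (P - b.+1)); last first.
  apply: (@leq_trans (C0 ^ b * n)); last by rewrite leq_mul2r expnS leq_pmull ?orbT.
  apply: ihb => // p p_p pn; have := hn p p_p pn.
  case: (ltngtP (P - b.+1) p); [lia| lia|].
  by move=> e; rewrite e p_p in npp.
have [k [m [e m0 cop mn]]] := split _ _ pp n0.
rewrite e expnS; apply: step => //.
  apply: (leq_trans (expnS_le_exp2 k K0)); rewrite leq_mul2l.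
  by rewrite expmono ?orbT ?prime_gt1.
apply: ihb => // p p_p pm.
have := hn p p_p; rewrite e dvdn_mull// => /(_ isT).
case: (ltngtP (P - b.+1) p); [lia| lia|].
by move=> e'; move: cop; rewrite e' prime_coprime// pm.
Qed.

End DivisorBound.

(** * Weyl differencing *)

Section WeylDifferencing.
Context {R : realType}.
Implicit Types (f : nat -> R).

(** The off-diagonal terms of the expanded square are grouped by the difference of the indices;
    induction on [K] adds one term to every row. *)
Lemma weyl_square_eq f K :
  (nc (\sum_(k < K) expi (f k)) ^+ 2)%:C = K%:R +
    \sum_(h < K) \sum_(l < K - h.+1) (expi (f (l + h.+1)%N - f l) + (expi (f (l + h.+1)%N - f l))^*%C).
Proof.
have sq (z : R[i]) : (nc z ^+ 2)%:C = z * z^*%C.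
  by rewrite nc_sqr; case: z => a b; apply: complexE2 => /=; ring.
have conjD (z w : R[i]) : (z + w)^*%C = z^*%C + w^*%C by exact: raddfD.
elim: K => [|K ih].
  by rewrite !big_ord0 nc0 expr0n /= addr0.
pose S := \sum_(k < K) expi (f k).
have -> : (nc (\sum_(k < K.+1) expi (f k)) ^+ 2)%:C =
    (nc S ^+ 2)%:C + 1 + \sum_(l < K) (expi (f K - f l) + (expi (f K - f l))^*%C).
  rewrite big_ord_recr /= -/S !sq conjD big_split /=.
  have -> : \sum_(l < K) expi (f K - f l) = expi (f K) * S^*%C.
    rewrite /S raddf_sum mulr_sumr; apply: eq_bigr => l _.
    by rewrite expiD expi_conj.
  have -> : \sum_(l < K) (expi (f K - f l))^*%C = (expi (f K))^*%C * S.
    rewrite /S mulr_sumr; apply: eq_bigr => l _.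
    by rewrite -!expi_conj opprB addrC expiD.
  have -> : cos (f K) -i* sin (f K) = (expi (f K))^*%C by [].
  have -> : 1 = expi (f K) * (expi (f K))^*%C by rewrite -sq nc_expi expr1n.
  by move: (expi _) (expi _)^*%C S^*%C => a b c; ring.
rewrite ih (_ : K.+1%:R = K%:R + 1); last by rewrite natr1.
rewrite [in RHS]big_ord_recr /= subnn big_ord0 addr0.
rewrite -!addrA; congr (_ + _); rewrite addrCA; congr (_ + _).
rewrite [X in _ + X](reindex_inj rev_ord_inj) /= -big_split /=; apply: eq_bigr => h _.
have -> : (K.+1 - h.+1 = (K - h.+1).+1)%N by have := ltn_ord h; lia.
rewrite big_ord_recr /=; congr (_ + _).
by have -> : (K - h.+1 + h.+1 = K)%N by have := ltn_ord h; lia.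
Qed.

Lemma weyl_differencing f K :
  nc (\sum_(k < K) expi (f k)) ^+ 2 <= K%:R +
    2 * \sum_(h < K) nc (\sum_(l < K - h.+1) expi (f (l + h.+1)%N - f l)).
Proof.
have := congr1 (fun z : R[i] => Re z) (weyl_square_eq f K).
have -> : (K%:R : R[i]) = (K%:R : R)%:C by rewrite rmorph_nat.
rewrite [X in X = _]/= ReD Re_sum => ->; rewrite lerD2l mulr_sumr; apply: ler_sum => h _.
rewrite big_split -(raddf_sum (@conjc R)) ReD.
set z := \sum_(l < _) _; have -> : Re z^*%C = Re z by case: z.
have := nc_Re z; rewrite ler_norml => /andP[_]; lra.
Qed.

(** Multiplying by [expi al - 1], of modulus [2 |sin (al / 2)|], telescopes the sum. The product
    form avoids dividing by a sine that may vanish. *)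
Lemma geometric_sum_bound (al ga : R) L :
  nc (\sum_(k < L) expi (al * k%:R + ga)) * `|sin (al / 2)| <= 1.
Proof.
have : (expi al - 1) * \sum_(k < L) expi (al * k%:R + ga) = expi (al * L%:R + ga) - expi ga.
  elim: L => [|L ih]; first by rewrite big_ord0 mulr0 mulr0 add0r subrr.
  rewrite big_ord_recr /= mulrDr ih (_ : L.+1%:R = L%:R + 1); last by rewrite natr1.
  rewrite (_ : al * (L%:R + 1) + ga = al + (al * L%:R + ga)); last by ring.
  by rewrite (expiD al); ring.
move=> /(congr1 (@ComplexField.Normc.normc R)); rewrite ncM => e.
have : nc (expi al - 1) = 2 * `|sin (al / 2)|.
  apply/eqP; rewrite -(@eqrXn2 _ 2)// ?nc_ge0 ?mulr_ge0//; apply/eqP.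
  rewrite sqr_nc_expiB1 exprMn real_normK ?num_real//.
  have -> : cos al = cos (al / 2 + al / 2) by congr cos; lra.
  by rewrite cosD; have := cos2Dsin2 (al / 2); lra.
have := ncB (expi (al * L%:R + ga)) (expi ga); rewrite -e !nc_expi => + e2.
by rewrite e2; lra.
Qed.

Lemma nc_sum_expi_le f L : nc (\sum_(k < L) expi (f k)) <= L%:R.
Proof.
rewrite (le_trans (nc_sum _ _ _))//; under eq_bigr do rewrite nc_expi.
by rewrite sumr_const card_ord.
Qed.

(** The shift [th], which will carry the dependence on [x], enters only the constant [ga]; this
    makes the cubic estimate uniform in [x]. *)
Lemma cubic_second_difference (c th : R) (h h' k : nat) :
  let p (k : nat) := c * (k%:R + th) ^+ 3 in
  exists ga : R, forall k : nat,
    (p (k + h' + h)%N - p (k + h')%N) - (p (k + h)%N - p k)  =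
    c * (6 * h * h')%:R * k%:R + ga.
Proof.
exists (c * (6 * th * h%:R * h'%:R + 3 * h%:R * h'%:R ^+ 2 + 3 * h%:R ^+ 2 * h'%:R)) => {}k.
by rewrite /= !natrD !natrM; ring.
Qed.

Lemma cauchy_sum_sqr n (a : 'I_n -> R) : (\sum_i a i) ^+ 2 <= n%:R * \sum_i a i ^+ 2.
Proof.
have : 0 <= \sum_i \sum_j (a i - a j) ^+ 2.
  by apply: sumr_ge0 => i _; apply: sumr_ge0 => j _; rewrite sqr_ge0.
have -> : \sum_i \sum_j (a i - a j) ^+ 2 = 2 * (n%:R * \sum_i a i ^+ 2) - 2 * (\sum_i a i) ^+ 2.
  transitivity (\sum_i (n%:R * a i ^+ 2 + \sum_j a j ^+ 2 - 2 * a i * \sum_j a j)).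
    apply: eq_bigr => i _.
    transitivity (\sum_j (a i ^+ 2 + a j ^+ 2 - 2 * a i * a j)); first by apply: eq_bigr => j _; ring.
    by rewrite sumrB big_split /= sumr_const card_ord -mulr_sumr -[_ *+ n]mulr_natl.
  by rewrite sumrB big_split /= sumr_const card_ord -!mulr_sumr -mulr_suml -mulr_sumr -[_ *+ n]mulr_natl; ring.
by lra.
Qed.

(* The bound of the innermost geometric sum of the twice differenced cubic sum. *)
Definition weyl_weight (be : R) (M r : nat) : R :=
  Num.min M%:R `|sin (pi * (be * r%:R))|^-1.

Lemma weyl_weight_ge0 be M r : 0 <= weyl_weight be M r.
Proof. by rewrite /weyl_weight le_min ler0n invr_ge0 normr_ge0. Qed.

(** Two differencings with Cauchy-Schwarz in between. A vanishing sine is treated apart: its inverse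
    is 0, so [weyl_weight] would be 0 where the geometric sum may be as large as its length. *)
Lemma cubic_sum_fourth_power (be th : R) (K M : nat) : (K <= M)%N ->
  nc (\sum_(k < K) expi (2 * pi * be * (k%:R + th) ^+ 3)) ^+ 4 <=
  10 * M%:R ^+ 3 + 16 * M%:R * \sum_(h < M) \sum_(h' < M) 
    (if sin (pi * (be * (6 * h.+1 * h'.+1)%:R)) == 0 then M%:R else weyl_weight be M (6 * h.+1 * h'.+1)).
Proof.
move=> KM; pose c := 2 * pi * be; pose p (k : nat) := c * (k%:R + th) ^+ 3.
set T := \sum_(h < M) _.
have K_M : (K%:R : R) <= M%:R by rewrite ler_nat.
pose A h := nc (\sum_(l < K - h.+1) expi (p (l + h.+1)%N - p l)).
have T0 h : 0 <= \sum_(h' < M) (if sin (pi * (be * (6 * h.+1 * h'.+1)%:R)) == 0 then M%:R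
    else weyl_weight be M (6 * h.+1 * h'.+1)).
  by apply: sumr_ge0 => h' _; case: ifP; rewrite ?weyl_weight_ge0.
have w0 h h' : 0 <= (if sin (pi * (be * (6 * h * h')%:R)) == 0 then M%:R
    else weyl_weight be M (6 * h * h')).
  by case: ifP; rewrite ?weyl_weight_ge0.
have A2 (h : 'I_K) : A h ^+ 2 <= M%:R + 2 * \sum_(h' < M)
    (if sin (pi * (be * (6 * h.+1 * h'.+1)%:R)) == 0 then M%:R else weyl_weight be M (6 * h.+1 * h'.+1)).
  apply: (le_trans (weyl_differencing (fun l => p (l + h.+1)%N - p l) _)).
  apply: lerD; first by rewrite ler_nat (leq_trans (leq_subr _ _)).
  rewrite ler_wpM2l//.
  have subM : (K - h.+1 <= M)%N by rewrite (leq_trans (leq_subr _ _)).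
  rewrite (big_ord_widen_cond M xpredT (fun h' : nat => nc (\sum_(l < K - h.+1 - h'.+1)
     expi (p (l + h'.+1 + h.+1)%N - p (l + h'.+1)%N - (p (l + h.+1)%N - p l)))))//.
  rewrite big_mkcond /=; apply: ler_sum => h' _; case: ifP => _; last exact: w0.
  have [ga e] := @cubic_second_difference c th h.+1 h'.+1 0.
  under eq_bigr => l _ do rewrite e.
  have L1 : (K - h.+1 - h'.+1)%:R <= (M%:R : R).
    by rewrite ler_nat (leq_trans (leq_subr _ _)).
  case: ifPn => [_|s0]; first by rewrite (le_trans (nc_sum_expi_le (fun k => _ * k%:R + _) _)).
  rewrite /weyl_weight le_min (le_trans (nc_sum_expi_le (fun k => _ * k%:R + _) _))//=.
  rewrite -[leRHS]mul1r ler_pdivlMr ?normr_gt0//.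
  have := geometric_sum_bound (c * (6 * h.+1 * h'.+1)%:R) ga (K - h.+1 - h'.+1).
  by rewrite (_ : c * _ / 2 = pi * (be * (6 * h.+1 * h'.+1)%:R))//; rewrite /c; field.
have : (\sum_(h < K) A h) ^+ 2 <= M%:R * (M%:R ^+ 2 + 2 * T).
  apply: (le_trans (cauchy_sum_sqr _)).
  apply: ler_pM => //; first by apply: sumr_ge0 => h _; rewrite sqr_ge0.
  apply: (@le_trans _ _ (\sum_(h < K) (M%:R + 2 * \sum_(h' < M) 
    (if sin (pi * (be * (6 * h.+1 * h'.+1)%:R)) == 0 then M%:R else weyl_weight be M (6 * h.+1 * h'.+1))))).
    by apply: ler_sum => h _; exact: A2.
  rewrite big_split /= sumr_const card_ord -[_ *+ K]mulr_natl -mulr_sumr expr2.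
  apply: lerD; first by rewrite ler_wpM2r.
  rewrite ler_wpM2l// /T.
  rewrite (big_ord_widen_cond M xpredT (fun h : nat => \sum_(h' < M) 
    (if sin (pi * (be * (6 * h.+1 * h'.+1)%:R)) == 0 then M%:R else weyl_weight be M (6 * h.+1 * h'.+1))))//.
  by rewrite big_mkcond /=; apply: ler_sum => h _; case: ifP => _.
have := weyl_differencing p K.
set S := nc _ => S2; set B := \sum_(h < K) A h => B2.
have B0 : 0 <= B by apply: sumr_ge0 => h _; rewrite nc_ge0.
have Tge0 : 0 <= T by apply: sumr_ge0 => h _.
have [M0|M0] := posnP M.
  have K0 : K = 0%N by lia.
  by rewrite /S K0 big_ord0 nc0 expr0n /= addr_ge0 ?mulr_ge0 ?exprn_ge0 // M0.
have M1 : 1 <= (M%:R : R) by rewrite ler1n.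
rewrite (_ : S ^+ 4 = (S ^+ 2) ^+ 2); last by rewrite -exprM.
have S2' : S ^+ 2 <= M%:R + 2 * B by apply: (le_trans S2); rewrite lerD2r.
have : (S ^+ 2) ^+ 2 <= 2 * M%:R ^+ 2 + 8 * B ^+ 2.
  have h1 : (S ^+ 2) ^+ 2 <= (M%:R + 2 * B) ^+ 2 by rewrite ler_sqr ?nnegrE ?sqr_ge0// addr_ge0 ?mulr_ge0.
  apply: (le_trans h1); rewrite -subr_ge0.
  rewrite (_ : _ - _ = (M%:R - 2 * B) ^+ 2); last by ring.
  by rewrite sqr_ge0.
have : (M%:R : R) ^+ 2 <= M%:R ^+ 3 by rewrite exprS ler_peMl ?sqr_ge0.
set m := (M%:R : R); move: B2; rewrite -/m => B2 h1 h2; apply: (le_trans h2).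
have := ler_wpM2l (_ : 0 <= 8) B2; rewrite ler0n => /(_ isT); rewrite exprS; move: h1; rewrite exprS; lra.
Qed.

End WeylDifferencing.

(** * Distribution of the multiples of [beta] modulo 1 *)

Section LinearSums.
Context {R : realType}.
Implicit Types (x y be : R).

Lemma nc_expiB1 x : nc (expi x - 1) = 2 * `|sin (x / 2)|.
Proof.
apply/eqP; rewrite -(@eqrXn2 _ 2)// ?nc_ge0 ?mulr_ge0//; apply/eqP.
rewrite sqr_nc_expiB1 exprMn real_normK ?num_real//.
have -> : cos x = cos (x / 2 + x / 2) by congr cos; lra.
by rewrite cosD; have := cos2Dsin2 (x / 2); lra.
Qed.

(** The double-angle formula turns [y cos y <= sin y] at [y = x / 2] into
    [sin x >= x (1 + cos x) / 2], and [cos x >= 0] in this range. *)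
Lemma sin_ge_half x : 0 <= x <= pi / 2 -> x / 2 <= sin x.
Proof.
move=> /andP[x0 xpi].
have h : x / 2 * cos (x / 2) <= sin (x / 2).
  rewrite -subr_ge0.
  have := @mvt_ge0 R (fun y => sin y - y * cos y) (fun y => y * sin y) 0 (x / 2).
  rewrite sin0 mul0r subr0; apply; first lra.
    move=> y _; apply: is_derive_eq; rewrite /GRing.scale/=; ring.
  by move=> y y0; rewrite mulr_ge0 ?sin_ge0_pi//; have := pi_ge0 R; lra.
have c0 : 0 <= cos (x / 2) by apply: cos_ge0_pihalf; lra.
have cx0 : 0 <= cos x by apply: cos_ge0_pihalf; lra.
have e1 : sin x = 2 * (sin (x / 2) * cos (x / 2)).
  by rewrite [in LHS](_ : x = x / 2 + x / 2) ?sinD; [ring|lra].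
have e2 : cos x = 2 * cos (x / 2) ^+ 2 - 1.
  rewrite [in LHS](_ : x = x / 2 + x / 2) ?cosD; last lra.
  by have := cos2Dsin2 (x / 2); lra.
have := ler_wpM2r c0 h; rewrite e1; nra.
Qed.

Definition frac y : R := y - (Num.floor y)%:~R.

Lemma frac_itv y : 0 <= frac y < 1.
Proof.
have := floor_itv y; rewrite /frac intrD => /andP[]; lra.
Qed.

Lemma abs_sin_pi_ge y : Num.min (frac y) (1 - frac y) <= `|sin (pi * y)|.
Proof.
have /andP[f0 f1] := frac_itv y.
(* Both sides are half the modulus of [expi (2 pi y) - 1], which depends only on [y] modulo 1; the
   parity of the floor never enters. *)
have -> : `|sin (pi * y)| = `|sin (pi * frac y)|.
  suff: 2 * `|sin (pi * y)| = 2 * `|sin (pi * frac y)| by lra.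
  rewrite (_ : pi * y = 2 * pi * y / 2); last by field.
  rewrite (_ : pi * frac y = 2 * pi * frac y / 2); last by field.
  rewrite -!nc_expiB1; congr (nc (_ - 1)).
  rewrite [in LHS](_ : y = frac y + (Num.floor y)%:~R); last by rewrite subrK.
  by rewrite mulrDr expiD expi2piz mulr1.
have pi2 := pi_ge2 R.
rewrite ge_min; case: (lerP (frac y) (1/2)) => h.
  apply/orP; left.
  have : pi * frac y / 2 <= sin (pi * frac y) by apply: sin_ge_half; nra.
  by move=> /le_trans/(_ (ler_norm _)); apply: le_trans; nra.
apply/orP; right.
have : pi * (1 - frac y) / 2 <= sin (pi * (1 - frac y)) by apply: sin_ge_half; nra.
rewrite {2}mulrBr mulr1 sinB sinpi cospi mul0r sub0r mulN1r opprK.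
by move=> /le_trans/(_ (ler_norm _)); apply: le_trans; nra.
Qed.

(** The summand at [i = 0] is 0 by the convention for inverses. The induction step is
    [ln (1 - u) <= - u] at [u = 1 / n.+2]. *)
Lemma harmonic_le_ln n : (0 < n)%N -> \sum_(i < n.+1) (i%:R : R)^-1 <= 1 + ln n%:R.
Proof.
case: n => // n _; elim: n => [|n ih].
  by rewrite !big_ord_recr big_ord0 /= ln1 invr0; lra.
rewrite big_ord_recr /=; apply: (le_trans (lerD ih (lexx _))).
rewrite -addrA lerD2l.
have n0 : 0 < n.+1%:R :> R by rewrite ltr0n.
have n1 : 0 < n.+2%:R :> R by rewrite ltr0n.
have : ln (1 + (- n.+2%:R^-1)) <= - n.+2%:R^-1 :> R.
  by apply: le_ln1Dx; rewrite ltrN2 invf_lt1// ltr1n.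
rewrite (_ : 1 - n.+2%:R^-1 = n.+1%:R / n.+2%:R); first by rewrite ln_div ?posrE//; move: (ln _) (ln _) (_^-1) => A B C; lra.
move: n1; have -> : n.+2%:R = n.+1%:R + 1 :> R by rewrite natr1.
by move: n.+1%:R => x x0; field; rewrite lt0r_neq0.
Qed.

Definition weyl_term be (M r : nat) : R :=
  if sin (pi * (be * r%:R)) == 0 then M%:R else weyl_weight be M r.

Lemma weyl_term_ge0 be M r : 0 <= weyl_term be M r.
Proof. by rewrite /weyl_term; case: ifP; rewrite ?weyl_weight_ge0. Qed.

Lemma weyl_term_le be M r : weyl_term be M r <= M%:R.
Proof. by rewrite /weyl_term /weyl_weight; case: ifP => //; rewrite ge_min lexx. Qed.

Definition bin be (Q r : nat) : nat := Num.truncn (Q%:R * frac (be * r%:R)).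

Lemma bin_itv be Q r :
  (bin be Q r)%:R <= Q%:R * frac (be * r%:R) < (bin be Q r).+1%:R.
Proof. by rewrite /bin truncn_itv// mulr_ge0//; have /andP[] := frac_itv (be * r%:R). Qed.

Lemma bin_lt be Q r : (0 < Q)%N -> (bin be Q r < Q)%N.
Proof.
move=> Q0; rewrite -(ltr_nat R); have /andP[+ _] := bin_itv be Q r.
move=> /le_lt_trans; apply; rewrite -[ltRHS]mulr1 ltr_pM2l ?ltr0n//.
by have /andP[] := frac_itv (be * r%:R).
Qed.

(* Division by zero is zero, so the two fractions vanish in the extreme bins. *)
Definition bin_bound (M Q i : nat) : R :=
  (i == 0%N)%:R * M%:R + (i == Q.-1)%:R * M%:R + Q%:R * i%:R^-1 + Q%:R * (Q.-1 - i)%:R^-1.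

(** In bin [i] the fractional part is at least [i / Q] away from 0 and [(Q.-1 - i) / Q] away from 1;
    in the two extreme bins only the bound [M] is left. *)
Lemma weyl_term_bin be M Q r : (0 < Q)%N -> weyl_term be M r <= bin_bound M Q (bin be Q r).
Proof.
move=> Q0; set i := bin be Q r.
have iQ : (i < Q)%N by exact: bin_lt.
have Q0' : 0 < Q%:R :> R by rewrite ltr0n.
have p0 : 0 <= (i == 0%N)%:R * M%:R :> R by rewrite mulr_ge0.
have p1 : 0 <= (i == Q.-1)%:R * M%:R :> R by rewrite mulr_ge0.
have p2 : 0 <= Q%:R * i%:R^-1 :> R by rewrite mulr_ge0 ?invr_ge0.
have p3 : 0 <= Q%:R * (Q.-1 - i)%:R^-1 :> R by rewrite mulr_ge0 ?invr_ge0.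
rewrite /bin_bound; have [i0|i0] := eqVneq i 0%N.
  have := weyl_term_le be M r; rewrite i0 /= in p1 p2 p3 *; lra.
have [i1|i1] := eqVneq i Q.-1.
  have := weyl_term_le be M r; rewrite i1 /= in p1 p2 p3 *; lra.
have /andP[b1 b2] := bin_itv be Q r; rewrite -/i in b1 b2.
have s := abs_sin_pi_ge (be * r%:R).
set f := frac _ in b1 b2 s.
have i0' : 0 < i%:R :> R by rewrite ltr0n; lia.
have i1' : 0 < (Q.-1 - i)%:R :> R by rewrite ltr0n; lia.
have e : Q%:R = (Q.-1 - i)%:R + i.+1%:R :> R.
  by rewrite -natrD; congr _%:R; clear -iQ; move: i iQ => i iQ; lia.
have f0 : 0 < f by rewrite -(pmulr_rgt0 _ Q0'); lra.
have f1 : 0 < 1 - f by rewrite -(pmulr_rgt0 _ Q0'); lra.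
have m0 : 0 < Num.min f (1 - f) by rewrite lt_min f0.
have s0 : 0 < `|sin (pi * (be * r%:R))| by lra.
rewrite /weyl_term -normr_eq0 (gt_eqF s0) /weyl_weight ge_min; apply/orP; right.
apply: (@le_trans _ _ (Num.min f (1 - f))^-1); first by rewrite lef_pV2.
rewrite !mul0r !add0r; case: (leP f (1 - f)) => _.
  apply: (@le_trans _ _ (Q%:R * i%:R^-1)); last lra.
  by rewrite ler_pdivlMr// mulrC ler_pdivrMr.
apply: (@le_trans _ _ (Q%:R * (Q.-1 - i)%:R^-1)); last lra.
rewrite ler_pdivlMr// mulrC ler_pdivrMr//; lra.
Qed.

Lemma sum_bin_bound M Q : (0 < Q)%N ->
  \sum_(i < Q) bin_bound M Q i <= 2 * M%:R + 2 * Q%:R * (1 + ln Q%:R).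
Proof.
move=> Q0.
have H : \sum_(i < Q) (i%:R : R)^-1 <= 1 + ln Q%:R.
  by have := harmonic_le_ln Q0; rewrite big_ord_recr /=; apply: le_trans; rewrite lerDl invr_ge0.
have one (k : nat) : (k < Q)%N -> \sum_(i < Q) ((i : nat) == k)%:R * M%:R <= M%:R :> R.
  move=> kQ; rewrite -mulr_suml (bigD1 (Ordinal kQ))//= eqxx big1 ?addr0 ?mul1r// => i.
  by rewrite -val_eqE /= => /negPf ->.
rewrite /bin_bound !big_split /= -!mulr_sumr.
have -> : \sum_(i < Q) ((Q.-1 - i)%:R : R)^-1 = \sum_(i < Q) (i%:R : R)^-1.
  rewrite [RHS](reindex_inj rev_ord_inj) /=; apply: eq_bigr => i _; congr (_%:R^-1).
  by have := ltn_ord i; lia.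
have := one 0%N Q0; have := one Q.-1; rewrite prednK ?leqnn// => /(_ isT).
have := ler_wpM2l (ler0n R Q) H.
set A := \sum_(i < Q) _; set B := \sum_(i < Q) _; set D := Q%:R * \sum_(i < Q) _.
lra.
Qed.

(* Two points [be * r], [be * (r + d)] with [2 d <= q] are more than [1 / (2 q)] apart modulo 1. *)
Lemma bin_separated be (a : int) (q r d : nat) :
  coprimez a q%:Z -> `|be - a%:~R / q%:R| <= 1 / q%:R ^+ 2 ->
  (0 < d)%N -> (2 * d <= q)%N ->
  bin be (2 * q) r != bin be (2 * q) (r + d).
Proof.
move=> cop bq d0 dq; apply/negP => /eqP e.
have /andP[] := bin_itv be (2 * q) r; have /andP[] := bin_itv be (2 * q) (r + d); rewrite -e.
have q0 : 0 < q%:R :> R by rewrite ltr0n; lia.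
rewrite -natr1; set b := (bin _ _ _)%:R => h1 h2 h3 h4.
set k := Num.floor (be * (r + d)%:R) - Num.floor (be * r%:R).
have h5 : `|2 * q%:R * (be * d%:R - k%:~R)| < 1.
  rewrite ltr_norml; move: h1 h2 h3 h4; rewrite /frac /k intrD intrN (natrM _ 2) (natrD _ r).
  set F1 := _%:~R; set F2 := _%:~R; move=> *; apply/andP; split; lra.
(* An integer of modulus below 1: sharing a bin contributes less than 1/2, and the error of [a / q]
   contributes at most [d / q <= 1 / 2]. Its vanishing makes [q] divide [d]. *)
have h6 : `|(a * d%:Z - k * q%:Z)%:~R : R| < 1.
  have -> : (a * d%:Z - k * q%:Z)%:~R = q%:R * (be * d%:R - k%:~R) - (be - a%:~R / q%:R) * (q%:R * d%:R) :> R.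
    rewrite intrD intrN !intrM; field; lra.
  rewrite (le_lt_trans (ler_normB _ _))//.
  have : `|(be - a%:~R / q%:R) * (q%:R * d%:R)| <= 1 / 2.
    rewrite normrM [X in _ * X]ger0_norm ?mulr_ge0//.
    apply: (le_trans (ler_wpM2r _ bq)); first by rewrite mulr_ge0.
    rewrite (_ : 1 / q%:R ^+ 2 * (q%:R * d%:R) = d%:R / q%:R); last by field; lra.
    by rewrite ler_pdivrMr//; move: dq; rewrite -(ler_nat R) natrM; lra.
  have : 2 * `|q%:R * (be * d%:R - k%:~R)| < 1.
    by move: h5; rewrite -mulrA normrM (@ger0_norm _ 2).
  lra.
move: h6; rewrite -intr_norm (_ : 1 = 1%:~R)// ltr_int => h6.
have /eqP : a * d%:Z - k * q%:Z = 0 by move: h6; case: (a * d%:Z - k * q%:Z) => [[|n]|n].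
rewrite subr_eq0 => /eqP e2.
have : (q%:Z %| a * d%:Z)%Z by rewrite e2 dvdz_mull.
rewrite Gauss_dvdzr; last by rewrite coprimez_sym.
by rewrite /dvdz /= => /dvdn_leq; lia.
Qed.

(** At most [q / 2] consecutive multiples hit every bin at most once, so they cost no more than one
    sum over all bins. *)
Lemma window_sum be (a : int) (q M r L : nat) :
  coprimez a q%:Z -> `|be - a%:~R / q%:R| <= 1 / q%:R ^+ 2 -> (0 < q)%N ->
  (2 * L <= q)%N ->
  \sum_(j < L) weyl_term be M (r + j) <= 2 * M%:R + 4 * q%:R * (1 + ln (2 * q)%:R).
Proof.
move=> cop bq q0 Lq; have Q0 : (0 < 2 * q)%N by lia.
apply: (@le_trans _ _ (\sum_(i < 2 * q) bin_bound M (2 * q) i)); last first.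
  by apply: (le_trans (sum_bin_bound M Q0)); rewrite !natrM; lra.
pose b (j : 'I_L) : 'I_(2 * q) := Ordinal (bin_lt be (r + j) Q0).
have binj : injective b.
  suff H (j j' : 'I_L) : (j < j')%N -> b j != b j'.
    move=> j j' e; apply/val_inj/eqP; rewrite /=.
    by case: (ltngtP j j') => // /H; rewrite e eqxx.
  move=> jj'; rewrite -val_eqE /=.
  have -> : (r + j' = r + j + (j' - j))%N by lia.
  by apply: bin_separated cop bq _ _; have := ltn_ord j'; lia.
have G0 i : (i < 2 * q)%N -> 0 <= bin_bound M (2 * q) i.
  by move=> _; rewrite /bin_bound !addr_ge0 ?mulr_ge0 ?invr_ge0.
apply: (@le_trans _ _ (\sum_(j < L) bin_bound M (2 * q) (b j))).
  by apply: ler_sum => j _; exact: weyl_term_bin.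
rewrite -(big_imset (fun i : 'I__ => bin_bound M (2 * q) i) (in2W binj : {in 'I_L &, injective b})) /=.
rewrite [leLHS]big_mkcond; apply: ler_sum => i _; case: ifP => // _; exact: G0.
Qed.

Lemma weyl_term_sum be (a : int) (q M n : nat) :
  coprimez a q%:Z -> `|be - a%:~R / q%:R| <= 1 / q%:R ^+ 2 -> (0 < q)%N ->
  \sum_(r < n * q./2) weyl_term be M r <= n%:R * (2 * M%:R + 4 * q%:R * (1 + ln (2 * q)%:R)).
Proof.
move=> cop bq q0; elim: n => [|n ih]; first by rewrite mul0n big_ord0 mul0r.
rewrite mulSnr big_split_ord /= -natr1 mulrDl mul1r; apply: lerD; first exact: ih.
by apply: window_sum cop bq q0 _; lia.
Qed.

(** The pairs are collected according to [r = 6 * h.+1 * h'.+1]. A pair with given [r] is determined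
    by [h.+1], a divisor of [r], so a fibre has at most [D] elements. *)
Lemma weyl_double_sum be (M D n L : nat) :
  (forall r, (0 < r <= 6 * M ^ 2)%N -> (size (divisors r) <= D)%N) ->
  (6 * M ^ 2 < n * L)%N ->
  \sum_(h < M) \sum_(h' < M) weyl_term be M (6 * h.+1 * h'.+1) <=
  D%:R * \sum_(r < n * L) weyl_term be M r.
Proof.
move=> hD hn; rewrite pair_big /=.
have lt (p : 'I_M * 'I_M) : (6 * p.1.+1 * p.2.+1 < n * L)%N.
  apply: leq_ltn_trans hn; rewrite -mulnA leq_mul2l /= expnS expn1.
  by rewrite leq_mul// ltn_ord.
rewrite (partition_big (fun p : 'I_M * 'I_M => Ordinal (lt p)) xpredT)//= mulr_sumr.
apply: ler_sum => r _.
apply: (@le_trans _ _ (\sum_(p : 'I_M * 'I_M | Ordinal (lt p) == r) weyl_term be M r)).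
  by apply: ler_sum => p /eqP <-.
rewrite sumr_const -[_ *+ _]mulr_natl ler_wpM2r ?weyl_term_ge0// ler_nat.
have [r0|r0] := boolP [exists p : 'I_M * 'I_M, Ordinal (lt p) == r]; last first.
  rewrite (@eq_card0 _ _)// => p; apply/negbTE/negP; rewrite unfold_in => h.
  by move/negP: r0; apply; apply/existsP; exists p.
have [p0 /eqP e0] := existsP r0.
have rpos : (0 < r <= 6 * M ^ 2)%N.
  have -> : (r : nat) = (6 * p0.1.+1 * p0.2.+1)%N by rewrite -e0.
  rewrite !muln_gt0 /= -mulnA leq_mul2l /= expnS expn1.
  by rewrite leq_mul// ltn_ord.
apply: (@leq_trans (size (divisors r))); last exact: hD.
rewrite cardE -(size_map (fun p : 'I_M * 'I_M => p.1.+1)).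
apply: uniq_leq_size.
  rewrite map_inj_in_uniq ?enum_uniq// => -[u v] [u' v']; rewrite !mem_enum !unfold_in.
  move=> /eqnP/= h1 /eqnP/= h2 [] /val_inj e; rewrite -e in h2 *.
  congr pair; apply/val_inj => /=; have : (6 * u.+1 * v.+1 = 6 * u.+1 * v'.+1)%N by rewrite h1 h2.
  by move/eqP; rewrite eqn_pmul2l// eqSS => /eqP.
move=> d /mapP[p]; rewrite mem_enum unfold_in => /eqnP/= <- ->.
rewrite -dvdn_divisors ?muln_gt0//.
by rewrite mulnAC dvdn_mull.
Qed.

End LinearSums.

(** * Cubic Weyl sums for Khinchin-Levy numbers *)

Section CubicWeylSum.
Context {R : realType}.
Implicit Types (x y be : R).

Lemma powRDp x a b : 0 < x -> x `^ (a + b) = x `^ a * x `^ b.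
Proof. by move=> x0; rewrite powRD// (gt_eqF x0) implybT. Qed.

Lemma powR_le x y e : 0 <= e -> 0 <= x -> x <= y -> x `^ e <= y `^ e.
Proof.
by move=> e0 x0 xy; rewrite ge0_ler_powR ?nnegrE// (le_trans x0).
Qed.

Lemma ln_le_powR x e : 0 < e -> 0 < x -> ln x <= x `^ e / e.
Proof.
move=> e0 x0; rewrite ler_pdivlMr// mulrC -ln_powR ltW// ln_sublinear//.
by rewrite powR_gt0.
Qed.

Lemma powR_ge1 x e : 1 <= x -> 0 <= e -> 1 <= x `^ e.
Proof. by move=> x1 e0; rewrite -(powRr0 x) ler_powR. Qed.

(** The divisor bound for some [K > 1 / e], after taking the [K]-th root. *)
Lemma size_divisors_powR (e : R) : 0 < e ->
  exists2 C : R, 1 <= C & forall n, (0 < n)%N -> (size (divisors n))%:R <= C * n%:R `^ e.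
Proof.
move=> e0; pose K := (Num.bound e^-1).
have Ke : e^-1 < K%:R by rewrite archi_boundP// invr_ge0 ltW.
have K0 : (0 < K)%N by rewrite -(ltr_nat R) (lt_trans _ Ke)// invr_gt0.
have K0' : 0 < (K%:R : R) by rewrite ltr0n.
have [C C0 H] := size_divisors_bound K0.
have C1 : 1 <= (C%:R : R) by rewrite ler1n.
exists C%:R => // n n0.
have n1 : 1 <= (n%:R : R) by rewrite ler1n.
have h := H n n0; rewrite -(ler_nat R) natrX natrM -powR_mulrn// in h.
have -> : (size (divisors n))%:R = ((size (divisors n))%:R `^ K%:R) `^ K%:R^-1 :> R.
  by rewrite -powRrM mulfV ?gt_eqF// powRr1.
apply: (@le_trans _ _ ((C%:R * n%:R) `^ (K%:R)^-1)).
  by apply: powR_le; rewrite ?invr_ge0 ?powR_ge0.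
rewrite powRM//; apply: ler_pM; rewrite ?powR_ge0//.
  by apply: ler1_powR => //; rewrite invf_le1// ler1n.
by apply: ler_powR => //; rewrite -(invrK e) lef_pV2 ?posrE ?invr_gt0// ltW.
Qed.

(** With [X = M ^ e]: the products up to [6 M ^ 2] fill [O(M ^ 2 / q)] windows, which is [O(M X)]
    because [M <= q X]; a window costs [O(M X)] and the divisor bound [O(X ^ 2)]. The fourth power
    of the sum is thus [O(M ^ 3 X ^ 4)]. *)
Lemma cubic_weyl_sum (e : R) : 0 < e -> exists2 C : R, 0 < C &
  forall be (a : int) (q M : nat), coprimez a q%:Z ->
  `|be - a%:~R / q%:R| <= 1 / q%:R ^+ 2 -> (1 < q)%N -> (q <= M)%N ->
  M%:R <= q%:R `^ (1 + e) -> forall (K : nat) th, (K <= M)%N ->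
  nc (\sum_(k < K) expi (2 * pi * be * (k%:R + th) ^+ 3)) <= C * M%:R `^ (3 / 4 + e).
Proof.
move=> e0; have [C1 C11 HC1] := size_divisors_powR e0.
pose c2 : R := 10 + 4 / e.
have c20 : 0 < c2 by rewrite /c2 addr_gt0// divr_gt0.
pose c6 : R := C1 * 6 `^ e.
have c60 : 0 <= c6 by rewrite mulr_ge0 ?powR_ge0//; lra.
pose C := 10 + 16 * c6 * 20 * c2.
have C11' : 1 <= C.
  by rewrite /C; have := mulr_ge0 c60 (ltW c20); lra.
exists C; first lra.
move=> be a q M cop bq q1 qM Mq K th KM.
have q20 : (0 < q./2)%N by clear -q1; lia.
(* The worst case of the rounding in [q./2] is [q = 3]. *)
have q3 : (q <= 3 * q./2)%N by clear -q1; lia.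
set m := (M%:R : R); set p := (q%:R : R) in bq Mq.
have q0 : (0 < q)%N by exact: ltnW.
have M0 : (0 < M)%N by exact: leq_trans qM.
have m1 : 1 <= m by rewrite ler1n.
have m0 : 0 < m by lra.
have p2 : 2 <= p by rewrite ler_nat.
have p0 : 0 < p by lra.
have pm : p <= m by rewrite ler_nat.
have me1 : 1 <= m `^ e by apply: powR_ge1 => //; lra.
set X := m `^ e in me1.
have X2 : m `^ (2 * e) = X ^+ 2 by rewrite mulrC powRrM powR_mulrn ?powR_ge0.
pose D := Num.truncn (c6 * m `^ (2 * e)).
have D0 : 0 <= c6 * m `^ (2 * e) by rewrite mulr_ge0 ?powR_ge0.
have HD r : (0 < r <= 6 * M ^ 2)%N -> (size (divisors r) <= D)%N.
  move=> /andP[r0 rM]; rewrite /D truncn_ge_nat//.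
  apply: (le_trans (HC1 r r0)); rewrite /c6 -mulrA ler_wpM2l//; first lra.
  have rle : r%:R <= 6 * m ^+ 2 by rewrite -natrX -natrM ler_nat.
  rewrite powRrM powR_mulrn ?(ltW m0)// -powRM ?exprn_ge0 ?(ltW m0)//.
  by apply: powR_le => //; exact: ltW.
pose n := (6 * M ^ 2 %/ q./2).+1.
have hn : (6 * M ^ 2 < n * q./2)%N by rewrite ltn_ceil.
have mX : m <= m * X by rewrite ler_peMr// ltW.
have pX : p `^ e <= X by apply: powR_le => //; exact: ltW.
have mpX : m <= p * X.
  apply: (le_trans Mq); by rewrite powRDp// powRr1 ?(ltW p0)// ler_wpM2l// (ltW p0).
have n_le : n%:R <= 20 * (m * X).
  rewrite /n -natr1; set x := (_ %/ _)%N; have : (x * q <= 18 * M ^ 2)%N.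
    apply: (@leq_trans (x * (3 * q./2))); first by rewrite leq_mul2l q3 orbT.
    by rewrite mulnCA (_ : 18 = 3 * 6)%N// -mulnA leq_mul2l/= leq_trunc_div.
  rewrite -(ler_nat R) (natrM _ x) (natrM _ 18) natrX -/m -/p => h.
  have : x%:R * p <= 18 * (m * X) * p.
    apply: (le_trans h); rewrite expr2 -!mulrA ler_wpM2l// ler_wpM2l ?(ltW m0)//.
    by rewrite mulrC.
  by rewrite ler_pM2r// => h2; lra.
have B_le : 2 * m + 4 * p * (1 + ln (2 * q)%:R) <= c2 * (m * X).
  have l2 : ln (2%:R : R) <= 1 by have := @le_ln1Dx R 1; rewrite (_ : 1 + 1 = 2%:R)//; apply; lra.
  have lp : ln p <= X / e.
    by apply: (le_trans (ln_le_powR e0 p0)); rewrite ler_pM2r ?invr_gt0.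
  have lq0 : 0 <= ln (2 * q)%:R :> R by rewrite ln_ge0// ler1n muln_gt0.
  have : ln (2 * q)%:R <= 1 + X / e.
    by rewrite natrM lnM ?posrE ?ltr0n// lerD.
  have : p * (1 + ln (2 * q)%:R) <= m * (1 + ln (2 * q)%:R).
    by rewrite ler_wpM2r//; lra.
  rewrite /c2; move: (ln _) lq0 => l l0 h1 h2.
  have : m * (1 + l) <= m * (2 + X / e) by rewrite ler_wpM2l; lra.
  rewrite (_ : (10 + 4 / e) * (m * X) = 10 * (m * X) + 4 * (m * (X / e))); last by ring.
  lra.
have fourth : nc (\sum_(k < K) expi (2 * pi * be * (k%:R + th) ^+ 3)) ^+ 4 <= C * (m ^+ 3 * (m `^ e) ^+ 4).
  rewrite -/X; apply: (le_trans (cubic_sum_fourth_power be th KM)).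
  have h2 := weyl_double_sum be HD hn; have h1 := weyl_term_sum M n cop bq q0.
  set T1 := \sum_(r < n * q./2) _ in h1 h2; set T2 := \sum_(h < M) _ in h2.
  change (10 * m ^+ 3 + 16 * m * T2 <= C * (m ^+ 3 * X ^+ 4)).
  have D_le : D%:R <= c6 * X ^+ 2 by rewrite -X2 truncn_le.
  have T1_le : T1 <= 20 * (m * X) * (c2 * (m * X)).
    apply: (le_trans h1); apply: ler_pM => //.
    rewrite addr_ge0 ?mulr_ge0 ?addr_ge0 ?ln_ge0// ?ler1n ?muln_gt0 ?q0// ltW//.
  have T2_le : T2 <= c6 * X ^+ 2 * (20 * (m * X) * (c2 * (m * X))).
    apply: (le_trans h2); apply: ler_pM => //.
    by apply: sumr_ge0 => r _; exact: weyl_term_ge0.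
  have : m * T2 <= m * (c6 * X ^+ 2 * (20 * (m * X) * (c2 * (m * X)))).
    by rewrite ler_wpM2l// ltW.
  have : m ^+ 3 * 1 <= m ^+ 3 * X ^+ 4.
    by rewrite ler_wpM2l ?exprn_ge0 ?(ltW m0)// exprn_ege1.
  rewrite /C => h3 h4.
  rewrite (_ : (10 + 16 * c6 * 20 * c2) * (m ^+ 3 * X ^+ 4) = 10 * (m ^+ 3 * X ^+ 4) +
    16 * (m * (c6 * X ^+ 2 * (20 * (m * X) * (c2 * (m * X)))))); last by ring.
  lra.
(* Fourth powers are compared; [C >= 1] gives [C <= C ^ 4], so the constant survives the fourth
   root. *)
rewrite -(@ler_pXn2r _ 4)// ?nnegrE ?nc_ge0 ?mulr_ge0 ?powR_ge0//; last lra.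
apply: (le_trans fourth); rewrite exprMn -[in X in _ <= _ * X]powR_mulrn ?powR_ge0//.
rewrite -powRrM (_ : (3 / 4 + e) * 4%:R = 3%:R + e * 4%:R); last by field.
rewrite powRDp// powR_mulrn ?(ltW m0)// powRrM powR_mulrn ?powR_ge0// ler_wpM2r//.
  by rewrite mulr_ge0 ?exprn_ge0 ?powR_ge0//; lra.
by rewrite -[leLHS]expr1 ler_weXn2l.
Qed.

(** Applied to denominators of approximations, to the ends of the blocks and to the powers of 2. *)
Lemma increasing_bracket (q : nat -> nat) (N M : nat) :
  (forall n, (q n < q n.+1)%N) -> (q N <= M)%N ->
  exists n, [/\ (N <= n)%N, (q n <= M)%N & (M < q n.+1)%N].
Proof.
move=> qs qN; pose P n := (N <= n)%N && (q n <= M)%N.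
have qn n : (n <= q n)%N by elim: n => // n ih; exact: leq_ltn_trans ih (qs n).
have exP : exists n, P n by exists N; rewrite /P leqnn.
have ubP n : P n -> (n <= M)%N by move=> /andP[_]; apply: leq_trans.
case: (ex_maxnP exP ubP) => n /andP[Nn nM] nmax; exists n; split=> //.
rewrite ltnNge; apply/negP => h.
have : (n.+1 <= n)%N by apply: nmax; rewrite /P h ltnW.
by rewrite ltnn.
Qed.

(** For [q n <= M < q n.+1] the spacing condition gives [M <= q n ^ (1 + e)], so [q n] is a
    denominator adapted to the length [M]. Bounded [M] are absorbed in the constant. *)
Lemma khinchin_levy_cubic_sum be (e : R) : Khinchin_Levy be -> 0 < e ->
  exists2 C : R, 0 < C & forall (M K : nat) th, (0 < M)%N -> (K <= M)%N ->
  nc (\sum_(k < K) expi (2 * pi * be * (k%:R + th) ^+ 3)) <= C * M%:R `^ (3 / 4 + e).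
Proof.
move=> [_ [q [q0 qs qe qa]]] e0.
have [C C0 H] := cubic_weyl_sum e0; have [N HN] := qe e e0.
(* [N.+1] and not [N]: the spacing condition holds for indices strictly above [N], and an index of
   at least 1 also ensures [1 < q n]. *)
pose M0 := q N.+1.
exists (C + M0%:R) => [|M K th Mpos KM]; first by rewrite ltr_wpDr.
have M1 : 1 <= M%:R `^ (3 / 4 + e) by apply: powR_ge1; rewrite ?ler1n//; lra.
rewrite [leRHS]mulrDl; have [small|large] := ltnP M M0.
  apply: (le_trans (nc_sum_expi_le (fun k => _ * (k%:R + _) ^+ 3) _)).
  have : (K%:R : R) <= M0%:R by rewrite ler_nat; lia.
  have : 0 <= (M0%:R : R) by [].
  have : 0 < C * M%:R `^ (3 / 4 + e) by rewrite mulr_gt0//; lra.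
  by move: M1; move: (_ `^ _) => Y; nra.
have [n [Nn qM Mq]] := increasing_bracket qs large.
have [a [cop ha]] := qa n.
apply: (@le_trans _ _ (C * M%:R `^ (3 / 4 + e))); last by rewrite lerDl mulr_ge0// powR_ge0.
apply: (H be a (q n)) => //.
  have qn k : (k < q k)%N by elim: k => // k ih; exact: leq_ltn_trans ih (qs k).
  by apply: leq_ltn_trans (qn n); lia.
by apply: le_trans (HN n Nn); rewrite ler_nat ltnW.
Qed.

End CubicWeylSum.

(** * Block sums by stationary phase *)

Section CotangentKernel.
Context {R : realType}.
Implicit Types (x y v : R).

(* Both terms are 0 at x = 0, which is the limit of the difference. *)
Definition cot_kernel x : R := cos x / sin x - x^-1.

Lemma cot_kernelN x : cot_kernel (- x) = - cot_kernel x.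
Proof. by rewrite /cot_kernel cosN sinN invrN mulrN invrN -opprD. Qed.

Lemma cot_kernel0 : cot_kernel 0 = 0.
Proof. by rewrite /cot_kernel sin0 invr0 mulr0 subrr. Qed.

Lemma abs_sin_le x : `|sin x| <= `|x|.
Proof. by have [+ _] := sin_cos_lipschitz 0 x; rewrite sin0 !subr0. Qed.

Lemma sin_lower_cubic x : 0 <= x -> x - sin x <= x ^+ 3 / 6.
Proof.
move=> x0; have := @mvt_ge0 R (fun y => y ^+ 3 / 6 - (y - sin y)) (fun y => y ^+ 2 / 2 - (1 - cos y)) 0 x x0.
rewrite sin0 expr0n /= mul0r !subr0 subr_ge0; apply.
  by move=> y _; apply: is_derive_eq; rewrite /GRing.scale/=; field.
move=> y _; have := abs_sin_le (y / 2); rewrite -ler_sqr ?nnegrE// !real_normK ?num_real//.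
have -> : cos y = cos (y / 2 + y / 2) by congr cos; lra.
by rewrite cosD; have := cos2Dsin2 (y / 2); lra.
Qed.

Lemma sin_sub_mul_cos x : 0 <= x -> `|sin x - x * cos x| <= x ^+ 3 / 3.
Proof.
move=> x0.
have := @mvt_dominated R (fun y => sin y - y * cos y) (fun y => y * sin y)
  (fun y => y ^+ 3 / 3) (fun y => y ^+ 2) 0 x x0.
rewrite sin0 mul0r expr0n /= mul0r !subr0; apply.
- by move=> y _; apply: is_derive_eq; rewrite /GRing.scale/=; ring.
- by move=> y _; apply: is_derive_eq; rewrite /GRing.scale/=; field.
- move=> y /andP[y0 _]; rewrite normrM (ger0_norm y0) expr2 ler_wpM2l//.
  by have := abs_sin_le y; rewrite (ger0_norm y0).
Qed.

Lemma abs_cot_kernel_le x : `|x| <= pi / 2 -> `|cot_kernel x| <= 2 * `|x|.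
Proof.
wlog x0 : x / 0 <= x.
  move=> H; have /orP[x0|x0] := le_total 0 x; first exact: H.
  by rewrite -(normrN x) -(normrN (cot_kernel x)) -cot_kernelN; apply: H; rewrite oppr_ge0.
rewrite (ger0_norm x0) => xpi.
have [->|xn0] := eqVneq x 0; first by rewrite cot_kernel0 normr0 mulr0.
have xp : 0 < x by lra.
have sx : x / 2 <= sin x by apply: sin_ge_half; lra.
have s0 : 0 < sin x by lra.
have -> : cot_kernel x = - (sin x - x * cos x) / (x * sin x).
  by rewrite /cot_kernel; field; rewrite !gt_eqF.
rewrite normrM normfV (ger0_norm (_ : 0 <= x * sin x)) ?mulr_ge0// ?(ltW s0)//.
rewrite ler_pdivrMr ?mulr_gt0// normrN (le_trans (sin_sub_mul_cos x0))//.
have := ler_wpM2l (_ : 0 <= x ^+ 2) sx; rewrite sqr_ge0 => /(_ isT).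
have : 0 <= x ^+ 3 by rewrite exprn_ge0.
rewrite !exprS expr0; lra.
Qed.

(** The kernel is differentiated only away from 0, where the derivative is at most 4/3. For
    arguments of opposite signs [|x| + |y| = |x - y|], and the linear bound suffices. *)
Lemma cot_kernel_lipschitz x y : `|x| <= pi / 2 -> `|y| <= pi / 2 ->
  `|cot_kernel x - cot_kernel y| <= 2 * `|x - y|.
Proof.
have pos u v : 0 < u <= pi / 2 -> 0 < v <= pi / 2 ->
    `|cot_kernel u - cot_kernel v| <= 2 * `|u - v|.
  move=> hu hv; apply: (@mvt_lipschitz R cot_kernel (fun z => z ^- 2 - (sin z) ^- 2)) => z hz.
    have [z0 z1] : 0 < z /\ z <= pi / 2.
      by move: hz; rewrite ge_min le_max => /andP[/orP[|] ? /orP[|] ?]; lra.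
    have sz : z / 2 <= sin z by apply: sin_ge_half; lra.
    have s0 : 0 < sin z by lra.
    have z0' : z != 0 by rewrite gt_eqF.
    have s0' : sin z != 0 by rewrite gt_eqF.
    have h1 : is_derive z 1 (fun x : R => (sin x)^-1) (- (sin z) ^- 2 * cos z).
      by apply: is_derive_eq; rewrite /GRing.scale/=; ring.
    have h2 : is_derive z 1 (fun x : R => x^-1) (- z ^- 2).
      have h3 : is_derive z 1 (fun x : R => (id x)^-1) (- z ^- 2 *: 1) by exact: is_deriveV.
      by apply: is_derive_eq; rewrite /GRing.scale/= mulr1.
    rewrite /cot_kernel; apply: is_derive_eq.
    rewrite /GRing.scale/=; have := cos2Dsin2 z => e.
    rewrite (_ : _ - _ = z ^- 2 - (cos z ^+ 2 + sin z ^+ 2) / sin z ^+ 2); first by rewrite e; field; rewrite s0' z0'.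
    by field; rewrite s0' z0'.
  have [z0 z1] : 0 < z /\ z <= pi / 2.
    by move: hz; rewrite ge_min le_max => /andP[/orP[|] ? /orP[|] ?]; lra.
  have sz : z / 2 <= sin z by apply: sin_ge_half; lra.
  have s0 : 0 < sin z by lra.
  have sz1 : sin z <= z by have := abs_sin_le z; rewrite !gtr0_norm.
  have -> : z ^- 2 - sin z ^- 2 = - (z ^+ 2 - sin z ^+ 2) / (z ^+ 2 * sin z ^+ 2).
    by field; rewrite !gt_eqF.
  rewrite normrM normfV normrN.
  rewrite (ger0_norm (_ : 0 <= z ^+ 2 - sin z ^+ 2)); last first.
    by rewrite subr_ge0 ler_sqr ?nnegrE// ltW.
  rewrite (ger0_norm (mulr_ge0 (sqr_ge0 z) (sqr_ge0 (sin z)))).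
  rewrite ler_pdivrMr ?mulr_gt0 ?exprn_gt0//.
  have h1 : z ^+ 2 - sin z ^+ 2 <= z ^+ 3 / 6 * (2 * z).
    rewrite subr_sqr; apply: ler_pM; [lra|lra| exact: sin_lower_cubic (ltW z0)|lra].
  have h2 : (z / 2) ^+ 2 <= sin z ^+ 2 by rewrite ler_sqr ?nnegrE//; lra.
  have := ler_wpM2l (_ : 0 <= z ^+ 2) h2; rewrite sqr_ge0 => /(_ isT).
  have z4 : 0 <= z ^+ 4 by rewrite exprn_ge0// ltW.
  move: h1 z4; rewrite !exprS !expr0 !mulr1; lra.
move=> hx hy.
have opp u v : u * v <= 0 -> `|u| <= pi / 2 -> `|v| <= pi / 2 ->
    `|cot_kernel u - cot_kernel v| <= 2 * `|u - v|.
  move=> uv hu hv; apply: (le_trans (ler_normB _ _)).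
  apply: (le_trans (lerD (abs_cot_kernel_le hu) (abs_cot_kernel_le hv))).
  rewrite -mulrDr ler_wpM2l// -ler_sqr ?nnegrE ?addr_ge0// sqrrD !real_normK ?num_real//.
  by rewrite -normrM (ler0_norm uv); lra.
have [|xy] := lerP (x * y) 0; first by move=> h; exact: opp.
have [x0|x0|x0] := ltgtP x 0; last by rewrite x0 mul0r ltxx in xy.
  have y0 : y < 0 by rewrite nmulr_rgt0 in xy.
  have := pos (- x) (- y); rewrite !cot_kernelN -!opprD !normrN; apply.
    by rewrite ltr0_norm in hx; lra.
  by rewrite ltr0_norm in hy; lra.
have y0 : 0 < y by rewrite pmulr_rgt0 in xy.
by rewrite gtr0_norm in hx => //; rewrite gtr0_norm in hy => //; apply: pos; lra.
Qed.

(* The mean value of [u |-> expi (v * u)] over the unit interval. *)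
Definition expi_mean v : R[i] := if v == 0 then 1 else (sin v / v) +i* ((1 - cos v) / v).

(** The quotient [(1 - expi_mean v) / (expi v - 1)], continued to -1/2 at 0. Its nearest poles are
    at [2 pi] and [- 2 pi], so it is well behaved for [|v| <= pi]; this is why the blocks end at
    frequency [pi]. *)
Definition sum_kernel v : R[i] := (- 2^-1) +i* (- (cot_kernel (v / 2) / 2)).

(** A term minus the integral of its linearised phase over a unit step becomes a weight times a
    forward difference of exponentials. Such sums are bounded by Abel summation, at the price of the
    variation of the weight. *)
Lemma sum_kernelE v : `|v| <= pi -> 1 - expi_mean v = sum_kernel v * (expi v - 1).
Proof.
move=> vpi; rewrite /expi_mean; case: eqVneq => [->|v0].
  by rewrite expi0 subrr mulr0.
set x := v / 2.
have x0 : x != 0 by rewrite /x mulf_neq0 ?invr_neq0.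
have vE : v = x + x by rewrite /x; lra.
have s0 : sin x != 0.
  apply/negP => /eqP s0.
  have : `|x| / 2 <= `|sin x|.
    have [xp|xn] := leP 0 x.
      rewrite ger0_norm//; apply: le_trans (ler_norm _); apply: sin_ge_half; rewrite xp /x.
      by move: vpi; rewrite ler_norml; lra.
    rewrite ltr0_norm// -normrN -sinN; apply: le_trans (ler_norm _); apply: sin_ge_half.
    by move: vpi; rewrite ler_norml /x; rewrite /x in xn; lra.
  by rewrite s0 normr0; have : 0 < `|x| by [rewrite normr_gt0]; lra.
have xx : x + x = 2 * x by ring.
rewrite /sum_kernel /cot_kernel -/x vE; apply: complexE2 => /=; rewrite ?sinD ?cosD xx.
  apply/eqP; rewrite -subr_eq0; apply/eqP.
  transitivity ((1 - (cos x ^+ 2 + sin x ^+ 2)) / 2); first by field; rewrite s0 x0.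
  by rewrite cos2Dsin2 subrr mul0r.
apply/eqP; rewrite -subr_eq0; apply/eqP.
transitivity ((cos x / (2 * sin x)) * (cos x ^+ 2 + sin x ^+ 2 - 1)); first by field; rewrite s0 x0.
by rewrite cos2Dsin2 subrr mulr0.
Qed.

Lemma sum_kernel_lipschitz u v : `|u| <= pi -> `|v| <= pi ->
  nc (sum_kernel u - sum_kernel v) <= `|u - v|.
Proof.
move=> hu hv; apply: (le_trans (nc_ReIm _)); rewrite /sum_kernel ReB ImB /= subrr normr0 add0r.
rewrite -opprD normrN -mulrBl normrM normfV (@ger0_norm _ 2)// ler_pdivrMr//.
have h2 (z : R) : `|z| <= pi -> `|z / 2| <= pi / 2.
  by rewrite normrM normfV (@ger0_norm _ 2)//; lra.
apply: (le_trans (cot_kernel_lipschitz (h2 _ hu) (h2 _ hv))).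
rewrite -mulrBl normrM normfV (@ger0_norm _ 2)//.
by have := normr_ge0 (u - v); lra.
Qed.

Lemma sum_kernel_bound v : `|v| <= pi -> nc (sum_kernel v) <= 4.
Proof.
move=> hv; apply: (le_trans (nc_ReIm _)); rewrite /= !normrN.
have h2 : `|v / 2| <= pi / 2.
  by rewrite normrM normfV (@ger0_norm _ 2)//; lra.
have := abs_cot_kernel_le h2; have := pihalf_lt2 R.
have e1 : `|2^-1 : R| = 2^-1 by rewrite ger0_norm ?invr_ge0.
rewrite (normrM (cot_kernel _)) e1; lra.
Qed.

End CotangentKernel.

(** * One unit step: comparison with a Fresnel primitive *)

Section StationaryBlock.
Context {R : realType}.
Implicit Types (t s y n v W A : R).

Definition sqrt_dev s y : R := Num.sqrt y - s.

(* For s = s_m, the solution of 3/2 t s + x = 2 pi m, the phase t y^(3/2) + x y - 2 pi m y equals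
   - t s^3 / 2 plus the following; the phase is exactly quadratic in [stat_coord]. *)
Definition stat_phase t s y : R :=
  t * (3 / 2 * s * sqrt_dev s y ^+ 2 + sqrt_dev s y ^+ 3).

Definition stat_coord s y : R := sqrt_dev s y * Num.sqrt (s + 2 / 3 * sqrt_dev s y).

(** The derivative of [stat_phase] in [y], since [s + sqrt_dev s y] is the square root of [y]. *)
Definition stat_freq t s y : R := 3 / 2 * t * sqrt_dev s y.

Lemma stat_phaseE t s y : 0 <= s + 2 / 3 * sqrt_dev s y ->
  stat_phase t s y = 3 / 2 * t * stat_coord s y ^+ 2.
Proof.
move=> h; rewrite /stat_coord exprMn sqr_sqrtr// /stat_phase; by field.
Qed.

(** With [w = sqrt_dev s y] and [r] the square root of [s + 2 / 3 w], the key identity is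
    [w / 3 + r ^ 2 = sqrt y]. As [r] is close to [sqrt s], a primitive in this coordinate is
    normalised by [2 sqrt s]. *)
Lemma stat_coord_derive s y : 0 < y -> 0 < s + 2 / 3 * sqrt_dev s y ->
  is_derive y 1 (stat_coord s) (2 * Num.sqrt (s + 2 / 3 * sqrt_dev s y))^-1.
Proof.
move=> y0 h; set r := Num.sqrt _.
have r0 : 0 < r by rewrite sqrtr_gt0.
have sy0 : 0 < Num.sqrt y by rewrite sqrtr_gt0.
have d1 := is_derive1_sqrt y0.
have d2 : is_derive y 1 (sqrt_dev s) (2 * Num.sqrt y)^-1.
  by rewrite /sqrt_dev; apply: is_derive_eq; rewrite subr0.
have d3 : is_derive y 1 (fun y => s + 2 / 3 * sqrt_dev s y) (2 / 3 * (2 * Num.sqrt y)^-1).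
  by apply: is_derive_eq; rewrite /GRing.scale/=; ring.
have d4 : is_derive y 1 (Num.sqrt \o (fun y => s + 2 / 3 * sqrt_dev s y))
    ((2 * r)^-1 * (2 / 3 * (2 * Num.sqrt y)^-1)).
  by apply: is_derive1_comp; exact: is_derive1_sqrt.
have -> : stat_coord s = sqrt_dev s * (Num.sqrt \o (fun y => s + 2 / 3 * sqrt_dev s y)) by [].
apply: is_derive_eq; rewrite /GRing.scale/= -/r.
have e : r ^+ 2 = s + 2 / 3 * sqrt_dev s y by rewrite sqr_sqrtr// ltW.
have e2 : Num.sqrt y = s + sqrt_dev s y by rewrite /sqrt_dev; ring.
rewrite [RHS](_ : _ = (2 * r)^-1 * (2 * Num.sqrt y)^-1 * (2 * (sqrt_dev s y / 3 + (s + 2 / 3 * sqrt_dev s y)))); last first.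
  rewrite (_ : sqrt_dev s y / 3 + _ = Num.sqrt y); last by rewrite e2; field.
  by field; rewrite !gt_eqF.
rewrite -e; field; by rewrite !gt_eqF.
Qed.

Lemma sqrt_dev_itv s y n W : 0 < n -> n <= y <= n + 1 -> `|sqrt_dev s n| <= W ->
  `|sqrt_dev s (n + 1)| <= W -> `|sqrt_dev s y| <= W.
Proof.
move=> n0 /andP[ny yn]; rewrite /sqrt_dev !ler_norml => /andP[h1 h2] /andP[h3 h4].
have : Num.sqrt n <= Num.sqrt y by rewrite ler_wsqrtr.
have : Num.sqrt y <= Num.sqrt (n + 1) by rewrite ler_wsqrtr.
by move=> *; apply/andP; split; lra.
Qed.

(** In terms of [d = sqrt y - sqrt n <= 1 / (2 sqrt n)] the Taylor remainder is exactly
    [t d ^ 2 (3 / 2 sqrt n + d)]. *)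
Lemma stat_phase_linear t s n y W : 0 < t -> 1 <= s -> W <= s / 2 -> 1 <= n ->
  `|sqrt_dev s n| <= W -> n <= y <= n + 1 ->
  `|stat_phase t s y - (stat_phase t s n + stat_freq t s n * (y - n))| <= t / s.
Proof.
move=> t0 s1 Ws n1 wn /andP[ny yn].
have s0 : 0 < s by lra.
set d := Num.sqrt y - Num.sqrt n.
have sn : s / 2 <= Num.sqrt n by move: wn; rewrite /sqrt_dev ler_norml; lra.
have sn0 : 0 < Num.sqrt n by lra.
have d0 : 0 <= d by rewrite subr_ge0 ler_wsqrtr.
have yE : y = (Num.sqrt n + d) ^+ 2 by rewrite /d addrC subrK sqr_sqrtr//; lra.
have nE : n = Num.sqrt n ^+ 2 by rewrite sqr_sqrtr//; lra.
have ynE : y - n = d * (2 * Num.sqrt n + d) by rewrite [in LHS]yE [in X in _ - X]nE; ring.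
have wy : sqrt_dev s y = sqrt_dev s n + d by rewrite /sqrt_dev /d; ring.
have -> : stat_phase t s y - (stat_phase t s n + stat_freq t s n * (y - n)) =
    t * (d ^+ 2 * (3 / 2 * Num.sqrt n + d)).
  rewrite ynE /stat_phase /stat_freq wy.
  have -> : Num.sqrt n = s + sqrt_dev s n by rewrite /sqrt_dev; ring.
  by field.
have n1' : 1 <= Num.sqrt n by rewrite -sqrtr1 ler_wsqrtr.
have dn : d * (2 * Num.sqrt n) <= 1 by have := mulr_ge0 d0 d0; lra.
have dd : 0 <= d * d by rewrite mulr_ge0.
have d12 : d <= 1 / 2 by nra.
rewrite ger0_norm; last by rewrite !mulr_ge0 ?exprn_ge0//; lra.
rewrite ler_pM2l// -[leRHS]mul1r ler_pdivlMr//.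
have h1 : d * (3 / 2 * Num.sqrt n + d) <= 1 by nra.
have h2 : d * s <= 1 by nra.
rewrite expr2 (_ : _ * s = (d * (3 / 2 * Num.sqrt n + d)) * (d * s)); last by ring.
have h3 : 0 <= d * s by rewrite mulr_ge0// ltW.
have h4 : 0 <= d * (3 / 2 * Num.sqrt n + d) by rewrite mulr_ge0//; lra.
by rewrite -[leRHS]mulr1 ler_pM.
Qed.

(** [cs] stands for cosine or sine, [P] for a Fresnel primitive, [K] for a primitive of the
    linearised phase. On [[n, n + 1]] the derivatives differ by [2 W / s] through the amplitude and
    by [t / s] through the phase. A block has [O(s)] steps, so the errors add up to [O(1)]. *)
Lemma stat_step t s n W A (cs P K : R -> R) : 0 < t -> 1 <= s -> W <= s / 2 -> 1 <= n ->
  `|sqrt_dev s n| <= W -> `|sqrt_dev s (n + 1)| <= W -> A < - (W * Num.sqrt (2 * s)) ->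
  (forall x, `|cs x| <= 1) -> (forall x y, `|cs x - cs y| <= `|x - y|) ->
  (forall x, A < x -> is_derive x 1 P (cs (3 / 2 * t * x ^+ 2))) ->
  (forall y, is_derive y 1 K (cs (stat_phase t s n + stat_freq t s n * (y - n)))) ->
  `|2 * Num.sqrt s * P (stat_coord s (n + 1)) - 2 * Num.sqrt s * P (stat_coord s n) - (K (n + 1) - K n)|
  <= (2 * W + t) / s.
Proof.
move=> t0 s1 Ws n1 wn wn1 hA cs1 csl hP hK.
have s0 : 0 < s by lra.
have n0 : 0 < n by lra.
have W0 : 0 <= W by exact: le_trans wn.
pose r y := Num.sqrt (s + 2 / 3 * sqrt_dev s y).
pose D y := 2 * Num.sqrt s * P (stat_coord s y) - K y.
have -> : 2 * Num.sqrt s * P (stat_coord s (n + 1)) - 2 * Num.sqrt s * P (stat_coord s n) - (K (n + 1) - K n)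
  = D (n + 1) - D n by rewrite /D; ring.
have wy y : n <= y <= n + 1 -> `|sqrt_dev s y| <= W by move=> h; exact: sqrt_dev_itv h wn wn1.
have sw y : n <= y <= n + 1 -> s / 2 <= s + 2 / 3 * sqrt_dev s y <= 2 * s.
  by move=> /wy; rewrite ler_norml => /andP[h1 h2]; apply/andP; split; lra.
have coordA y : n <= y <= n + 1 -> A < stat_coord s y.
  move=> h; apply: (lt_le_trans hA).
  have : `|stat_coord s y| <= W * Num.sqrt (2 * s).
    rewrite normrM (ger0_norm (sqrtr_ge0 _)); apply: ler_pM => //; rewrite ?wy//.
    by rewrite ler_wsqrtr//; have /andP[] := sw y h.
  by rewrite ler_norml => /andP[].
have dP y : n <= y <= n + 1 ->
    is_derive y 1 D (Num.sqrt s / r y * cs (stat_phase t s y) -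
      cs (stat_phase t s n + stat_freq t s n * (y - n))).
  move=> h; have /andP[sw1 sw2] := sw y h.
  have y0 : 0 < y by have /andP[] := h; lra.
  have r0 : 0 < r y by rewrite sqrtr_gt0; lra.
  have d1 : is_derive y 1 (P \o stat_coord s) (cs (stat_phase t s y) * (2 * r y)^-1).
    apply: is_derive1_comp; last by apply: stat_coord_derive => //; lra.
    by rewrite stat_phaseE; [exact: hP (coordA y h)|lra].
  have d2 := hK y; rewrite /D (_ : (fun y => _) = (2 * Num.sqrt s) \*o (P \o stat_coord s) - K)//.
  apply: is_derive_eq; rewrite /GRing.scale/=; field; by rewrite gt_eqF.
rewrite (_ : (2 * W + t) / s = (2 * W + t) / s * `|(n + 1) - n|); last first.
  by rewrite (addrC n) addrK normr1 mulr1.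
have nn : n <= n + 1 by rewrite lerDl.
pose dD y := Num.sqrt s / r y * cs (stat_phase t s y) - cs (stat_phase t s n + stat_freq t s n * (y - n)).
apply: (@mvt_lipschitz R D dD); rewrite (min_idPl nn) (max_idPr nn); first exact: dP.
move=> y h; rewrite /dD.
have /andP[sw1 sw2] := sw y h.
have r0 : 0 < r y by rewrite sqrtr_gt0; lra.
have ss0 : 0 < Num.sqrt s by rewrite sqrtr_gt0.
have rE : r y ^+ 2 = s + 2 / 3 * sqrt_dev s y by rewrite sqr_sqrtr//; lra.
have sE : Num.sqrt s ^+ 2 = s by rewrite sqr_sqrtr// ltW.
have a1 : `|Num.sqrt s / r y - 1| <= 2 * W / s.
  have rs : s / 2 <= r y * Num.sqrt s.
    rewrite -ler_sqr ?nnegrE; [|lra|by rewrite mulr_ge0// ltW].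
    rewrite [leRHS]exprMn rE sE; have := ler_wpM2r (ltW s0) sw1; rewrite expr2; nra.
  have -> : Num.sqrt s / r y - 1 = - (2 / 3 * sqrt_dev s y) / (r y * Num.sqrt s + r y ^+ 2).
    have -> : 2 / 3 * sqrt_dev s y = r y ^+ 2 - Num.sqrt s ^+ 2 by rewrite rE sE; ring.
    by field; rewrite !gt_eqF//= ?addr_gt0 ?mulr_gt0// addr_gt0.
  have rr : s <= r y * Num.sqrt s + r y ^+ 2 by rewrite rE; lra.
  rewrite normrM normfV normrN (@ger0_norm _ (r y * _ + _)); last by lra.
  apply: ler_pM => //; first by rewrite invr_ge0; lra.
    rewrite normrM ger0_norm; last by lra.
    by have := wy y h; lra.
  by rewrite lef_pV2 ?posrE//; lra.
rewrite (_ : _ - _ = (Num.sqrt s / r y - 1) * cs (stat_phase t s y) +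
  (cs (stat_phase t s y) - cs (stat_phase t s n + stat_freq t s n * (y - n)))); last by ring.
apply: (le_trans (ler_normD _ _)); rewrite [leRHS]mulrDl; apply: lerD.
  by rewrite normrM -[leRHS]mulr1 ler_pM.
by apply: (le_trans (csl _ _)); exact: stat_phase_linear Ws _ _ _.
Qed.

End StationaryBlock.

(** * The sum over a whole block *)

Section StationaryBlockSum.
Context {R : realType}.
Implicit Types (t s y n v W A : R).

Lemma expi_mean_re (f v : R) : v != 0 ->
  expi f * expi_mean v = (sin (f + v) / v - sin f / v) +i* (- cos (f + v) / v - - cos f / v).
Proof.
move=> v0; rewrite /expi_mean (negbTE v0); apply: complexE2; rewrite /= ?sinD ?cosD; field; exact: v0.
Qed.

(** Only differences of values matter, so the primitives are specified by their derivatives to the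
    right of some [A] below all the coordinates that occur. *)
Definition fresnel_primitive t A (Pc Ps : R -> R) :=
  (forall x, A < x -> is_derive x 1 Pc (cos (3 / 2 * t * x ^+ 2))) /\
  (forall x, A < x -> is_derive x 1 Ps (sin (3 / 2 * t * x ^+ 2))).

Lemma stat_step_complex t s n W A (Pc Ps : R -> R) : 0 < t -> 1 <= s -> W <= s / 2 -> 1 <= n ->
  `|sqrt_dev s n| <= W -> `|sqrt_dev s (n + 1)| <= W -> A < - (W * Num.sqrt (2 * s)) ->
  fresnel_primitive t A Pc Ps ->
  nc ((2 * Num.sqrt s)%:C * (Pc (stat_coord s (n + 1)) +i* Ps (stat_coord s (n + 1))) -
      (2 * Num.sqrt s)%:C * (Pc (stat_coord s n) +i* Ps (stat_coord s n)) -
      expi (stat_phase t s n) * expi_mean (stat_freq t s n)) <= 2 * ((2 * W + t) / s).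
Proof.
move=> t0 s1 Ws n1 wn wn1 hA [hPc hPs].
have cos1 (x : R) : `|cos x| <= 1 by exact: cos_max.
have sin1 (x : R) : `|sin x| <= 1 by exact: sin_max.
have cosl (x y : R) : `|cos x - cos y| <= `|x - y| by have [] := sin_cos_lipschitz y x.
have sinl (x y : R) : `|sin x - sin y| <= `|x - y| by have [] := sin_cos_lipschitz y x.
pose F := stat_phase t s n; pose v := stat_freq t s n.
rewrite -/F -/v.
apply: (le_trans (nc_ReIm _)).
have -> : 2 * ((2 * W + t) / s) = (2 * W + t) / s + (2 * W + t) / s by ring.
rewrite !ReB !ImB !Re_rM !Im_rM.
have [v0|v0] := eqVneq v 0.
  rewrite {1 2}v0 /expi_mean eqxx mulr1; apply: lerD => /=.
    rewrite (_ : cos F = cos F * (n + 1) - cos F * n); last by ring.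
    apply: (@stat_step R t s n W A cos Pc (fun y => cos F * y)) => // y.
    by rewrite -/F -/v v0 mul0r addr0; apply: is_derive_eq; rewrite /GRing.scale/= mulr1.
  rewrite (_ : sin F = sin F * (n + 1) - sin F * n); last by ring.
  apply: (@stat_step R t s n W A sin Ps (fun y => sin F * y)) => // y.
  by rewrite -/F -/v v0 mul0r addr0; apply: is_derive_eq; rewrite /GRing.scale/= mulr1.
rewrite expi_mean_re//; apply: lerD => /=.
  have -> : sin (F + v) / v - sin F / v = (fun y => v^-1 * sin (F + v * (y - n))) (n + 1) - (fun y => v^-1 * sin (F + v * (y - n))) n.
    by rewrite /= (addrC n) addrK mulr1 subrr mulr0 addr0 !(mulrC v^-1).
  apply: (@stat_step R t s n W A cos Pc (fun y => v^-1 * sin (F + v * (y - n)))) => // y; rewrite -/F -/v.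
  have h1 : is_derive y 1 (fun y => F + v * (y - n)) v.
    by apply: is_derive_eq; rewrite /GRing.scale/=; ring.
  have h2 : is_derive y 1 (sin \o (fun y => F + v * (y - n))) (cos (F + v * (y - n)) * v) by exact: is_derive1_comp.
  rewrite (_ : (fun y => _) = v^-1 \*o (sin \o (fun y => F + v * (y - n))))//.
  by apply: is_derive_eq; rewrite /GRing.scale/=; field.
have -> : - cos (F + v) / v - - cos F / v = (fun y => - v^-1 * cos (F + v * (y - n))) (n + 1) - (fun y => - v^-1 * cos (F + v * (y - n))) n.
  by rewrite /= (addrC n) addrK mulr1 subrr mulr0 addr0; ring.
apply: (@stat_step R t s n W A sin Ps (fun y => - v^-1 * cos (F + v * (y - n)))) => // y; rewrite -/F -/v.
have h1 : is_derive y 1 (fun y => F + v * (y - n)) v.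
  by apply: is_derive_eq; rewrite /GRing.scale/=; ring.
have h2 : is_derive y 1 (cos \o (fun y => F + v * (y - n))) (- sin (F + v * (y - n)) * v) by exact: is_derive1_comp.
rewrite (_ : (fun y => _) = - v^-1 \*o (cos \o (fun y => F + v * (y - n))))//.
by apply: is_derive_eq; rewrite /GRing.scale/=; field.
Qed.

Lemma abel_bound_lt (w S : nat -> R[i]) (n : nat) (B C V : R) : (forall k, (k <= n)%N -> nc (S k) <= B) ->
  (forall k, (k < n)%N -> nc (w k) <= C) -> 0 <= C ->
  \sum_(k < n.-1) nc (w k.+1 - w k) <= V ->
  nc (\sum_(k < n) w k * (S k.+1 - S k)) <= B * (2 * C + V).
Proof.
move=> SB wC C0 wV; have B0 : 0 <= B by rewrite (le_trans _ (SB 0%N _))// nc_ge0.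
case: n => [|n] in SB wC wV *.
  rewrite big_ord0 nc0; have : 0 <= V by rewrite (le_trans _ wV)// big_ord0.
  by move=> V0; rewrite mulr_ge0// addr_ge0 ?mulr_ge0.
(* Clamping the index repeats the last available weight: at the end of a block the frequency may
   exceed [pi], and the kernel is not controlled there. *)
pose w' k := w (minn k n).
have -> : \sum_(k < n.+1) w k * (S k.+1 - S k) = \sum_(k < n.+1) w' k * (S k.+1 - S k).
  by apply: eq_bigr => k _; rewrite /w' (minn_idPl _)// -ltnS.
apply: (le_trans (abel_bound w' SB)); rewrite ler_wpM2l//.
have h1 : nc (w' n.+1) <= C by apply: wC; rewrite ltnS geq_minr.
have h2 : nc (w' 0%N) <= C by apply: wC; rewrite ltnS geq_minr.
have : \sum_(k < n.+1) nc (w' k.+1 - w' k) <= V.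
  rewrite big_ord_recr /= /w' minnn (minn_idPr _)// subrr nc0 addr0.
  apply: le_trans wV; rewrite ler_sum// => k _.
  by rewrite !(minn_idPl _)// ltnW.
by lra.
Qed.

(** Each exponential is an increment of the normalised Fresnel primitive plus a kernel weight times
    a forward difference, up to [O(1 / s)]. The frequency increases along the block within
    [[- pi, pi]], so the kernel has bounded variation there. *)
Lemma stat_block_sum t W : 0 < t -> 0 <= W -> exists2 C : R, 0 < C &
  forall s A (Pc Ps : R -> R) (a N : nat), 1 <= s -> W <= s / 2 -> (0 < a)%N ->
  A < - (W * Num.sqrt (2 * s)) -> fresnel_primitive t A Pc Ps ->
  (forall k, (k <= N)%N -> `|sqrt_dev s (a + k)%:R| <= W) ->
  (forall k, (k < N)%N -> `|stat_freq t s (a + k)%:R| <= pi) ->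
  nc (\sum_(k < N) expi (stat_phase t s (a + k)%:R) -
      (2 * Num.sqrt s)%:C * (Pc (stat_coord s (a + N)%:R) +i* Ps (stat_coord s (a + N)%:R)) +
      (2 * Num.sqrt s)%:C * (Pc (stat_coord s a%:R) +i* Ps (stat_coord s a%:R))) <= C.
Proof.
(* There are at most [6 W s] steps, each with error [(4 W + 10 t) / s]. Abel summation gives
   [16 = 2 * 4 + 8]: the kernel is at most 4 and its variation at most [2 pi <= 8]. *)
move=> t0 W0; exists (6 * W * (4 * W + 10 * t) + 16).
  by rewrite ltr_wpDl// !mulr_ge0// addr_ge0// mulr_ge0// ltW.
move=> s A Pc Ps a N s1 Ws a0 hA hP hw hv.
have s0 : 0 < s by lra.
pose G k := (2 * Num.sqrt s)%:C * (Pc (stat_coord s (a + k)%:R) +i* Ps (stat_coord s (a + k)%:R)).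
pose E k := expi (stat_phase t s (a + k)%:R).
pose v k := stat_freq t s (a + k)%:R.
rewrite -/(G N) -[a in X in _ + X]addn0 -/(G 0%N).
have natS k : (a + k.+1)%:R = (a + k)%:R + 1 :> R by rewrite addnS natr1.
have a1 k : 1 <= (a + k)%:R :> R by rewrite ler1n addn_gt0 a0.
have hwS k : (k < N)%N -> `|sqrt_dev s ((a + k)%:R + 1)| <= W by move=> kN; rewrite -natS; exact: hw.
have vS k : 0 <= v k.+1 - v k.
  rewrite /v natS /stat_freq /sqrt_dev -mulrBr; apply: mulr_ge0; first by rewrite mulr_ge0// ltW.
  by rewrite opprB addrA subrK subr_ge0 ler_wsqrtr// lerDl.
have step k : (k < N)%N -> nc (E k - (G k.+1 - G k) - sum_kernel (v k) * (E k.+1 - E k)) <= (4 * W + 10 * t) / s.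
  move=> kN.
  have h1 := stat_step_complex t0 s1 Ws (a1 k) (hw k (ltnW kN)) (hwS k kN) hA hP.
  rewrite -natS -/(G k) -/(G k.+1) -/(E k) -/(v k) in h1.
  have h2 : nc (expi (v k) * E k - E k.+1) <= 2 * (t / s).
    rewrite /E -expiD; apply: (le_trans (nc_expiB _ _)); rewrite ler_wpM2l//.
    have := @stat_phase_linear R t s (a + k)%:R ((a + k)%:R + 1) W t0 s1 Ws (a1 k) (hw k (ltnW kN)).
    rewrite lerDl lexx ler01 => /(_ isT); rewrite [X in _ * X](_ : _ = 1); last by ring.
    by rewrite mulr1 -natS distrC (addrC (v k)).
  have h3 := sum_kernel_bound (hv k kN).
  have -> : E k - (G k.+1 - G k) - sum_kernel (v k) * (E k.+1 - E k) =
    - (G k.+1 - G k - E k * expi_mean (v k)) + sum_kernel (v k) * (expi (v k) * E k - E k.+1).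
    have := sum_kernelE (hv k kN); rewrite -/(v k) => e.
    have -> : expi_mean (v k) = 1 - sum_kernel (v k) * (expi (v k) - 1) by rewrite -e; ring.
    by ring.
  apply: (le_trans (ncD _ _)); rewrite ncN ncM.
  have : nc (sum_kernel (v k)) * nc (expi (v k) * E k - E k.+1) <= 4 * (2 * (t / s)).
    by apply: ler_pM => //; exact: nc_ge0.
  rewrite (_ : (4 * W + 10 * t) / s = 2 * ((2 * W + t) / s) + 4 * (2 * (t / s))); last by ring.
  by lra.
have -> : \sum_(k < N) E k - G N + G 0%N =
  \sum_(k < N) (E k - (G k.+1 - G k) - sum_kernel (v k) * (E k.+1 - E k)) +
  \sum_(k < N) sum_kernel (v k) * (E k.+1 - E k).
  rewrite -big_split /=; under [RHS]eq_bigr => k _ do rewrite subrK.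
  rewrite sumrB -(big_mkord xpredT (fun k => G k.+1 - G k)) telescope_sumr//; ring.
apply: (le_trans (ncD _ _)); apply: lerD.
  apply: (le_trans (nc_sum _ _ _)).
  apply: (@le_trans _ _ (\sum_(k < N) (4 * W + 10 * t) / s)).
    by apply: ler_sum => k _; exact: step.
  rewrite sumr_const card_ord -[_ *+ _]mulr_natl.
  have hN : N%:R <= 6 * W * s.
    have := hw N (leqnn N); have := hw 0%N (leq0n N); rewrite addn0 /sqrt_dev !ler_norml.
    have r1 : Num.sqrt a%:R ^+ 2 = a%:R :> R by rewrite sqr_sqrtr.
    have r2 : Num.sqrt (a + N)%:R ^+ 2 = (a + N)%:R :> R by rewrite sqr_sqrtr.
    have r3 : 0 <= Num.sqrt a%:R :> R by [].
    have r4 : Num.sqrt a%:R <= Num.sqrt (a + N)%:R :> R by rewrite ler_wsqrtr// ler_nat leq_addr.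
    move: r1 r2 r3 r4; rewrite natrD; set u := Num.sqrt _; set u' := Num.sqrt _.
    move=> r1 r2 r3 r4 /andP[h1 h2] /andP[h3 h4].
    have -> : N%:R = (u' - u) * (u' + u) by rewrite -subr_sqr r1 r2; ring.
    rewrite (_ : 6 * W * s = 2 * W * (3 * s)); last by ring.
    by apply: ler_pM; lra.
  apply: (@le_trans _ _ (6 * W * s * ((4 * W + 10 * t) / s))); first by rewrite ler_wpM2r// divr_ge0 ?addr_ge0 ?mulr_ge0// ltW.
  by rewrite (_ : _ * _ = 6 * W * (4 * W + 10 * t))//; field; rewrite gt_eqF.
rewrite (_ : 16 = 1 * (2 * 4 + 8)); last by ring.
apply: (@abel_bound_lt (fun k => sum_kernel (v k)) E) => //.
- by move=> k _; rewrite nc_expi.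
- by move=> k kN; exact: sum_kernel_bound (hv k kN).
have pi4 : 2 * pi <= 8 :> R by have := pihalf_lt2 R; lra.
apply: (@le_trans _ _ (\sum_(k < N.-1) (v k.+1 - v k))).
  apply: ler_sum => k _; have kN : (k.+1 < N)%N by rewrite -ltn_predRL.
  by rewrite (le_trans (sum_kernel_lipschitz (hv _ kN) (hv k (ltnW kN))))// ger0_norm ?vS.
rewrite -(big_mkord xpredT (fun k => v k.+1 - v k)) telescope_sumr//.
apply: le_trans pi4.
have [N0|N0] := posnP N; first by rewrite N0 subrr mulr_ge0// pi_ge0.
have := hv 0%N N0; have := hv N.-1; rewrite prednK// leqnn => /(_ isT).
by rewrite -!/(v _) !ler_norml; lra.
Qed.

End StationaryBlockSum.

(** * Fresnel integrals *)

Section FresnelPrimitive.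
Context {R : realType}.
Implicit Types (t x A : R).

Lemma continuous_primitive (f : R -> R) (A : R) : continuous f ->
  exists F : R -> R, forall x, A < x -> is_derive x 1 F (f x).
Proof.
move=> cf; exists (fun x => \int[@lebesgue_measure R]_(y in `[A, x]) f y) => x Ax.
have int : (@lebesgue_measure R).-integrable `[A, x + 1] (EFin \o f).
  apply: continuous_compact_integrable; first exact: segment_compact.
  exact: continuous_subspaceT.
have [|d e] := @continuous_FTC1_closed R f A x (x + 1) _ int Ax (cf x); first by rewrite ltrDl.
apply: DeriveDef; first exact: d.
by rewrite -derive1E; exact: e.
Qed.

Lemma fresnel_primitive_exists t A : exists Pc Ps : R -> R, fresnel_primitive t A Pc Ps.
Proof.
have c1 : continuous (fun x : R => 3 / 2 * t * x ^+ 2).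
  by move=> x; apply: cvgMr; exact: exprn_continuous.
have [|Pc hc] := @continuous_primitive (fun x => cos (3 / 2 * t * x ^+ 2)) A.
  by move=> x; apply: continuous_comp; [exact: c1|exact: continuous_cos].
have [|Ps hs] := @continuous_primitive (fun x => sin (3 / 2 * t * x ^+ 2)) A.
  by move=> x; apply: continuous_comp; [exact: c1|exact: continuous_sin].
by exists Pc, Ps.
Qed.

(* Integration by parts: the derivative of P - sn(u v^2) / (2 u v) is sn(u v^2) / (2 u v^2). *)
Lemma oscillating_tail_pos (u X Y : R) (cs sn P : R -> R) : 0 < u -> 0 < X <= Y ->
  (forall x, is_derive x 1 sn (cs x)) -> (forall x, `|sn x| <= 1) ->
  (forall x, X <= x <= Y -> is_derive x 1 P (cs (u * x ^+ 2))) ->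
  `|P Y - P X| <= 2 / (u * X).
Proof.
move=> u0 /andP[X0 XY] dsn sn1 dP.
have Y0 : 0 < Y by lra.
pose g x := sn (u * x ^+ 2) / (2 * u * x).
have der x : X <= x <= Y -> is_derive x 1 (P - g) (sn (u * x ^+ 2) / (2 * u * x ^+ 2)).
  move=> h; have x0 : 0 < x by lra.
  have xn0 : x != 0 by rewrite gt_eqF.
  have un0 : u != 0 by rewrite gt_eqF.
  have h0 := dP x h.
  have h1 : is_derive x 1 (fun x => u * x ^+ 2) (2 * u * x).
    by apply: is_derive_eq; rewrite /GRing.scale/=; ring.
  have h2 : is_derive x 1 (sn \o (fun x => u * x ^+ 2)) (cs (u * x ^+ 2) * (2 * u * x)).
    exact: is_derive1_comp.
  have h3 : is_derive x 1 (fun x : R => (id x)^-1) (- x ^- 2 *: 1) by exact: is_deriveV.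
  have -> : g = (2 * u)^-1 \*o ((sn \o (fun x => u * x ^+ 2)) * (fun x : R => (id x)^-1)).
    apply/funext => y; rewrite /g.
    change (sn (u * y ^+ 2) / (2 * u * y) = (2 * u)^-1 * (sn (u * y ^+ 2) * y^-1)).
    by rewrite (invfM (2 * u) y); ring.
  apply: is_derive_eq; rewrite /GRing.scale/= /GRing.scale/=.
  by field; rewrite xn0 un0.
have B x : X <= x <= Y -> `|g x| <= (2 * u * X)^-1.
  move=> h; rewrite normrM normfV (ger0_norm (_ : 0 <= 2 * u * x)); last by rewrite !mulr_ge0; lra.
  rewrite -[leRHS]mul1r; apply: ler_pM => //; first by rewrite invr_ge0 !mulr_ge0; lra.
  by rewrite lef_pV2 ?posrE ?mulr_gt0 ?ler_pM2l ?mulr_gt0//; lra.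
have := @mvt_dominated R (P - g) (fun x => sn (u * x ^+ 2) / (2 * u * x ^+ 2))
  (fun x => - (2 * u)^-1 * x^-1) (fun x => (2 * u * x ^+ 2)^-1) X Y XY der.
have hM x : X <= x <= Y -> is_derive x 1 (fun x : R => - (2 * u)^-1 * x^-1) (2 * u * x ^+ 2)^-1.
  move=> h; have x0 : x != 0 by rewrite gt_eqF//; lra.
  have un0 : u != 0 by rewrite gt_eqF.
  have h3 : is_derive x 1 (fun x : R => (id x)^-1) (- x ^- 2 *: 1) by exact: is_deriveV.
  by apply: is_derive_eq; rewrite /GRing.scale/=; field; rewrite x0 un0.
move=> /(_ hM) H.
have : `|(P - g) Y - (P - g) X| <= - (2 * u)^-1 * Y^-1 - - (2 * u)^-1 * X^-1.
  apply: H => x h; have x0 : 0 < x by lra.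
  rewrite normrM normfV (ger0_norm (_ : 0 <= 2 * u * x ^+ 2)); last by rewrite !mulr_ge0//; lra.
  by rewrite ler_piMl ?invr_ge0 ?mulr_ge0//; lra.
have := B X; have := B Y; rewrite !lexx XY => /(_ isT) b1 /(_ isT) b2.
have e : (2 * u * X)^-1 = (2 * u)^-1 * X^-1 by rewrite invfM.
have e2 : 2 / (u * X) = 4 * ((2 * u)^-1 * X^-1) by field; rewrite !gt_eqF.
have : 0 <= (2 * u)^-1 * Y^-1 by rewrite mulr_ge0 ?invr_ge0 ?mulr_ge0//; lra.
rewrite e in b1 b2; rewrite e2; move: b1 b2.
have : 0 <= (2 * u)^-1 * X^-1 by rewrite mulr_ge0 ?invr_ge0 ?mulr_ge0//; lra.
move: ((2 * u)^-1) => w; rewrite !ler_norml /= /GRing.sub_fun /=.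
rewrite !fctE; set p1 := P X; set p2 := P Y; set g1 := g X; set g2 := g Y.
set a := w * X^-1; set b := w * Y^-1; rewrite !mulNr -/a -/b.
by move=> *; apply/andP; split; lra.
Qed.

Lemma oscillating_tail_neg (u X Y : R) (cs sn P : R -> R) : 0 < u -> 0 < X <= Y ->
  (forall x, is_derive x 1 sn (cs x)) -> (forall x, `|sn x| <= 1) ->
  (forall x, - Y <= x <= - X -> is_derive x 1 P (cs (u * x ^+ 2))) ->
  `|P (- Y) - P (- X)| <= 2 / (u * X).
Proof.
move=> u0 XY dsn sn1 dP.
have := @oscillating_tail_pos u X Y cs sn (fun x => - P (- x)) u0 XY dsn sn1.
rewrite -opprD normrN; apply => x h.
have h1 : is_derive x 1 (fun x : R => - x) (-1).
  by apply: is_derive_eq.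
have h2 : is_derive x 1 (P \o (fun x => - x)) (cs (u * x ^+ 2) * -1).
  by apply: is_derive1_comp; rewrite -(sqrrN x); apply: dP; lra.
rewrite (_ : (fun x => - P (- x)) = - (P \o (fun x => - x)))//.
by apply: is_derive_eq; rewrite mulrN1 opprK.
Qed.

Lemma fresnel_tail t A (Pc Ps : R -> R) (X Y : R) : 0 < t -> fresnel_primitive t A Pc Ps ->
  0 < X <= Y -> A < - Y ->
  nc ((Pc Y +i* Ps Y) - (Pc X +i* Ps X)) <= 4 / (t * X) /\
  nc ((Pc (- Y) +i* Ps (- Y)) - (Pc (- X) +i* Ps (- X))) <= 4 / (t * X).
Proof.
move=> t0 [hc hs] XY AY.
have u0 : 0 < 3 / 2 * t by rewrite mulr_gt0.
have c1 (x : R) : `|sin x| <= 1 by exact: sin_max.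
have s1 (x : R) : `|- cos x| <= 1 by rewrite normrN; exact: cos_max.
have d1 (x : R) : is_derive x 1 (@sin R) (cos x) by exact: is_derive_sin.
have d2 (x : R) : is_derive x 1 (fun x : R => - cos x) (sin x).
  by apply: is_derive_eq; rewrite opprK.
have /andP[X0 XY'] := XY.
have e : 2 / (3 / 2 * t * X) + 2 / (3 / 2 * t * X) <= 4 / (t * X).
  rewrite (_ : 2 / (3 / 2 * t * X) = 4 / 3 / (t * X)); last by field; rewrite !gt_eqF.
  by rewrite -mulrDl ler_pM2r ?invr_gt0 ?mulr_gt0//; lra.
split; apply: (le_trans (nc_ReIm _)); apply: le_trans e; rewrite ReB ImB /=; apply: lerD.
- by apply: (@oscillating_tail_pos _ _ _ cos sin) => // x h; apply: hc; lra.
- by apply: (@oscillating_tail_pos _ _ _ sin (fun x => - cos x)) => // x h; apply: hs; lra.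
- by apply: (@oscillating_tail_neg _ _ _ cos sin) => // x h; apply: hc; lra.
- by apply: (@oscillating_tail_neg _ _ _ sin (fun x => - cos x)) => // x h; apply: hs; lra.
Qed.

(** The two tails beyond 1 give [8 / t], and on [[- 1, 1]] the real and imaginary parts are at most
    2 each. *)
Lemma fresnel_bound t A (Pc Ps : R -> R) (X : R) : 0 < t -> fresnel_primitive t A Pc Ps ->
  0 < X -> A < - X ->
  nc ((Pc X +i* Ps X) - (Pc (- X) +i* Ps (- X))) <= 8 / t + 4.
Proof.
move=> t0 hP X0 AX.
have mid Y : 0 < Y <= 1 -> A < - Y -> nc ((Pc Y +i* Ps Y) - (Pc (- Y) +i* Ps (- Y))) <= 4.
  move=> /andP[Y0 Y1] AY; case: hP => hc hs.
  have m1 : Num.min (- Y) Y = - Y by apply/min_idPl; lra.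
  have m2 : Num.max (- Y) Y = Y by apply/max_idPr; lra.
  have e : `|Y - - Y| <= 2 by rewrite opprK ger0_norm; lra.
  apply: (le_trans (nc_ReIm _)); rewrite ReB ImB /=.
  have h1 : `|Pc Y - Pc (- Y)| <= 1 * `|Y - - Y|.
    apply: (@mvt_lipschitz R Pc (fun x => cos (3 / 2 * t * x ^+ 2))); rewrite m1 m2 => x h.
      by apply: hc; lra.
    exact: cos_max.
  have h2 : `|Ps Y - Ps (- Y)| <= 1 * `|Y - - Y|.
    apply: (@mvt_lipschitz R Ps (fun x => sin (3 / 2 * t * x ^+ 2))); rewrite m1 m2 => x h.
      by apply: hs; lra.
    exact: sin_max.
  by lra.
have t80 : 0 <= 8 / t by rewrite divr_ge0// ltW.
have [X1|X1] := leP X 1; first by rewrite (le_trans (mid X _ AX)) ?X0//; lra.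
have [h1 h2] := @fresnel_tail t A Pc Ps 1 X t0 hP (ltac:(rewrite ltr01 /=; exact: ltW)) AX.
have h3 := mid 1 (ltac:(by rewrite ltr01 lexx)) (ltac:(lra)).
rewrite mulr1 in h1 h2.
set f := (fun y => Pc y +i* Ps y) in h1 h2 h3 *.
have : nc (f X - f (- X)) <= nc (f X - f 1) + (nc (f 1 - f (- 1)) + nc (f (- 1) - f (- X))).
  apply: (le_trans (nc_triangle _ (f 1) _)); rewrite lerD2l; exact: nc_triangle.
rewrite (ncBC (f (- 1))) -/(f X) -/(f (- X)) (_ : 8 / t = 4 / t + 4 / t); last by field; rewrite gt_eqF.
rewrite -/(f X) -/(f 1) in h1; rewrite -/(f (- X)) -/(f (- 1)) in h2; rewrite -/(f 1) -/(f (-1)) in h3.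
by lra.
Qed.

End FresnelPrimitive.

(** * The dispersive exponential sum *)

Section DispersiveExponentialSum.
Context {R : realType}.
Implicit Types (t x s : R).

Definition disp_phase t x (n : nat) : R := t * Num.sqrt n%:R ^+ 3 + x * n%:R.

(** Subtracting [2 pi m n] from the phase does not affect the exponential at an integer [n], and
    makes [s ^ 2] the stationary point. *)
Lemma disp_phase_split t x s (m : int) (n : nat) : 3 / 2 * t * s + x = 2 * pi * m%:~R ->
  expi (disp_phase t x n) = expi (- (t * s ^+ 3 / 2)) * expi (stat_phase t s n%:R).
Proof.
move=> e; rewrite -expiD -[RHS]mulr1 -(expi2piz (m * n%:Z)) -expiD; congr expi.
rewrite intrM (mulrA (2 * pi)) -e /disp_phase /stat_phase /sqrt_dev.
have : n%:R = Num.sqrt n%:R ^+ 2 :> R by rewrite sqr_sqrtr.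
rewrite -[n%:~R]/(n%:R); move: (Num.sqrt _) => u ->.
by field.
Qed.

Lemma nc_sum_nat_le (f : nat -> R) (a b : nat) :
  nc (\sum_(a <= n < b) expi (f n)) <= (b - a)%:R.
Proof.
apply: (le_trans (nc_sum _ _ _)); under eq_bigr do rewrite nc_expi.
by rewrite sumr_const_nat.
Qed.

Lemma sum_nat_shift (V : nmodType) (f : nat -> V) (a b : nat) :
  \sum_(a <= n < b) f n = \sum_(k < b - a) f (a + k)%N.
Proof.
rewrite -{1}[a]add0n big_addn big_mkord; apply: eq_bigr => k _; by rewrite addnC.
Qed.

Lemma sum_consecutive_blocks (B : nat -> nat) (f : nat -> R[i]) K :
  (forall k, (B k <= B k.+1)%N) ->
  \sum_(B 0 <= n < B K) f n = \sum_(k < K) \sum_(B k <= n < B k.+1) f n.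
Proof.
move=> hB; elim: K => [|K ih]; first by rewrite big_geq// big_ord0.
rewrite big_ord_recr /= -ih -big_cat_nat//=.
by elim: K {ih} => // K ih; exact: leq_trans ih (hB K).
Qed.

Lemma sqrt_ceil_bounds (rho r y : R) : 1 <= rho -> rho <= r -> r ^+ 2 <= y < r ^+ 2 + 1 ->
  r <= Num.sqrt y <= r + 1 / rho.
Proof.
move=> rho1 rr /andP[y1 y2].
have y0 : 0 <= y by exact: le_trans (sqr_ge0 _) y1.
have h0 : 0 <= 1 / rho by rewrite divr_ge0//; lra.
have h1 : 1 <= 1 / rho * r by rewrite mul1r mulrC ler_pdivlMr ?mul1r//; lra.
have r0 : 0 <= r by lra.
have rr0 : 0 <= r + 1 / rho by lra.
apply/andP; split; rewrite -ler_sqr ?nnegrE ?sqrtr_ge0// sqr_sqrtr//.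
by apply: (le_trans (ltW y2)); have := sqr_ge0 (1 / rho); lra.
Qed.

Lemma stat_coord_low (c rho s w : R) : 0 < c -> 1 <= rho -> rho <= s - c ->
  c / 2 <= `|w| -> - c <= w -> c / 4 * Num.sqrt rho <= `|w * Num.sqrt (s + 2 / 3 * w)|.
Proof.
move=> c0 rho1 rs w1 w2.
rewrite normrM (ger0_norm (sqrtr_ge0 _)) (_ : c / 4 * _ = c / 2 * (Num.sqrt rho / 2)); last by field.
have c2 : 0 <= c / 2 by rewrite ltW// divr_gt0.
have r2 : 0 <= Num.sqrt rho / 2 by rewrite divr_ge0.
apply: (ler_pM c2 r2 w1).
have -> : Num.sqrt rho / 2 = Num.sqrt (rho / 4).
  by rewrite -[LHS]ger0_norm// -sqrtr_sqr exprMn exprVn sqr_sqrtr; [congr Num.sqrt; field|lra].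
by rewrite ler_wsqrtr//; lra.
Qed.

(** [c] solves [3 / 2 t c = pi]: the frequency reaches [pi] in modulus at [(s - c) ^ 2] and
    [(s + c) ^ 2]. The ends have coordinates of order [sqrt rho]; moving them to [X] and [- X] costs
    [sqrt s] times a tail [4 / (t X)], hence [O(1)]. Afterwards all blocks share the same Fresnel
    integral. *)
Lemma disp_block_sum t : 0 < t -> let c := 2 * pi / (3 * t) in exists2 C : R, 0 < C &
  forall (rho s A : R) (Pc Ps : R -> R) (a b : nat),
  1 <= rho -> 2 * (c + 1) <= rho -> 2 / c <= rho -> rho <= s - c -> s <= 4 * rho ->
  (s - c) ^+ 2 <= a%:R < (s - c) ^+ 2 + 1 -> (s + c) ^+ 2 <= b%:R < (s + c) ^+ 2 + 1 ->
  (a <= b)%N ->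
  A < - ((c + 1) * Num.sqrt (2 * (4 * rho))) -> fresnel_primitive t A Pc Ps ->
  forall X, X = c / 4 * Num.sqrt rho ->
  nc (\sum_(a <= n < b) expi (stat_phase t s n%:R) -
      (2 * Num.sqrt s)%:C * ((Pc X +i* Ps X) - (Pc (- X) +i* Ps (- X)))) <= C.
Proof.
move=> t0 c.
have c0 : 0 < c by rewrite divr_gt0 ?mulr_gt0 ?pi_gt0.
have cE : pi = 3 / 2 * t * c by rewrite /c; field; rewrite gt_eqF.
clearbody c.
have [C C0 HC] := @stat_block_sum R t (c + 1) t0 (ltac:(lra)).
exists (C + 128 / (t * c)).
  by rewrite addr_gt0// divr_gt0// mulr_gt0.
move=> rho s A Pc Ps a b rho1 rhoc rhoc2 rs s4 hab1 hab2 ab hA hP X XE.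
have r0 : 0 < s - c by clear -rho1 rs; lra.
have rho2 : 1 / rho <= c / 2.
  clear -rho1 rhoc2 c0; rewrite ler_pdivrMr; last lra.
  by move: rhoc2; rewrite ler_pdivrMr//; lra.
have rho3 : 1 / rho <= 1 by rewrite ler_pdivrMr ?mul1r//; clear -rho1; lra.
have /andP[sa1 sa2] := sqrt_ceil_bounds rho1 rs hab1.
have rs' : rho <= s + c by clear -rs c0; lra.
have /andP[sb1 sb2] := sqrt_ceil_bounds rho1 rs' hab2.
have a1 : (s - c) ^+ 2 <= a%:R by have /andP[] := hab1.
have b2 : b%:R < (s + c) ^+ 2 + 1 by have /andP[] := hab2.
have a0 : (0 < a)%N by rewrite -(ltr0n R); clear -r0 a1; nra.
have sq n : (a <= n <= b)%N -> Num.sqrt (a%:R : R) <= Num.sqrt (n%:R : R) <= Num.sqrt (b%:R : R).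
  by move=> /andP[h1 h2]; rewrite !ler_wsqrtr ?ler_nat ?h1.
have W s' : s' <= 4 * rho -> Num.sqrt (2 * s') <= Num.sqrt (2 * (4 * rho)).
  by move=> h; rewrite ler_wsqrtr// ler_wpM2l.
have hA' : A < - ((c + 1) * Num.sqrt (2 * s)).
  by apply: (lt_le_trans hA); rewrite lerN2 ler_wpM2l ?W//; clear -c0; lra.
have hw n : (a <= n <= b)%N -> `|sqrt_dev s n%:R| <= c + 1.
  by move=> /sq; rewrite /sqrt_dev ler_norml => /andP[h1 h2]; clear -h1 h2 sa1 sb2 rho3 c0; apply/andP; split; lra.
have s1 : 1 <= s by clear -rho1 rs c0; lra.
have cs2 : c + 1 <= s / 2 by clear -rhoc rs c0; lra.
have := HC s A Pc Ps a (b - a)%N s1 cs2 a0 hA' hP.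
rewrite subnKC//.
have h1 k : (k <= b - a)%N -> `|sqrt_dev s (a + k)%:R| <= c + 1 by move=> hk; apply: hw; clear -hk ab; lia.
have h2 k : (k < b - a)%N -> `|stat_freq t s (a + k)%:R| <= pi.
  move=> hk; have hk2 : (a + k < b)%N by clear -hk ab; lia.
  rewrite /stat_freq normrM ger0_norm; last by rewrite mulr_ge0// ltW.
  rewrite cE ler_pM2l ?mulr_gt0// /sqrt_dev ler_norml.
  have /andP[q1 _] := sq (a + k)%N (ltac:(rewrite leq_addr /=; exact: ltnW)).
  have : Num.sqrt (a + k)%:R <= s + c.
    rewrite -(@ler_sqr _ _) ?nnegrE//; last by clear -r0 c0; lra.
    rewrite sqr_sqrtr//; have : (a + k)%:R + 1 <= b%:R :> R by rewrite natr1 ler_nat.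
    by clear -b2; lra.
  by move=> q2; clear -q1 q2 sa1; apply/andP; split; lra.
move=> /(_ h1 h2).
have -> : \sum_(k < b - a) expi (stat_phase t s (a + k)%:R) = \sum_(a <= n < b) expi (stat_phase t s n%:R).
  by rewrite sum_nat_shift.
set S := \sum_(a <= n < b) _.
set f := (fun y => Pc y +i* Ps y).
change (nc (S - (2 * Num.sqrt s)%:C * f (stat_coord s b%:R) + (2 * Num.sqrt s)%:C * f (stat_coord s a%:R)) <= C ->
  nc (S - (2 * Num.sqrt s)%:C * (f X - f (- X))) <= C + 128 / (t * c)).
move=> hS.
clear HC h1 h2 a1 b2 hab1 hab2 W hA' a0 cE.
have sr0 : 0 < Num.sqrt rho by rewrite sqrtr_gt0; clear -rho1; lra.
have X0 : 0 < X by rewrite XE !mulr_gt0 ?invr_gt0.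
have s4r : Num.sqrt s <= 2 * Num.sqrt rho.
  clear -s4 rho1; rewrite -[leRHS]ger0_norm ?mulr_ge0// -sqrtr_sqr exprMn sqr_sqrtr; last lra.
  by rewrite ler_wsqrtr//; lra.
have coord n : (a <= n <= b)%N -> `|stat_coord s n%:R| <= (c + 1) * Num.sqrt (2 * (4 * rho)).
  move=> h; have := hw n h; have hh := hw n h.
  rewrite /stat_coord normrM (ger0_norm (sqrtr_ge0 _)) => h3; apply: ler_pM => //.
  by rewrite ler_wsqrtr//; move: hh; rewrite ler_norml; clear -rhoc rs s4 c0; lra.
have low (w : R) : c / 2 <= `|w| -> - c <= w -> X <= `|w * Num.sqrt (s + 2 / 3 * w)|.
  by rewrite XE; exact: stat_coord_low.
have qb : X <= stat_coord s b%:R.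
  have wb : c <= sqrt_dev s b%:R by rewrite /sqrt_dev; clear -sb1; lra.
  have : 0 <= stat_coord s b%:R by rewrite /stat_coord mulr_ge0// (le_trans _ wb)// ltW.
  move=> /ger0_norm <-; apply: low; last by clear -wb c0; lra.
  by clear -wb c0; rewrite ger0_norm; lra.
have qa : X <= - stat_coord s a%:R.
  have wa : sqrt_dev s a%:R <= - (c / 2) by rewrite /sqrt_dev; clear -sa2 rho2; lra.
  have : stat_coord s a%:R <= 0 by rewrite /stat_coord mulr_le0_ge0//; clear -wa c0; lra.
  move=> /ler0_norm <-; apply: low; last by rewrite /sqrt_dev; clear -sa1; lra.
  by clear -wa c0; rewrite ler0_norm; lra.
have cb := coord b (ltac:(by rewrite ab leqnn)).
have ca := coord a (ltac:(by rewrite ab leqnn)).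
have [tb _] := @fresnel_tail R t A Pc Ps X (stat_coord s b%:R) t0 hP (ltac:(by rewrite X0))
   (ltac:(move: cb; rewrite ler_norml; clear -hA; lra)).
have [_ ta] := @fresnel_tail R t A Pc Ps X (- stat_coord s a%:R) t0 hP (ltac:(by rewrite X0))
   (ltac:(move: ca; rewrite ler_norml; clear -hA; lra)).
rewrite opprK in ta.
have tb' : nc (f (stat_coord s b%:R) - f X) <= 4 / (t * X) := tb.
have ta' : nc (f (stat_coord s a%:R) - f (- X)) <= 4 / (t * X) := ta.
have -> : S - (2 * Num.sqrt s)%:C * (f X - f (- X)) =
   (S - (2 * Num.sqrt s)%:C * f (stat_coord s b%:R) + (2 * Num.sqrt s)%:C * f (stat_coord s a%:R)) +
   ((2 * Num.sqrt s)%:C * (f (stat_coord s b%:R) - f X) - (2 * Num.sqrt s)%:C * (f (stat_coord s a%:R) - f (- X))).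
  by ring.
apply: (le_trans (ncD _ _)); apply: lerD => //.
apply: (le_trans (ncB _ _)); rewrite !ncM nc_real ger0_norm ?mulr_ge0// -mulrDr.
have -> : 128 / (t * c) = 4 * Num.sqrt rho * (4 / (t * X) + 4 / (t * X)).
  by rewrite XE; field; rewrite !gt_eqF.
by apply: ler_pM; rewrite ?mulr_ge0 ?addr_ge0 ?nc_ge0 ?lerD//; clear -s4r; lra.
Qed.

End DispersiveExponentialSum.

(** * Assembling the blocks *)

Section DispersiveExponentialSum.
Context {R : realType}.
Implicit Types (t x : R).

Definition ceil_sqr (r : R) : nat := `|Num.ceil (r ^+ 2)|%N.

Lemma ceil_sqr_itv (r : R) : r ^+ 2 <= (ceil_sqr r)%:R < r ^+ 2 + 1.
Proof.
have := ceil_itv (r ^+ 2); rewrite intrD => /andP[h1 h2].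
have c0 : 0 <= Num.ceil (r ^+ 2) by rewrite ceil_ge0 (lt_le_trans _ (sqr_ge0 r))// ltrN10.
have -> : (ceil_sqr r)%:R = (Num.ceil (r ^+ 2))%:~R :> R.
  by rewrite /ceil_sqr -[in RHS](gez0_abs c0).
by rewrite h2 /=; lra.
Qed.

Lemma nc_sum_conj (f : nat -> R) K :
  nc (\sum_(k < K) expi (- f k)) = nc (\sum_(k < K) expi (f k)).
Proof.
rewrite -[RHS]nc_conj (raddf_sum (@conjc R)); congr nc.
by apply: eq_bigr => k _; rewrite expi_conj.
Qed.

(* The blocks are the ranges where the frequency is within pi of a multiple of 2 pi; the block sums
   assemble into a cubic Weyl sum of length of order sqrt N. *)
Lemma disp_complete_blocks t (e : R) : 0 < t ->
  Khinchin_Levy (4 / 27 * (t / (2 * pi)) ^- 2) -> 0 < e ->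
  let c := 2 * pi / (3 * t) in exists2 C : R, 0 < C &
  forall x (rho th : R) (m0 : int) (K : nat),
  1 <= rho -> 2 * (c + 1) <= rho -> 2 / c <= rho ->
  th = m0%:~R - x / (2 * pi) -> rho <= 2 * c * th - c -> 2 * c * (K%:R + th) <= 3 * rho ->
  nc (\sum_(k < K) \sum_(ceil_sqr (2 * c * (k%:R + th) - c) <= n <
                         ceil_sqr (2 * c * (k.+1%:R + th) - c)) expi (disp_phase t x n))
  <= C * rho `^ (5 / 4 + e).
Proof.
move=> t0 KL e0 c.
have c0 : 0 < c by rewrite divr_gt0 ?mulr_gt0 ?pi_gt0.
have [Cw Cw0 HW] := khinchin_levy_cubic_sum KL e0.
have [Cb Cb0 HB] := disp_block_sum t0; rewrite -/c in HB.
have cE : c = 2 * pi / (3 * t) by [].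
clearbody c.

(* Blocks have width [2 c] in the square root of the index, which stays of order [rho], so there are
   at most [c5 * rho] of them. The summand 1 ensures [c5 * rho >= 1], which absorbs the rounding in
   [M]. *)
pose c5 := 3 / (2 * c) + 1.
have c50 : 0 < c5 by rewrite addr_gt0// divr_gt0// mulr_gt0.
pose Kb := 8 / t + 4.
have Kb0 : 0 < Kb by rewrite addr_gt0// divr_gt0.
pose C1 := 2 * Kb * (Cw * (2 * c5) `^ (3 / 4 + e) * 8).
have C10 : 0 < C1 by rewrite /C1 !mulr_gt0 ?powR_gt0 ?mulr_gt0.
exists (C1 + c5 * Cb); first by rewrite addr_gt0// mulr_gt0.
move=> x rho th m0 K rho1 rhoc rhoc2 thE rth K3.
have rho0 : 0 < rho by lra.
pose s k : R := 2 * c * (k%:R + th).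
have sS k : s k.+1 = s k + 2 * c.
  by rewrite /s -[k.+1%:R]natr1; ring.
have s_lo k : rho <= s k - c.
  have : 0 <= 2 * c * k%:R by rewrite !mulr_ge0// ltW.
  by rewrite /s mulrDr; clear -rth; lra.
have s_mono k k' : (k <= k')%N -> s k <= s k'.
  move=> kk; rewrite /s ler_pM2l ?lerD2r ?ler_nat// mulr_gt0//.
have s_hi k : (k <= K)%N -> s k <= 3 * rho.
  by move=> kK; apply: le_trans K3; exact: s_mono.
(* Below the coordinates of all blocks, so that one pair of primitives serves them all. *)
pose A : R := - ((c + 1) * Num.sqrt (2 * (4 * rho))) - 1.
have [Pc [Ps hP]] := fresnel_primitive_exists t A.
pose X := c / 4 * Num.sqrt rho.
have X0 : 0 < X by rewrite !mulr_gt0 ?invr_gt0 ?sqrtr_gt0.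
have hA : A < - ((c + 1) * Num.sqrt (2 * (4 * rho))) by rewrite /A; lra.
have AX : A < - X.
  have h1 : Num.sqrt rho <= Num.sqrt (2 * (4 * rho)) by rewrite ler_wsqrtr//; clear -rho0; lra.
  have h2 : c / 4 * Num.sqrt rho <= (c + 1) * Num.sqrt (2 * (4 * rho)).
    apply: ler_pM => //; first by rewrite ltW// divr_gt0.
    by clear -c0; lra.
  by rewrite /A /X; clear -h2; lra.
pose D := (Pc X +i* Ps X) - (Pc (- X) +i* Ps (- X)).
have hD : nc D <= Kb := fresnel_bound t0 hP X0 AX.
pose E (k : nat) := expi (- (2 * pi * (4 / 27 * (t / (2 * pi)) ^- 2) * (k%:R + th) ^+ 3)) : R[i].
pose T k := \sum_(ceil_sqr (s k - c) <= n < ceil_sqr (s k.+1 - c)) expi (disp_phase t x n).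
have blk k : (k < K)%N -> nc (T k - E k * ((2 * Num.sqrt (s k))%:C * D)) <= Cb.
  move=> kK.
  have sk : s k.+1 - c = s k + c by rewrite sS; ring.
  have i1 := ceil_sqr_itv (s k - c); have i2 := ceil_sqr_itv (s k.+1 - c).
  have ab : (ceil_sqr (s k - c) <= ceil_sqr (s k.+1 - c))%N.
    rewrite -ltnS -(ltr_nat R) -natr1.
    have /andP[_ u1] := i1; have /andP[u2 _] := i2.
    have : (s k - c) ^+ 2 <= (s k.+1 - c) ^+ 2.
      rewrite ler_sqr ?nnegrE.
      - by rewrite lerD2r s_mono.
      - by rewrite (le_trans _ (s_lo k))// ltW.
      - by rewrite (le_trans _ (s_lo k.+1))// ltW.
    by clear -u1 u2; lra.
  have s4 : s k <= 4 * rho by have := s_hi k (ltnW kK); clear -rho0; lra.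
  have := HB rho (s k) A Pc Ps _ _ rho1 rhoc rhoc2 (s_lo k) s4 i1.
  rewrite -sk => /(_ _ i2 ab hA hP X erefl).
  (* [s k] is the stationary point for the multiple [m0 + k] of [2 pi]. By the choice of [c],
     [t (s k) ^ 3 / 2] is then [2 pi beta (k + th) ^ 3]. *)
  have freq : 3 / 2 * t * s k + x = 2 * pi * (m0 + k%:Z)%:~R.
    have pn : (pi : R) != 0 by rewrite gt_eqF ?pi_gt0.
    have tn : t != 0 by rewrite gt_eqF.
    rewrite intrD -[k%:~R]/(k%:R) /s thE cE; move: (pi : R) pn => p pn.
    by field; rewrite ?pn ?tn.
  have -> : T k = E k * \sum_(ceil_sqr (s k - c) <= n < ceil_sqr (s k.+1 - c)) expi (stat_phase t (s k) n%:R).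
    rewrite mulr_sumr; apply: eq_bigr => n _; rewrite (disp_phase_split n freq); congr (expi _ * _).
    have pn : (pi : R) != 0 by rewrite gt_eqF ?pi_gt0.
    have tn : t != 0 by rewrite gt_eqF.
    by rewrite /s cE; move: (pi : R) pn => p pn; field; rewrite ?pn ?tn.
  by rewrite -mulrBr ncM nc_expi mul1r.
change (nc (\sum_(k < K) T k) <= (C1 + c5 * Cb) * rho `^ (5 / 4 + e)).
(* An error [O(1)] per block, and the common factor [D] times a cubic Weyl sum with weights
   [sqrt (s k)]. Removing the weights by Abel summation costs [sqrt rho], whence the exponent
   [3 / 4 + 1 / 2 = 5 / 4]. *)
have -> : \sum_(k < K) T k = \sum_(k < K) (T k - E k * ((2 * Num.sqrt (s k))%:C * D)) +
    2%:R%:C * D * \sum_(k < K) (Num.sqrt (s k))%:C * E k.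
  rewrite mulr_sumr -big_split /=; apply: eq_bigr => k _.
  rewrite (realCM 2); ring.
have hK : K%:R <= c5 * rho.
  have : 2 * c * K%:R <= 3 * rho by have := s_lo 0%N; move: K3; rewrite /s mulrDr mulrDr mulr0; clear -c0 rho0; lra.
  move=> h; rewrite /c5; have : K%:R <= 3 / (2 * c) * rho.
    by rewrite mulrAC ler_pdivlMr ?mulr_gt0// mulrC.
  by clear -rho0; lra.
have rhoe : rho <= rho `^ (5 / 4 + e).
  by rewrite -[leLHS]powRr1 ?(ltW rho0)// ler_powR//; clear -e0; lra.
rewrite [leRHS]mulrDl; apply: (le_trans (ncD _ _)); rewrite addrC; apply: lerD; last first.
  apply: (le_trans (nc_sum _ _ _)); apply: (@le_trans _ _ (\sum_(k < K) Cb)).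
    by apply: ler_sum => k _; exact: blk.
  rewrite sumr_const card_ord -[_ *+ _]mulr_natl mulrAC ler_pM2r//.
  by apply: (le_trans hK); rewrite ler_pM2l.
rewrite !ncM nc_real ger0_norm//.
pose M := (Num.truncn (c5 * rho)).+1.
have KM : (K <= M)%N by rewrite /M ltnW// ltnS truncn_ge_nat// mulr_ge0// ltW.
have ml : M%:R <= 2 * c5 * rho.
  have h1 : (Num.truncn (c5 * rho))%:R <= c5 * rho by rewrite truncn_le mulr_ge0// ltW.
  have h2 : 1 <= c5 * rho.
    rewrite -[leLHS]mulr1; apply: ler_pM => //.
    by rewrite /c5 lerDr ltW// divr_gt0// mulr_gt0.
  by rewrite /M -natr1; clear -h1 h2; lra.
have Weyl k : (k <= K)%N -> nc (\sum_(j < k) E j) <= Cw * M%:R `^ (3 / 4 + e).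
  move=> kK; rewrite (nc_sum_conj (fun j => 2 * pi * (4 / 27 * (t / (2 * pi)) ^- 2) * (j%:R + th) ^+ 3)).
  by apply: HW => //; exact: leq_trans KM.
have := @abel_monotone R (fun k => Num.sqrt (s k)) E K (Cw * M%:R `^ (3 / 4 + e)) (fun k _ => sqrtr_ge0 _)
  (or_introl (fun k _ => ler_wsqrtr (s_mono k k.+1 (leqnSn k)))) Weyl.
set S := nc _ => hS.
have sq k : (k <= K)%N -> Num.sqrt (s k) <= 2 * Num.sqrt rho.
  move=> kK; have := s_hi k kK; clear -rho0 => h.
  rewrite -[leRHS]ger0_norm ?mulr_ge0// -sqrtr_sqr exprMn sqr_sqrtr; last lra.
  by rewrite ler_wsqrtr//; lra.
have hM : M%:R `^ (3 / 4 + e) <= (2 * c5) `^ (3 / 4 + e) * rho `^ (3 / 4 + e).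
  rewrite -powRM ?mulr_ge0 ?(ltW c50) ?(ltW rho0)//; apply: powR_le => //.
  by clear -e0; lra.
have hS2 : S <= Cw * ((2 * c5) `^ (3 / 4 + e) * rho `^ (3 / 4 + e)) * (8 * Num.sqrt rho).
  apply: (le_trans hS); apply: ler_pM.
  - by rewrite mulr_ge0 ?powR_ge0// ltW.
  - by rewrite mulr_ge0// addr_ge0.
  - by rewrite ler_wpM2l// ltW.
  - have := sq K (leqnn K); have := sq 0%N (leq0n K); lra.
have rE : rho `^ (5 / 4 + e) = rho `^ (3 / 4 + e) * Num.sqrt rho.
  rewrite -powR12_sqrt ?(ltW rho0)// -powRDp//; congr (_ `^ _); clear; lra.
rewrite rE /C1.
have -> : 2 * Kb * (Cw * (2 * c5) `^ (3 / 4 + e) * 8) * (rho `^ (3 / 4 + e) * Num.sqrt rho) =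
  2 * Kb * (Cw * ((2 * c5) `^ (3 / 4 + e) * rho `^ (3 / 4 + e)) * (8 * Num.sqrt rho)) by ring.
apply: ler_pM => //; rewrite ?mulr_ge0 ?nc_ge0//.
by rewrite ler_wpM2l.
Qed.

Lemma disp_exp_sum_pos t (e : R) : 0 < t ->
  Khinchin_Levy (4 / 27 * (t / (2 * pi)) ^- 2) -> 0 < e -> exists2 C : R, 0 < C &
  forall x (N L : nat), (0 < N)%N -> (L <= N)%N ->
  nc (\sum_(N <= n < N + L) expi (disp_phase t x n)) <= C * N%:R `^ (5 / 8 + e).
Proof.
(* The exponent loss doubles because the blocks are measured in [rho = sqrt N]:
   [N ^ (5 / 8 + e) = rho ^ (5 / 4 + 2 e)]. *)
move=> t0 KL e0; have e20 : 0 < 2 * e by rewrite mulr_gt0.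
have [Cb Cb0] := disp_complete_blocks t0 KL e20.
set c := 2 * pi / (3 * t) => HB.
have c0 : 0 < c by rewrite divr_gt0 ?mulr_gt0 ?pi_gt0.
clearbody c.
have ci0 : 0 < 2 / c by rewrite divr_gt0.
pose rho0 := 1 + 2 * (c + 1) + 2 / c.
have rho00 : 0 < rho0 by rewrite /rho0; clear -c0 ci0; lra.
(* Pays for the ranges before the first and after the last complete block, which have [O(sqrt N)]
   terms each. *)
pose C2 := 16 * c + 8 * c ^+ 2 + 4.
have cc : 0 < c ^+ 2 by rewrite exprn_gt0.
have C20 : 0 < C2 by rewrite /C2; clear -c0 cc; lra.
exists (rho0 ^+ 2 + C2 + Cb) => [|x N L N0 LN].
  by rewrite addr_gt0// addr_gt0// exprn_gt0.
have N1 : 1 <= (N%:R : R) by rewrite ler1n.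
pose rho : R := Num.sqrt N%:R.
have rhoN : rho ^+ 2 = N%:R by rewrite sqr_sqrtr.
have rhop : 0 < rho by rewrite sqrtr_gt0 ltr0n.
have pE : N%:R `^ (5 / 8 + e) = rho `^ (5 / 4 + 2 * e).
  rewrite /rho -powR12_sqrt// -powRrM; congr (_ `^ _); clear; lra.
have p1 : 1 <= N%:R `^ (5 / 8 + e) by apply: powR_ge1 => //; clear -e0; lra.
have rho1 : 1 <= rho by rewrite -[leLHS]sqrtr1 ler_wsqrtr.
have rp : rho <= N%:R `^ (5 / 8 + e).
  rewrite pE -[leLHS]powRr1 ?(ltW rhop)// ler_powR//; clear -e0; lra.
have sN n : nc (\sum_(n <= k < n) expi (disp_phase t x k)) = 0 by rewrite big_geq// nc0.
set P := N%:R `^ _ in p1 rp pE *.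
have P0 : 0 < P by clear -p1; lra.
have [small|large] := ltP rho rho0.
  apply: (le_trans (nc_sum_nat_le (disp_phase t x) _ _)); rewrite addKn.
  have : (L%:R : R) <= N%:R by rewrite ler_nat.
  have h : rho ^+ 2 <= rho0 ^+ 2 by rewrite ler_sqr ?nnegrE ltW.
  rewrite -rhoN => /le_trans; apply; apply: (le_trans h).
  have : rho0 ^+ 2 * 1 <= rho0 ^+ 2 * P by rewrite ler_wpM2l ?sqr_ge0.
  have := mulr_gt0 C20 P0; have := mulr_gt0 Cb0 P0; rewrite !mulrDl mulr1; clear; lra.
have rhoc : 2 * (c + 1) <= rho by clear -large ci0; rewrite /rho0 in large; lra.
have rhoc2 : 2 / c <= rho by clear -large c0; rewrite /rho0 in large; lra.
(* The least integer for which the first block starts at or after [N]: [th >= (rho + c) / (2 c)]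
   means [2 c th - c >= rho]. *)
pose m0 := Num.ceil ((rho + c) / (2 * c) + x / (2 * pi)).
pose th := m0%:~R - x / (2 * pi).
have /andP[th1 th2] : (rho + c) / (2 * c) <= th < (rho + c) / (2 * c) + 1.
  have := ceil_itv ((rho + c) / (2 * c) + x / (2 * pi)); rewrite -/m0 intrB /th => /andP[h1 h2].
  by move: h1 h2; move: (x / (2 * pi)) ((rho + c) / (2 * c)) => u v; clear; lra.
have c20 : 0 < 2 * c by rewrite mulr_gt0.
pose r k := 2 * c * (k%:R + th) - c.
have r0_lo : rho <= r 0%N.
  by move: th1; rewrite ler_pdivrMr// /r add0r mulrC; clear; lra.
have r0_hi : r 0%N <= rho + 2 * c.
  by move: th2; rewrite -ltrBlDr ltr_pdivlMr// /r add0r mulrC; clear; lra.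
have rS k : r k.+1 = r k + 2 * c by rewrite /r -[k.+1%:R]natr1; ring.
have r_lo k : rho <= r k by elim: k => // k ih; rewrite rS; clear -ih c0; lra.
pose B k := ceil_sqr (r k).
have hB k : r k ^+ 2 <= (B k)%:R < r k ^+ 2 + 1 := ceil_sqr_itv (r k).
have BS k : (B k < B k.+1)%N.
  rewrite -(ltr_nat R); have /andP[_ h1] := hB k; have /andP[h2 _] := hB k.+1.
  apply: lt_le_trans h1 _; apply: le_trans h2; rewrite rS.
  have h3 : 2 <= c * r k.
    move: rhoc2; rewrite ler_pdivrMr// => /le_trans; apply.
    by rewrite mulrC ler_pM2l.
  by move: (r k) h3 => y h3; clear -h3 cc; lra.
have NB : (N <= B 0%N)%N.
  rewrite -(ler_nat R); have /andP[h _] := hB 0%N; apply: le_trans h.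
  by rewrite -rhoN ler_sqr ?nnegrE ?(ltW rhop)// (le_trans (ltW rhop)).
have BN0 : (B 0%N)%:R - N%:R <= (4 * c + 4 * c ^+ 2 + 1) * rho.
  have /andP[_ h] := hB 0%N.
  have h2 : r 0%N ^+ 2 <= (rho + 2 * c) ^+ 2.
    have b0 : 0 <= rho + 2 * c := ltW (addr_gt0 rhop c20).
    have r00 : 0 <= r 0%N := le_trans (ltW rhop) (r_lo 0%N).
    by rewrite ler_sqr.
  have h3 : (4 * c ^+ 2 + 1) * 1 <= (4 * c ^+ 2 + 1) * rho.
    by rewrite ler_wpM2l//; clear -cc; lra.
  by rewrite -rhoN; clear -h h2 h3; lra.
have C2P : (4 * c + 4 * c ^+ 2 + 1) * rho + (8 * c + 4 * c ^+ 2 + 1) * rho <= C2 * P.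
  rewrite -mulrDl; apply: ler_pM => //; rewrite ?(ltW rhop)//; rewrite /C2; clear -c0 cc; lra.
have pos1 : 0 <= (8 * c + 4 * c ^+ 2 + 1) * rho.
  by rewrite mulr_ge0 ?(ltW rhop)//; clear -c0 cc; lra.
have posr : 0 <= rho0 ^+ 2 * P by rewrite mulr_ge0 ?sqr_ge0 ?ltW.
have posb : 0 <= Cb * P by rewrite mulr_ge0 ?ltW.
rewrite [leRHS]mulrDl (mulrDl (rho0 ^+ 2) C2).
have [late|early] := ltnP (N + L) (B 0%N).
  apply: (le_trans (nc_sum_nat_le (disp_phase t x) _ _)); rewrite addKn.
  have : (N + L)%:R <= (B 0%N)%:R :> R by rewrite ler_nat ltnW.
  by rewrite natrD; clear -BN0 C2P posr posb pos1; lra.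
have [K [_ BK BK1]] := increasing_bracket BS early.
have rK : r K <= 2 * rho.
  have /andP[h _] := hB K.
  have b0 : 0 <= 2 * rho by rewrite mulr_ge0// ltW.
  have r00 : 0 <= r K := le_trans (ltW rhop) (r_lo K).
  rewrite -ler_sqr//; apply: (le_trans h); rewrite [leRHS]exprMn rhoN.
  have h1 : (B K)%:R <= (N + L)%:R :> R by rewrite ler_nat.
  have h2 : L%:R <= N%:R :> R by rewrite ler_nat.
  have h3 : 0 <= N%:R :> R by [].
  by rewrite natrD in h1; clear -h1 h2 h3; lra.
have K3 : 2 * c * (K%:R + th) <= 3 * rho.
  by move: rK; rewrite /r; clear -rhoc c0; lra.
have rth : rho <= 2 * c * th - c by move: r0_lo; rewrite /r add0r.
have Hmid := HB x rho th m0 K rho1 rhoc rhoc2 erefl rth K3.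
rewrite -pE in Hmid.
have BK0 : (B 0%N <= B K)%N.
  by elim: K {BK BK1 rK K3 Hmid} => // k ih; exact: leq_trans ih (ltnW (BS k)).
rewrite (@big_cat_nat _ _ _ (B 0%N))//= (@big_cat_nat _ _ _ (B K) (B 0%N))//=.
rewrite (@sum_consecutive_blocks R B _ K (fun k => ltnW (BS k))).
apply: (le_trans (ncD _ _)); apply: (le_trans (lerD (lexx _) (ncD _ _))).
have s1 := @nc_sum_nat_le R (disp_phase t x) N (B 0%N).
have s3 := @nc_sum_nat_le R (disp_phase t x) (B K) (N + L).
rewrite natrB// in s1; rewrite natrB// in s3.
have s3' : (N + L)%:R - (B K)%:R <= (8 * c + 4 * c ^+ 2 + 1) * rho.
  have /andP[_ h1] := hB K.+1; have /andP[h2 _] := hB K; rewrite rS in h1.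
  have h3 : (N + L)%:R <= (B K.+1)%:R :> R by rewrite ler_nat ltnW.
  have h4 : c * r K <= c * (2 * rho) by rewrite ler_pM2l.
  have h5 : (4 * c ^+ 2 + 1) * 1 <= (4 * c ^+ 2 + 1) * rho.
    by rewrite ler_wpM2l//; clear -cc; lra.
  by clear -h1 h2 h3 h4 h5; lra.
change (is_true (nc (\sum_(k < K) \sum_(B k <= n < B k.+1) expi (disp_phase t x n)) <= Cb * P)) in Hmid.
clear -s1 BN0 s3 s3' Hmid C2P posr; lra.
Qed.

(** Complex conjugation replaces [t] and [x] by their opposites, and [beta] is even in [t]. *)
Lemma disp_exp_sum t (e : R) : t != 0 ->
  Khinchin_Levy (4 / 27 * (t / (2 * pi)) ^- 2) -> 0 < e -> exists2 C : R, 0 < C &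
  forall x (N L : nat), (0 < N)%N -> (L <= N)%N ->
  nc (\sum_(N <= n < N + L) expi (disp_phase t x n)) <= C * N%:R `^ (5 / 8 + e).
Proof.
move=> t0 KL e0; have [tp|tn|t00] := ltgtP t 0; last by rewrite t00 eqxx in t0.
  have tN : 0 < - t by rewrite oppr_gt0.
  have KLN : Khinchin_Levy (4 / 27 * (- t / (2 * pi)) ^- 2) by rewrite mulNr sqrrN.
  have [C C0 H] := disp_exp_sum_pos tN KLN e0.
  exists C => // x N L N0 LN; apply: le_trans (H (- x) N L N0 LN).
  rewrite !sum_nat_shift -(nc_sum_conj (fun k => disp_phase (- t) (- x) (N + k))).
  rewrite le_eqVlt; apply/orP; left; apply/eqP; congr nc; apply: eq_bigr => k _; congr expi.
  by rewrite /disp_phase; ring.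
exact: disp_exp_sum_pos.
Qed.

End DispersiveExponentialSum.

(** * Fourier coefficients of functions of bounded variation *)

Section BoundedVariationIntegral.
Context {R : realType}.
Local Notation mu := (@lebesgue_measure R).
Implicit Types (p f L : R -> R) (a b T B M : R).

(** The Jordan decomposition. Composition with the projection onto [[0, T]] makes the two variation
    functions monotone on the whole line, where measurability is immediate. *)
Lemma bounded_variation_monotone_sub f T : 0 <= T -> bounded_variation 0 T f ->
  exists p q : R -> R, [/\ {homo p : x y / x <= y}, {homo q : x y / x <= y} &
    forall x, 0 <= x <= T -> f x = p x - q x].
Proof.
move=> T0 bv; pose cl x : R := Num.max 0 (Num.min x T).
have clT x : cl x \in `[0, T].
  by rewrite in_itv /= /cl le_max lexx /= ge_max T0 /= ge_min lexx orbT.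
have clm : {homo cl : x y / x <= y}.
  move=> x y xy; have h : Num.min x T <= Num.min y T by rewrite le_min !ge_min xy lexx orbT.
  by rewrite /cl ge_max !le_max lexx h orbT.
have cle x : 0 <= x <= T -> cl x = x.
  by move=> /andP[h1 h2]; rewrite /cl (min_idPl h2) (max_idPr h1).
exists ((fine \o pos_tv 0 f) \o cl), ((fine \o neg_tv 0 f) \o cl); split.
- move=> x y xy; apply: (fine_neg_tv_nondecreasing (bounded_variationN bv)); rewrite ?clT//.
  exact: clm.
- by move=> x y xy; apply: (fine_neg_tv_nondecreasing bv); rewrite ?clT//; exact: clm.
- move=> x xT; rewrite (bounded_variation_pos_neg_tvE bv) /=; first by rewrite (cle x xT).
  by rewrite in_itv.
Qed.

Lemma integrable_monotone_mul p f a b :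
  {homo p : x y / x <= y} -> continuous f -> mu.-integrable `[a, b] (EFin \o (fun x => p x * f x)).
Proof.
move=> pm cf; have [ab|ba] := leP a b; last first.
  rewrite set_itv_ge ?bnd_simp -?ltNge//; exact: integrable_set0.
have [c _ hc] : exists2 c, c \in `[a, b] & forall t, t \in `[a, b] -> `|f t| <= `|f c|.
  by apply: (@EVT_max R (fun x => `|f x|)) => //; apply: continuous_subspaceT => x; apply: continuous_comp; [exact: cf|exact: norm_continuous].
apply: measurable_bounded_integrable => //.
- by rewrite /= lebesgue_measure_itv /=; case: ifP => // _; rewrite ltry.
- apply: measurable_realfun.measurable_funM; first exact: measurable_realfun.nondecreasing_measurable.
  by apply: measurable_funTS; exact: measurable_realfun.continuous_measurable_fun.
- exists ((`|p a| + `|p b|) * `|f c|); split; first by rewrite num_real.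
  move=> M hM x /= xab; apply: (le_trans _ (ltW hM)).
  rewrite normrM; apply: ler_pM => //; last exact: hc.
  have /andP[ax xb] : a <= x <= b by rewrite in_itv /= in xab.
  have := pm _ _ ax; have := pm _ _ xb; have := ler_norm (p b); have := ler_norm (- p a).
  by rewrite normrN ler_norml => *; have := normr_ge0 (p a); have := normr_ge0 (p b); move=> *; apply/andP; split; lra.
Qed.

Lemma integrable_subr (f g : R -> R) (D : set (measurableTypeR R)) : measurable D -> mu.-integrable D (EFin \o f) ->
  mu.-integrable D (EFin \o g) -> mu.-integrable D (EFin \o (fun x => f x - g x)).
Proof.
by move=> mD hf hg; have := integrableB mD hf hg; apply: eq_integrable.
Qed.

Lemma Rintegral_derivative L (L' : R -> R) a b : a <= b -> (forall x : R, is_derive x 1 L (L' x)) ->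
  continuous L' -> \int[mu]_(x in `[a, b]) L' x = L b - L a.
Proof.
move=> ab dL cL'; move: ab; rewrite le_eqVlt => /orP[/eqP <-|ab].
  by rewrite set_itv1 Rintegral_set1 subrr.
have cL : continuous L.
  by move=> x; apply/differentiable_continuous/derivable1_diffP; have [] := dL x.
rewrite /Rintegral (@continuous_FTC2 R L' L a b ab)//.
- exact: continuous_subspaceT.
- split; first by move=> x _; have [] := dL x.
  + by apply: cvg_at_right_filter; exact: cL.
  + by apply: cvg_at_left_filter; exact: cL.
- by move=> x _; rewrite derive1E; have [] := dL x.
Qed.

Lemma Rintegral_itv_split f a b c : a <= b -> b <= c -> mu.-integrable `[a, c] (EFin \o f) ->
  \int[mu]_(x in `[a, c]) f x = \int[mu]_(x in `[a, b]) f x + \int[mu]_(x in `[b, c]) f x.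
Proof.
move=> ab bc int; have intbc : mu.-integrable `]b, c] (EFin \o f).
  by apply: integrableS int => //; apply: subset_itvr; rewrite bnd_simp.
have := @Rintegral_itvB R f (BLeft a) (BRight c) b int.
rewrite !bnd_simp => /(_ ab bc); rewrite Rintegral_itv_obnd_cbnd// => <-.
by rewrite addrC subrK.
Qed.

Lemma monotone_integral_step p L (L' : R -> R) M a b :
  a <= b -> {homo p : x y / x <= y} -> (forall x : R, is_derive x 1 L (L' x)) ->
  continuous L' -> (forall x, `|L' x| <= M) ->
  `|\int[mu]_(x in `[a, b]) (p x * L' x) - p a * (L b - L a)| <= (p b - p a) * M * (b - a).
Proof.
move=> ab pm dL cL' LM.
have i1 := @integrable_monotone_mul p L' a b pm cL'.
have i2 : mu.-integrable `[a, b] (EFin \o (fun x => p a * L' x)).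
  by apply: (@integrable_monotone_mul (fun=> p a) L').
have i3 : mu.-integrable `[a, b] (EFin \o L').
  apply: continuous_compact_integrable; first exact: segment_compact.
  exact: continuous_subspaceT.
rewrite -(Rintegral_derivative ab dL cL') -RintegralZl// -RintegralB//.
have i4 : mu.-integrable `[a, b] (EFin \o (fun x => p x * L' x - p a * L' x)).
  by apply: integrable_subr.
apply: (le_trans (le_normr_Rintegral _ i4)) => //.
have -> : (p b - p a) * M * (b - a) = \int[mu]_(x in `[a, b]) ((p b - p a) * M).
  rewrite Rintegral_cst//= lebesgue_measure_itv /= lte_fin; case: ifP => [_|]; first by rewrite -EFinB.
  move=> /negbT; rewrite -leNgt => ba; have -> : b = a by apply/eqP; rewrite eq_le ba ab.
  by rewrite subrr !mul0r.
apply: le_Rintegral => //.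
- exact: integrable_norm.
- apply: continuous_compact_integrable; first exact: segment_compact.
  by apply: continuous_subspaceT => x; exact: cvg_cst.
- move=> x /=; rewrite in_itv /= => /andP[ax xb].
  rewrite -mulrBl normrM; apply: ler_pM => //.
  by have := pm _ _ ax; have := pm _ _ xb => h1 h2; rewrite ger0_norm; lra.
Qed.

(* Abel summation over the partition of mesh T / J, then J -> oo. *)
Lemma monotone_integral_bound p L (L' : R -> R) T M B :
  0 <= T -> {homo p : x y / x <= y} -> (forall x : R, is_derive x 1 L (L' x)) ->
  continuous L' -> (forall x, `|L' x| <= M) -> (forall x, `|L x| <= B) ->
  `|\int[mu]_(x in `[0, T]) (p x * L' x)| <= B * (`|p 0| + `|p T| + (p T - p 0)).
Proof.
move=> T0 pm dL cL' LM LB.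
have M0 : 0 <= M by rewrite (le_trans _ (LM 0)).
have B0 : 0 <= B by rewrite (le_trans _ (LB 0)).
have pT : 0 <= p T - p 0 by rewrite subr_ge0 pm.
suff H (J : nat) : (0 < J)%N -> `|\int[mu]_(x in `[0, T]) (p x * L' x)| <=
    B * (`|p 0| + `|p T| + (p T - p 0)) + (p T - p 0) * M * T / J%:R.
  apply/ler_addgt0Pr => e e0; set X := (p T - p 0) * M * T.
  have X0 : 0 <= X by rewrite !mulr_ge0.
  pose J := (Num.truncn (X / e)).+1.
  have : X / e < J%:R by exact: truncnS_gt.
  rewrite ltr_pdivrMr// => /ltW h.
  by apply: (le_trans (H J isT)); rewrite lerD2l -/X ler_pdivrMr ?ltr0n// [e * _]mulrC.
move=> J0; have J0' : 0 < J%:R :> R by rewrite ltr0n.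
pose d := T / J%:R; pose y (n : nat) := d * n%:R.
have d0 : 0 <= d by rewrite divr_ge0.
have yS n : y n <= y n.+1 by rewrite ler_wpM2l// ler_nat.
have y0 n : 0 <= y n by rewrite mulr_ge0.
have key n : `|\int[mu]_(x in `[0, y n]) (p x * L' x) - p (y n) * L (y n)| <=
    B * (`|p 0| + (p (y n) - p 0)) + (p (y n) - p 0) * M * d.
  elim: n => [|n ih].
    rewrite /y mulr0 set_itv1 Rintegral_set1 sub0r normrN subrr !mul0r addr0 addr0 normrM mulrC.
    by rewrite ler_wpM2r.
  rewrite (@Rintegral_itv_split _ 0 (y n) (y n.+1))//; last exact: integrable_monotone_mul.
  have st := monotone_integral_step (yS n) pm dL cL' LM.

  have yd : y n.+1 - y n = d by rewrite /y -[n.+1%:R]natr1; ring.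
  rewrite yd in st.
  have pp : 0 <= p (y n.+1) - p (y n) by rewrite subr_ge0 pm.
  have h : `|(p (y n.+1) - p (y n)) * L (y n.+1)| <= B * (p (y n.+1) - p (y n)).
    by rewrite normrM (ger0_norm pp) mulrC ler_wpM2r.
  set I1 := \int[mu]_(x in `[0, y n]) _ in ih *; set I2 := \int[mu]_(x in `[y n, y n.+1]) _ in st *.
  rewrite (_ : I1 + I2 - p (y n.+1) * L (y n.+1) = (I1 - p (y n) * L (y n)) +
    (I2 - p (y n) * (L (y n.+1) - L (y n))) - (p (y n.+1) - p (y n)) * L (y n.+1)); last by ring.
  apply: (le_trans (ler_normB _ _)).
  apply: (le_trans (lerD (le_trans (ler_normD _ _) (lerD ih st)) h)).
  by rewrite le_eqVlt; apply/orP; left; apply/eqP; ring.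
have yJ : y J = T by rewrite /y /d divfK// gt_eqF.
have := key J; rewrite yJ => h.
have h2 : `|p T * L T| <= B * `|p T| by rewrite normrM mulrC ler_wpM2r.
set I := \int[mu]_(x in _) _ in h *.
rewrite -[I](subrK (p T * L T)); apply: (le_trans (ler_normD _ _)).
apply: (le_trans (lerD h h2)); rewrite /d !mulrA; clear; lra.
Qed.

(** Stands for the bound of the Stieltjes integral of [L] against [df] by the variation of [f] and
    the supremum of [L], boundary terms included. The bound [M] on [L'] makes the mesh error vanish
    and leaves no trace in the constant. *)
Lemma bounded_variation_integral_bound f T : 0 <= T -> bounded_variation 0 T f ->
  exists2 C, 0 <= C & forall L (L' : R -> R) M B,
    (forall x : R, is_derive x 1 L (L' x)) -> continuous L' -> (forall x, `|L' x| <= M) ->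
    (forall x, `|L x| <= B) -> `|\int[mu]_(x in `[0, T]) (f x * L' x)| <= C * B.
Proof.
move=> T0 bv; have [p [q [pm qm fE]]] := bounded_variation_monotone_sub T0 bv.
exists ((`|p 0| + `|p T| + (p T - p 0)) + (`|q 0| + `|q T| + (q T - q 0))).
  have := pm 0 T T0; have := qm 0 T T0; have := normr_ge0 (p 0); have := normr_ge0 (p T).
  have := normr_ge0 (q 0); have := normr_ge0 (q T); clear; lra.
move=> L L' M B dL cL' LM LB.
have -> : \int[mu]_(x in `[0, T]) (f x * L' x) =
    \int[mu]_(x in `[0, T]) (p x * L' x) - \int[mu]_(x in `[0, T]) (q x * L' x).
  rewrite -RintegralB//; [|exact: integrable_monotone_mul..].
  apply: eq_Rintegral => x; rewrite inE /= in_itv /= => xT.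
  by rewrite (fE x xT) mulrBl.
apply: (le_trans (ler_normB _ _)); rewrite mulrDl; apply: lerD; rewrite mulrC.
  exact: monotone_integral_bound.
exact: monotone_integral_bound.
Qed.

Lemma bounded_variation_integrable f (h : R -> R) T : 0 <= T -> bounded_variation 0 T f ->
  continuous h -> mu.-integrable `[0, T] (EFin \o (fun x => f x * h x)).
Proof.
move=> T0 bv ch; have [p [q [pm qm fE]]] := bounded_variation_monotone_sub T0 bv.
have : mu.-integrable `[0, T] (EFin \o (fun x => p x * h x - q x * h x)).
  apply: integrable_subr => //; exact: integrable_monotone_mul.
apply: eq_integrable => // x; rewrite inE /= in_itv /= => xT.
by rewrite (fE x xT) mulrBl.
Qed.

End BoundedVariationIntegral.

(** * Componentwise continuity and derivatives of complex-valued functions *)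

Section ComplexDerivative.
Context {R : realType}.
Implicit Types (f g : R -> R[i]) (c : R[i]).

Definition ccontinuous f := continuous (fun y => Re (f y)) /\ continuous (fun y => Im (f y)).

Definition cderivable f (f' : R -> R[i]) := forall y : R,
  is_derive y 1 (fun y => Re (f y)) (Re (f' y)) /\ is_derive y 1 (fun y => Im (f y)) (Im (f' y)).

Lemma cderivable_continuous f f' : cderivable f f' -> ccontinuous f.
Proof.
move=> df; split=> y; apply/differentiable_continuous/derivable1_diffP; have [d1 d2] := df y.
  by have [] := d1.
by have [] := d2.
Qed.

Lemma ccontinuousD f g : ccontinuous f -> ccontinuous g -> ccontinuous (fun y => f y + g y).
Proof.
move=> [f1 f2] [g1 g2]; split => y.
  under eq_fun do rewrite ReD; exact: cvgD (f1 y) (g1 y).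
by under eq_fun do rewrite ImD; exact: cvgD (f2 y) (g2 y).
Qed.

Lemma ccontinuousZ c f : ccontinuous f -> ccontinuous (fun y => c * f y).
Proof.
move=> [f1 f2]; split => y.
  under eq_fun do rewrite cReM; apply: cvgB; apply: cvgM; [exact: cvg_cst|exact: f1|exact: cvg_cst|exact: f2].
under eq_fun do rewrite cImM; apply: cvgD; apply: cvgM; [exact: cvg_cst|exact: f2|exact: cvg_cst|exact: f1].
Qed.

Lemma ccontinuous_sum (I : Type) (s : seq I) (F : I -> R -> R[i]) :
  (forall i, ccontinuous (F i)) -> ccontinuous (fun y => \sum_(i <- s) F i y).
Proof.
move=> hF; elim: s => [|i s ih].
  by under eq_fun do rewrite big_nil; split => y /=; exact: cvg_cst.
by under eq_fun do rewrite big_cons; exact: ccontinuousD.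
Qed.

Lemma cderivableD f f' g g' : cderivable f f' -> cderivable g g' ->
  cderivable (fun y => f y + g y) (fun y => f' y + g' y).
Proof.
move=> df dg y; have [f1 f2] := df y; have [g1 g2] := dg y; rewrite ReD ImD; split.
  by under eq_fun do rewrite ReD; apply: is_deriveD.
by under eq_fun do rewrite ImD; apply: is_deriveD.
Qed.

Lemma cderivableZ c f f' : cderivable f f' -> cderivable (fun y => c * f y) (fun y => c * f' y).
Proof.
move=> df y; have [f1 f2] := df y; rewrite cReM cImM; split.
  under eq_fun do rewrite cReM; apply: is_derive_eq; by rewrite /GRing.scale/= ?mulr0 ?addr0 ?add0r; ring.
under eq_fun do rewrite cImM; apply: is_derive_eq; by rewrite /GRing.scale/= ?mulr0 ?addr0 ?add0r; ring.
Qed.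

Lemma cderivable_sum (I : Type) (s : seq I) (F F' : I -> R -> R[i]) :
  (forall i, cderivable (F i) (F' i)) ->
  cderivable (fun y => \sum_(i <- s) F i y) (fun y => \sum_(i <- s) F' i y).
Proof.
move=> hF; elim: s => [|i s ih].
  move=> y; rewrite big_nil; split; under eq_fun do rewrite big_nil /=; exact: is_derive_cst.
rewrite (_ : (fun y => \sum_(j <- i :: s) F j y) = (fun y => F i y + \sum_(j <- s) F j y)); last first.
  by apply/funext => y; rewrite big_cons.
rewrite (_ : (fun y => \sum_(j <- i :: s) F' j y) = (fun y => F' i y + \sum_(j <- s) F' j y)); last first.
  by apply/funext => y; rewrite big_cons.
exact: cderivableD.
Qed.

Lemma cderivable_expi (a b : R) :
  cderivable (fun y => expi (a * y + b)) (fun y => 'i * a%:C * expi (a * y + b)).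
Proof.
move=> y; have h : is_derive y 1 (fun y => a * y + b) a.
  by apply: is_derive_eq; rewrite /GRing.scale/=; ring.
have h1 : is_derive y 1 (cos \o (fun y => a * y + b)) (- sin (a * y + b) * a) by exact: is_derive1_comp.
have h2 : is_derive y 1 (sin \o (fun y => a * y + b)) (cos (a * y + b) * a) by exact: is_derive1_comp.
rewrite cReM cImM cReM cImM /=; split.
  by rewrite (_ : _ - _ = - sin (a * y + b) * a); [exact: h1|ring].
by rewrite (_ : _ + _ = cos (a * y + b) * a); [exact: h2|ring].
Qed.

Lemma ccontinuous_expi (a b : R) : ccontinuous (fun y => expi (a * y + b)).
Proof. exact: cderivable_continuous (cderivable_expi a b). Qed.

Lemma nc_mvt f f' C a b : cderivable f f' -> (forall y, nc (f' y) <= C) ->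
  nc (f b - f a) <= 2 * C * `|b - a|.
Proof.
move=> df fC; apply: (le_trans (nc_ReIm _)); rewrite ReB ImB.
have h1 : `|Re (f b) - Re (f a)| <= C * `|b - a|.
  apply: (@mvt_lipschitz R (fun y => Re (f y)) (fun y => Re (f' y))) => y _.
    by have [] := df y.
  by rewrite (le_trans (nc_Re _)).
have h2 : `|Im (f b) - Im (f a)| <= C * `|b - a|.
  apply: (@mvt_lipschitz R (fun y => Im (f y)) (fun y => Im (f' y))) => y _.
    by have [] := df y.
  by rewrite (le_trans (nc_Im _)).
lra.
Qed.

End ComplexDerivative.

(** * Trigonometric kernels against a function of bounded variation *)

Section FourierKernel.
Context {R : realType}.
Local Notation mu := (@lebesgue_measure R).
Implicit Types (g phi : R -> R[i]).

Definition per_integral (f h : R -> R) : R := \int[mu]_(x in `[0, 2 * pi]) (f x * h x).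

Lemma twopi_ge0 : 0 <= 2 * pi :> R.
Proof. by rewrite mulr_ge0// pi_ge0. Qed.

Lemma torus_integralE g phi : BV_torus g -> ccontinuous phi ->
  torus_integral (fun y => g y * phi y) =
  (per_integral (fun x => Re (g x)) (fun x => Re (phi x)) - per_integral (fun x => Im (g x)) (fun x => Im (phi x))) +i*
  (per_integral (fun x => Re (g x)) (fun x => Im (phi x)) + per_integral (fun x => Im (g x)) (fun x => Re (phi x))).
Proof.
move=> [_ b1 b2] [c1 c2]; rewrite /torus_integral /per_integral; congr (_ +i* _).
  have -> : (fun x => Re (g x * phi x)) = (fun x => Re (g x) * Re (phi x) - Im (g x) * Im (phi x)).
    by apply/funext => x; rewrite cReM.
  by rewrite RintegralB//; exact: bounded_variation_integrable twopi_ge0 _ _.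
have -> : (fun x => Im (g x * phi x)) = (fun x => Re (g x) * Im (phi x) + Im (g x) * Re (phi x)).
  by apply/funext => x; rewrite cImM.
by rewrite RintegralD//; exact: bounded_variation_integrable twopi_ge0 _ _.
Qed.

Lemma per_integralD (f h1 h2 : R -> R) : bounded_variation 0 (2 * pi) f -> continuous h1 -> continuous h2 ->
  per_integral f (fun x => h1 x + h2 x) = per_integral f h1 + per_integral f h2.
Proof.
move=> bf c1 c2; rewrite /per_integral.
have -> : (fun x => f x * (h1 x + h2 x)) = (fun x => f x * h1 x + f x * h2 x).
  by apply/funext => x; rewrite mulrDr.
by rewrite RintegralD//; exact: bounded_variation_integrable twopi_ge0 _ _.
Qed.

Lemma per_integralZ (f h : R -> R) (a : R) : bounded_variation 0 (2 * pi) f -> continuous h ->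
  per_integral f (fun x => a * h x) = a * per_integral f h.
Proof.
move=> bf c1; rewrite /per_integral.
have -> : (fun x => f x * (a * h x)) = (fun x => a * (f x * h x)).
  by apply/funext => x; rewrite mulrCA.
by rewrite RintegralZl//; exact: bounded_variation_integrable twopi_ge0 _ _.
Qed.

Lemma torus_integralD g phi psi : BV_torus g -> ccontinuous phi -> ccontinuous psi ->
  torus_integral (fun y => g y * (phi y + psi y)) =
  torus_integral (fun y => g y * phi y) + torus_integral (fun y => g y * psi y).
Proof.
move=> gBV c1 c2; rewrite !torus_integralE//; last exact: ccontinuousD.
have [_ b1 b2] := gBV; have [c11 c12] := c1; have [c21 c22] := c2.
have e1 : (fun x => Re (phi x + psi x)) = (fun x => Re (phi x) + Re (psi x)).
  by apply/funext => x; rewrite ReD.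
have e2 : (fun x => Im (phi x + psi x)) = (fun x => Im (phi x) + Im (psi x)).
  by apply/funext => x; rewrite ImD.
by rewrite e1 e2 !per_integralD//; apply: complexE2; rewrite ?ReD ?ImD /=; ring.
Qed.

Lemma torus_integralZ g phi (c : R[i]) : BV_torus g -> ccontinuous phi ->
  torus_integral (fun y => g y * (c * phi y)) = c * torus_integral (fun y => g y * phi y).
Proof.
move=> gBV c1; rewrite !torus_integralE//; last exact: ccontinuousZ.
have [_ b1 b2] := gBV; have [c11 c12] := c1.
have e1 : (fun x => Re (c * phi x)) = (fun x => Re c * Re (phi x) + - Im c * Im (phi x)).
  by apply/funext => x; rewrite cReM mulNr.
have e2 : (fun x => Im (c * phi x)) = (fun x => Re c * Im (phi x) + Im c * Re (phi x)).
  by apply/funext => x; rewrite cImM.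
have cz (a : R) (h : R -> R) : continuous h -> continuous (fun x => a * h x).
  by move=> ch x; apply: cvgM; [exact: cvg_cst|exact: ch].
rewrite e1 e2 !per_integralD ?per_integralZ//; try exact: cz.
by apply: complexE2; rewrite ?cReM ?cImM /=; ring.
Qed.

Lemma torus_integral_zero g : torus_integral (fun y => g y * 0) = 0.
Proof.
rewrite (_ : (fun y => g y * 0) = fun=> 0); last by apply/funext => y; rewrite mulr0.
by rewrite /torus_integral /= !Rintegral_cst//= !mul0r.
Qed.

Lemma torus_integral_sum g (I : Type) (s : seq I) (c : I -> R[i]) (F : I -> R -> R[i]) : BV_torus g ->
  (forall i, ccontinuous (F i)) ->
  torus_integral (fun y => g y * \sum_(i <- s) c i * F i y) =
  \sum_(i <- s) c i * torus_integral (fun y => g y * F i y).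
Proof.
move=> gBV cF; elim: s => [|i s ih].
  rewrite big_nil -[RHS](torus_integral_zero g); congr torus_integral.
  by apply/funext => y; rewrite big_nil.
rewrite (_ : (fun y => g y * \sum_(j <- i :: s) c j * F j y) =
  (fun y => g y * (c i * F i y + \sum_(j <- s) c j * F j y))); last first.
  by apply/funext => y; rewrite big_cons.
rewrite big_cons torus_integralD//; last first.
- by apply: ccontinuous_sum => j; exact: ccontinuousZ.
- exact: ccontinuousZ.
by rewrite torus_integralZ// ih.
Qed.

(* Integration by parts moves a factor n from the kernel to the measure dg. *)
Lemma fourier_kernel_bound g : BV_torus g -> exists2 C : R, 0 <= C &
  forall (s : seq int) (d : int -> R[i]) (B : R),
  (forall z : R, nc (\sum_(n <- s) d n * expi (n%:~R * z)) <= B) ->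
  forall x : R, nc (\sum_(n <- s) n%:~R%:C * fourier g n * d n * expi (n%:~R * x)) <= C * B.
Proof.
move=> gBV; have [_ b1 b2] := gBV.
have [C1 C10 H1] := bounded_variation_integral_bound twopi_ge0 b1.
have [C2 C20 H2] := bounded_variation_integral_bound twopi_ge0 b2.
exists ((2 * pi)^-1 * (2 * C1 + 2 * C2)).
  by rewrite mulr_ge0 ?invr_ge0 ?twopi_ge0// addr_ge0// mulr_ge0.
move=> s d B hB x.
pose G y := \sum_(n <- s) (n%:~R%:C * d n * expi (n%:~R * x)) * expi (- (n%:~R * y)).
have cE n : ccontinuous (fun y : R => expi (- (n%:~R * y))).
  rewrite (_ : (fun y => _) = fun y => expi (- n%:~R * y + 0)); first exact: ccontinuous_expi.
  by apply/funext => y; rewrite addr0 mulNr.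
have -> : \sum_(n <- s) n%:~R%:C * fourier g n * d n * expi (n%:~R * x) =
    ((2 * pi)^-1)%:C * torus_integral (fun y => g y * G y).
  rewrite torus_integral_sum// mulr_sumr; apply: eq_bigr => n _; rewrite /fourier; ring.
rewrite ncM nc_real ger0_norm ?invr_ge0 ?twopi_ge0// -[leRHS]mulrA ler_wpM2l ?invr_ge0 ?twopi_ge0//.
(* As a function of [y] this is the given kernel at [x - y]. Differentiation produces the factor
   [n]: [L' = - i G], while [L] itself is bounded by [B]. *)
pose L y := \sum_(n <- s) d n * expi (- n%:~R * y + n%:~R * x).
pose L' y := \sum_(n <- s) d n * ('i * (- n%:~R)%:C * expi (- n%:~R * y + n%:~R * x)).
have dL : cderivable L L' by apply: cderivable_sum => n; apply: cderivableZ; exact: cderivable_expi.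
have LG y : L' y = - 'i * G y.
  rewrite /G mulr_sumr; apply: eq_bigr => n _.
  rewrite expiD mulNr (rmorphN (real_complex R)); ring.
have cG : ccontinuous G by apply: ccontinuous_sum => n; exact: ccontinuousZ.
have [cG1 cG2] := cG.
have LB y : nc (L y) <= B.
  apply: le_trans (hB (x - y)); rewrite le_eqVlt; apply/orP; left; apply/eqP; congr nc.
  by apply: eq_bigr => n _; congr (_ * expi _); ring.
pose M := \sum_(n <- s) nc (d n * ('i * (- n%:~R)%:C)).
have GM y : nc (G y) <= M.
  rewrite -[leLHS]mul1r -nc_i -(ncN 'i) -ncM -LG.
  apply: (le_trans (nc_sum _ _ _)); apply: ler_sum => n _.
  by rewrite mulrA ncM nc_expi mulr1.
have LRe y : Re (L' y) = Im (G y) by rewrite LG cReM /=; ring.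
have LIm y : Im (L' y) = - Re (G y) by rewrite LG cImM /=; ring.
have dRe (y : R) : is_derive y 1 (fun y => Re (L y)) (Im (G y)) by have [h _] := dL y; rewrite -LRe.
have dIm (y : R) : is_derive y 1 (fun y => - Im (L y)) (Re (G y)).
  have [_ h] := dL y; rewrite LIm in h; rewrite -[Re (G y)]opprK.
  by apply: is_deriveN.
have mRe y : `|Re (G y)| <= M by rewrite (le_trans (nc_Re _)).
have mIm y : `|Im (G y)| <= M by rewrite (le_trans (nc_Im _)).
have bRe y : `|Re (L y)| <= B by rewrite (le_trans (nc_Re _)).
have bIm y : `|- Im (L y)| <= B by rewrite normrN (le_trans (nc_Im _)).
rewrite torus_integralE//; apply: (le_trans (nc_ReIm _)) => /=.
have h1 := H1 _ _ M B dRe cG2 mIm bRe; have h2 := H1 _ _ M B dIm cG1 mRe bIm.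
have h3 := H2 _ _ M B dRe cG2 mIm bRe; have h4 := H2 _ _ M B dIm cG1 mRe bIm.
rewrite -/(per_integral _ _) in h1; rewrite -/(per_integral _ _) in h2.
rewrite -/(per_integral _ _) in h3; rewrite -/(per_integral _ _) in h4.
apply: (le_trans (lerD (ler_normB _ _) (ler_normD _ _))).
move: h1 h2 h3 h4; clear; lra.
Qed.

End FourierKernel.

(** * Dyadic blocks and regularity of the evolution *)

Section EvolutionBlocks.
Context {R : realType}.
Context (t : R) (g : R -> R[i]).
Implicit Types (x z h : R) (s : bool).

Definition sgn_int s (n : nat) : int := if s then - n%:Z else n%:Z.
Definition sgn_real s : R := if s then -1 else 1.

Lemma sgn_intE s n : (sgn_int s n)%:~R = sgn_real s * n%:R :> R.
Proof. by case: s; rewrite /sgn_int /sgn_real ?mulN1r ?mul1r ?intrN. Qed.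

Lemma sgn_real_norm s : `|sgn_real s| = 1.
Proof. by case: s; rewrite /= ?normrN normr1. Qed.

Lemma sgn_real_neq0 s : sgn_real s != 0.
Proof. by rewrite -normr_eq0 sgn_real_norm oner_eq0. Qed.

Lemma sgn_realV s : (sgn_real s)^-1 = sgn_real s.
Proof. by case: s; rewrite /= ?invrN1 ?invr1. Qed.

Definition evo_coef (n : int) x : R[i] := fourier g n * expi (t * omega32 n + n%:~R * x).

Lemma omega32_sgn s n : omega32 (sgn_int s n) = Num.sqrt n%:R ^+ 3 :> R.
Proof.
rewrite /omega32 sgn_intE normrM sgn_real_norm mul1r ger0_norm// (_ : 3 / 2 = 2^-1 * 3%:R :> R); last by field.
by rewrite powRrM powR12_sqrt// powR_mulrn.
Qed.

Lemma evo_phase s n x : t * omega32 (sgn_int s n) + (sgn_int s n)%:~R * x = disp_phase t (sgn_real s * x) n.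
Proof. by rewrite omega32_sgn sgn_intE /disp_phase; ring. Qed.

Lemma symmetric_sum (V : nmodType) (f : int -> V) (N : nat) :
  \sum_(k < N.*2.+1) f (k%:Z - N%:Z) = f 0 + \sum_(1 <= n < N.+1) (f n%:Z + f (- n%:Z)).
Proof.
elim: N => [|N ih].
  by rewrite big_ord_recl big_ord0 big_geq// !addr0 subrr.
rewrite doubleS big_ord_recl big_ord_recr /= big_nat_recr//= [RHS]addrA -ih.
rewrite [LHS]addrC -[LHS]addrA; congr (_ + _).
  by apply: eq_bigr => k _; congr f; rewrite /bump /=; lia.
by congr (f _ + f _); rewrite /bump /=; lia.
Qed.

(** Runs over [|n| < M], one less than the index convention of the partial sums, so that differences
    of values are sums over half-open dyadic ranges. *)
Definition evo_sum (M : nat) x : R[i] :=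
  evo_coef 0 x + \sum_(1 <= n < M) (evo_coef n%:Z x + evo_coef (- n%:Z) x).

Lemma evolution_partial_sumE N x : evolution_partial_sum omega32 t g N x = evo_sum N.+1 x.
Proof. by rewrite /evolution_partial_sum (symmetric_sum (fun n => evo_coef n x)). Qed.

Lemma evo_sum_block M L x : (0 < M)%N ->
  evo_sum (M + L) x - evo_sum M x =
  \sum_(M <= n < M + L) evo_coef (sgn_int false n) x + \sum_(M <= n < M + L) evo_coef (sgn_int true n) x.
Proof.
move=> M0; rewrite /evo_sum (@big_cat_nat _ _ _ M 1 (M + L))//= ?leq_addr// -big_split /=.
by rewrite addrA [_ + \sum_(M <= n < _) _]addrC addrK.
Qed.

Context (gBV : BV_torus g) (t0 : t != 0) (KL : Khinchin_Levy (4 / 27 * (t / (2 * pi)) ^- 2)).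

(** The weights [1 / m] in [d] cancel the factor gained in [fourier_kernel_bound]. Abel summation
    bounds the kernel [Q] by [M ^ (1 - a) / M]. Its increments are bounded through its derivative,
    which is the exponential sum without weights, of size [M ^ (1 - a)]. *)
Lemma evo_block_bounds s (a : R) : a < 3 / 8 -> exists2 C : R, 0 < C & forall M L : nat, (0 < M)%N -> (L <= M)%N ->
  (forall x, nc (\sum_(M <= n < M + L) evo_coef (sgn_int s n) x) <= C * M%:R `^ (- a)) /\
  (forall x h, nc (\sum_(M <= n < M + L) (evo_coef (sgn_int s n) (x + h) - evo_coef (sgn_int s n) x))
     <= C * (`|h| * M%:R `^ (1 - a))).
Proof.
move=> a38; have e0 : 0 < 3 / 8 - a by lra.
have [C C0 HC] := disp_exp_sum t0 KL e0.
have [Cg Cg0 HG] := fourier_kernel_bound gBV.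
exists (4 * (Cg + 1) * C); first by rewrite !mulr_gt0//; lra.
move=> M L M0 LM; have M0' : 0 < M%:R :> R by rewrite ltr0n.
set r := sgn_real s.
have HC' z k : (k <= L)%N -> nc (\sum_(M <= n < M + k) expi (disp_phase t z n)) <= C * M%:R `^ (1 - a).
  move=> kL; apply: (le_trans (HC z M k M0 (leq_trans kL LM))).
  by rewrite (_ : 5 / 8 + _ = 1 - a)//; lra.
have M1a : M%:R `^ (1 - a) = M%:R * M%:R `^ (- a) :> R by rewrite powRDp// powRr1// ltW.
pose d (m : int) : R[i] := (m%:~R^-1)%:C * expi (t * omega32 m).
have nz n : (M <= n)%N -> (sgn_int s n)%:~R != 0 :> R.
  by move=> Mn; rewrite sgn_intE mulf_neq0 ?sgn_real_neq0// pnatr_eq0 -lt0n (leq_trans M0).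
pose S := [seq sgn_int s n | n <- index_iota M (M + L)].
pose Q z := \sum_(m <- S) d m * expi (m%:~R * z).
have QB z : nc (Q z) <= 4 * C * M%:R `^ (- a).
  have -> : Q z = (sgn_real s)%:C * \sum_(k < L) ((M + k)%:R^-1)%:C * expi (disp_phase t (r * z) (M + k)).
    rewrite /Q /S big_map -/(index_iota M (M + L)) (sum_nat_shift (fun n => d (sgn_int s n) * expi ((sgn_int s n)%:~R * z))).
    rewrite addKn mulr_sumr; apply: eq_bigr => k _.
    rewrite /d -mulrA -expiD evo_phase mulrA -realCM sgn_intE; congr (_%:C * _).
    by rewrite invfM sgn_realV.
  rewrite ncM nc_real sgn_real_norm mul1r.
  have pos k : 0 < (M + k)%:R :> R by rewrite ltr0n ltn_addr.
  have := @abel_monotone R (fun k => (M + k)%:R^-1) (fun k => expi (disp_phase t (r * z) (M + k))) L (C * M%:R `^ (1 - a)).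
  move=> /(_ (fun k _ => ltac:(by rewrite invr_ge0))) H.
  apply: (le_trans (H _ _)).
  - by right => k _; rewrite lef_pV2 ?posrE// ler_nat leq_add2l.
  - by move=> k kL; have := HC' (r * z) k kL; rewrite sum_nat_shift addKn.
  rewrite M1a addn0.
  have h : (M + L)%:R^-1 <= M%:R^-1 :> R by rewrite lef_pV2 ?posrE// ler_nat leq_addr.
  have h2 : (2 * ((M + L)%:R^-1 + M%:R^-1)) * M%:R <= 4 :> R.
    rewrite -ler_pdivlMr//; move: h; set u := _^-1; set v := _^-1; clear; lra.
  rewrite (_ : C * (M%:R * M%:R `^ (- a)) * _ = C * M%:R `^ (- a) * ((2 * ((M + L)%:R^-1 + M%:R^-1)) * M%:R)); last by ring.
  rewrite (_ : 4 * C * M%:R `^ (- a) = C * M%:R `^ (- a) * 4); last by ring.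
  by rewrite ler_wpM2l// mulr_ge0 ?powR_ge0// ltW.
have coefE (w : int -> R[i]) x : \sum_(m <- S) m%:~R%:C * fourier g m * (d m * w m) * expi (m%:~R * x) =
    \sum_(M <= n < M + L) evo_coef (sgn_int s n) x * w (sgn_int s n).
  rewrite big_map -/(index_iota M (M + L)); apply: eq_big_nat => n /andP[Mn _].
  rewrite /evo_coef /d expiD.
  have : ((sgn_int s n)%:~R%:C * ((sgn_int s n)%:~R^-1)%:C = 1 :> R[i]) by rewrite -realCM mulfV ?nz.
  move: (_%:~R%:C) (_^-1%:C) => A B AB.
  rewrite -[RHS]mul1r -AB; ring.
have X0 : 0 <= M%:R `^ (- a) :> R by rewrite powR_ge0.
split=> [x|x h].
  have QB' z : nc (\sum_(m <- S) d m * 1 * expi (m%:~R * z)) <= 4 * C * M%:R `^ (- a).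
    by rewrite (eq_bigr (fun m => d m * expi (m%:~R * z))) => [|m _]; rewrite ?mulr1//; exact: QB.
  have := HG S (fun m => d m * 1) _ QB' x; rewrite (coefE (fun=> 1)).
  rewrite (eq_bigr (fun n => evo_coef (sgn_int s n) x)) => [H|n _]; last by rewrite mulr1.
  apply: (le_trans H); rewrite -subr_ge0 (_ : _ - _ = 4 * C * M%:R `^ (- a)); last by ring.
  by rewrite !mulr_ge0// ltW.
have QB' z : nc (\sum_(m <- S) d m * (expi (m%:~R * h) - 1) * expi (m%:~R * z)) <= 2 * (C * M%:R `^ (1 - a)) * `|h|.
  have -> : \sum_(m <- S) d m * (expi (m%:~R * h) - 1) * expi (m%:~R * z) = Q (z + h) - Q z.
    rewrite /Q -sumrB; apply: eq_bigr => m _.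
    by rewrite (mulrDr m%:~R z h) expiD; ring.
  have -> : `|h| = `|(z + h) - z| by rewrite addrC addKr.
  apply: (@nc_mvt R Q (fun z => \sum_(m <- S) d m * ('i * m%:~R%:C * expi (m%:~R * z)))).
    apply: cderivable_sum => m; apply: cderivableZ.
    have := @cderivable_expi R m%:~R 0.
    rewrite (_ : (fun y => expi (m%:~R * y + 0)) = (fun y => expi (m%:~R * y))); last by apply/funext => y; rewrite addr0.
    by rewrite (_ : (fun y => 'i * m%:~R%:C * expi (m%:~R * y + 0)) = (fun y => 'i * m%:~R%:C * expi (m%:~R * y)))//; apply/funext => y; rewrite addr0.
  move=> y.
  have -> : \sum_(m <- S) d m * ('i * m%:~R%:C * expi (m%:~R * y)) = 'i * \sum_(M <= n < M + L) expi (disp_phase t (r * y) n).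
    rewrite big_map -/(index_iota M (M + L)) mulr_sumr; apply: eq_big_nat => n /andP[Mn _].
    rewrite -evo_phase expiD /d.
    have : ((sgn_int s n)%:~R^-1)%:C * (sgn_int s n)%:~R%:C = 1 :> R[i] by rewrite -realCM mulVf ?nz.
    move: (_%:~R%:C) (_^-1%:C) => A B AB.
    rewrite -[RHS]mul1r -AB; ring.
  by rewrite ncM nc_i mul1r; exact: HC'.
have := HG S (fun m => d m * (expi (m%:~R * h) - 1)) _ QB' x.
rewrite (coefE (fun m => expi (m%:~R * h) - 1)).
rewrite (eq_bigr (fun n => evo_coef (sgn_int s n) (x + h) - evo_coef (sgn_int s n) x)) => [H|n _]; last first.
  by rewrite /evo_coef (mulrDr (_%:~R) x h) addrA (expiD (_ + _)); ring.
apply: (le_trans H).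
rewrite (_ : Cg * _ = 2 * Cg * C * (`|h| * M%:R `^ (1 - a))); last by ring.
rewrite ler_wpM2r ?mulr_ge0 ?powR_ge0// ler_pM2r//; lra.
Qed.

End EvolutionBlocks.

(** * From dyadic bounds to limits *)

Section DyadicLimit.
Context {R : realType}.
Implicit Types (v w : nat -> R[i]) (a C e : R).

Lemma powRN_decr (x y a : R) : 0 < a -> 0 < x -> x <= y -> y `^ (- a) <= x `^ (- a).
Proof.
move=> a0 x0 xy; have y0 : 0 < y by exact: lt_le_trans xy.
by rewrite !powRN lef_pV2 ?posrE ?powR_gt0// powR_le// ltW.
Qed.

Lemma powRN_small a e : 0 < a -> 0 < e -> exists N : nat, forall n, (N <= n)%N -> n.+1%:R `^ (- a) <= e.
Proof.
move=> a0 e0; exists (Num.bound (e `^ (- a^-1))) => n Nn.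
have h1 : e `^ (- a^-1) <= n.+1%:R.
  apply: (@le_trans _ _ (Num.bound (e `^ (- a^-1)))%:R); first by rewrite ltW// archi_boundP// powR_ge0.
  by rewrite ler_nat (leq_trans Nn).
have := powRN_decr a0 (powR_gt0 (- a^-1) e0) h1.
by rewrite -powRrM mulrNN mulVf ?gt_eqF// powRr1// ltW.
Qed.

Lemma le_powRN_le0 (c K a : R) : 0 < a -> 0 <= K -> (forall n, c <= K * n.+1%:R `^ (- a)) -> c <= 0.
Proof.
move=> a0 K0 h; rewrite leNgt; apply/negP => c0.
have e0 : 0 < c / (2 * (K + 1)) by rewrite divr_gt0//; lra.
have [N /(_ N (leqnn N)) hN] := powRN_small a0 e0.
have := le_trans (h N) (ler_wpM2l K0 hN).
have -> : K * (c / (2 * (K + 1))) = c * (K / (2 * (K + 1))) by ring.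
have : K / (2 * (K + 1)) < 1 by rewrite ltr_pdivrMr; lra.
by move=> h1; rewrite leNgt -ltr_pdivlMl// mulVf ?gt_eqF// h1.
Qed.

(** [M] is doubled until [M'] is within reach. The constant [D = C / (1 - r)], with [r = 2 ^ - a],
    is the solution of [C + r D = D]. *)
Lemma dyadic_tail v a C : 0 < a -> 0 <= C ->
  (forall M L, (0 < M)%N -> (L <= M)%N -> nc (v (M + L)%N - v M) <= C * M%:R `^ (- a)) ->
  forall M M', (0 < M)%N -> (M <= M')%N -> nc (v M' - v M) <= C / (1 - 2 `^ (- a)) * M%:R `^ (- a).
Proof.
move=> a0 C0 hv.
set r := 2 `^ (- a); have r1 : r < 1.
  have := @gt0_ltr_powR R _ a0; rewrite /r powRN invf_lt1 ?powR_gt0// => /(_ 1 2).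
  by rewrite powR1 !nnegrE !ler0n => -> //; rewrite ltr1n.
have r0 : 0 < r by rewrite powR_gt0.
have CC : C <= C / (1 - r) by rewrite ler_pdivlMr ?subr_gt0// ler_piMr//; lra.
move=> M M'; have [k] := ubnP (M' - M); elim: k M => // k ih M Mk M0 MM'.
have X0 : 0 <= M%:R `^ (- a) :> R by rewrite powR_ge0.
have [h|h] := leqP M' (M + M).
  rewrite -(subnKC MM'); apply: (le_trans (hv _ _ M0 _)); last exact: ler_wpM2r.
  by rewrite leq_subLR.
have M20 : (0 < M + M)%N by rewrite addn_gt0 M0.
have h1 := ih (M + M)%N ltac:(lia) M20 (ltnW h).
apply: (le_trans (nc_triangle _ (v (M + M)%N) _)).
apply: (le_trans (lerD h1 (hv M M M0 (leqnn M)))).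
rewrite natrD -mulr2n -[_ *+ 2]mulr_natl powRM ?ler0n// -/r.
rewrite le_eqVlt; apply/orP; left; apply/eqP; field; lra.
Qed.

(** The constant [D = C / (r - 1)], with [r = 2 ^ b], is the solution of [C + D = r D]. *)
Lemma dyadic_growth w b C : 0 < b -> 0 <= C -> w 1%N = 0 ->
  (forall M L, (0 < M)%N -> (L <= M)%N -> nc (w (M + L)%N - w M) <= C * M%:R `^ b) ->
  forall J : nat, nc (w (2 ^ J)%N) <= C / (2 `^ b - 1) * (2 ^ J)%:R `^ b.
Proof.
move=> b0 C0 w1 hw.
set r := 2 `^ b; have r1 : 1 < r.
  have := @gt0_ltr_powR R _ b0 1 2.
  by rewrite powR1 !nnegrE !ler0n => -> //; rewrite ltr1n.
have D0 : 0 <= C / (r - 1) by rewrite divr_ge0// subr_ge0 ltW.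
elim=> [|J ih]; first by rewrite expn0 w1 nc0 mulr_ge0 ?powR_ge0.
have := hw (2 ^ J)%N (2 ^ J)%N; rewrite expn_gt0 /= => /(_ isT (leqnn _)) h.
rewrite expnS mul2n -addnn.
have -> : w (2 ^ J + 2 ^ J)%N = (w (2 ^ J + 2 ^ J)%N - w (2 ^ J)%N) + w (2 ^ J)%N by rewrite subrK.
apply: (le_trans (ncD _ _)); apply: (le_trans (lerD h ih)).
rewrite natrD -mulr2n -[_ *+ 2]mulr_natl powRM ?ler0n// -/r.
rewrite le_eqVlt; apply/orP; left; apply/eqP; field; lra.
Qed.

(** Any two intervals of centre [v m] and radius [eps m] intersect, so the infimum of their right
    ends belongs to all of them. *)
Lemma real_limit (v eps : nat -> R) : (forall m, 0 <= eps m) ->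
  (forall m n, (m <= n)%N -> `|v n - v m| <= eps m) -> exists l, forall m, `|v m - l| <= eps m.
Proof.
move=> e0 hv; pose A := [set x | exists m, x = v m + eps m].
have lb n : lbound A (v n - eps n).
  move=> _ [m ->]; have [/hv h|/ltnW /hv h] := leqP m n; have := e0 m; have := e0 n; move: h; rewrite ler_norml.
    by move=> /andP[]; lra.
  by move=> /andP[]; lra.
exists (inf A) => m; rewrite ler_norml; apply/andP; split.
  have : inf A <= v m + eps m by apply: ge_inf; [exists (v 0%N - eps 0%N); exact: lb|exists m].
  lra.
have : v m - eps m <= inf A by apply: lb_le_inf; [exists (v 0%N + eps 0%N); exists 0%N|exact: lb].
lra.
Qed.

Lemma complex_limit v (eps : nat -> R) : (forall m, 0 <= eps m) ->
  (forall m n, (m <= n)%N -> nc (v n - v m) <= eps m) -> exists l, forall m, nc (v m - l) <= 2 * eps m.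
Proof.
move=> e0 hv.
have [m n mn|x hx] := @real_limit (fun m => Re (v m)) eps e0.
  by rewrite -ReB; exact: le_trans (nc_Re _) (hv m n mn).
have [m n mn|y hy] := @real_limit (fun m => Im (v m)) eps e0.
  by rewrite -ImB; exact: le_trans (nc_Im _) (hv m n mn).
exists (x +i* y) => m; apply: (le_trans (nc_ReIm _)); rewrite ReB ImB /=.
by have := hx m; have := hy m; lra.
Qed.

Lemma cvge0P (f : nat -> \bar R) : (forall n, 0 <= f n)%E ->
  (f n @[n --> \oo] --> 0%E) <-> forall e, 0 < e -> exists N, forall n, (N <= n)%N -> (f n <= e%:E)%E.
Proof.
move=> f0; split => [fc e e0|h].
  have : nbhs (0%:E : \bar R) [set y : \bar R | (y < e%:E)%E].
    by apply: open_nbhs_nbhs; split; [exact: open_ereal_lt_ereal|rewrite /= lte_fin].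
  by move=> /fc [N _ hN]; exists N => n Nn; rewrite ltW//; exact: hN.
move=> A /= [e /= e0 eA].
have [N hN] := h (e / 2) ltac:(lra).
exists N => // n Nn; have := hN n Nn; have := f0 n; rewrite /=.
case: (f n) => [r| |]//; rewrite !lee_fin => r0 re.
by apply: eA; rewrite /= sub0r normrN ger0_norm//; lra.
Qed.

End DyadicLimit.

(** * Uniqueness of the continuous representative *)

Section EvolutionLimit.
Context {R : realType}.
Local Notation mu := (@lebesgue_measure R).
Local Notation per := `[0, 2 * pi]%classic.

Lemma ccontinuous_measurable (f : R -> R[i]) (D : set (measurableTypeR R)) : ccontinuous f ->
  measurable_fun D (fun x => nc (f x) ^+ 2).
Proof.
move=> [f1 f2]; under eq_fun do rewrite nc_sqr.
apply: measurable_realfun.measurable_funD; apply: measurable_realfun.measurable_funX; apply: measurable_funTS;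
  exact: measurable_realfun.continuous_measurable_fun.
Qed.

Lemma periodicz (f : R -> R[i]) (T : R) (n : int) x : periodic f T -> f (x + n%:~R * T) = f x.
Proof.
move=> fT; case: n => n; first by rewrite -pmulrn mulr_natl periodicn.
by rewrite NegzE intrN -pmulrn mulNr mulr_natl -[LHS](periodicn fT n.+1) subrK.
Qed.

Lemma periodic_reduce (x : R) : exists n : int, 0 <= x + n%:~R * (2 * pi) <= 2 * pi.
Proof.
have p0 : 0 < 2 * pi :> R by rewrite mulr_gt0// pi_gt0.
exists (- Num.floor (x / (2 * pi))).
have := floor_itv (x / (2 * pi)); rewrite intrN mulNr ler_pdivlMr// ltr_pdivrMr// intrD.
by move=> /andP[h1 h2]; apply/andP; lra.
Qed.

(* Positivity at one point spreads to a nondegenerate interval inside the period. *)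
Lemma integral0_continuous_eq0 (f : R -> R) (a b : R) : a < b -> continuous f -> (forall x, 0 <= f x) ->
  (\int[mu]_(x in `[a, b]) (f x)%:E = 0)%E -> forall x, a <= x <= b -> f x = 0.
Proof.
move=> ab fc f0 I0 x /andP[ax xb]; apply/eqP; rewrite eq_le f0 andbT leNgt; apply/negP => fx.
have : \forall y \near x, f x / 2 < f y.
  by have /cvgrPdist_lt/(_ (f x / 2)) := fc x; move=> /(_ ltac:(lra)); apply: filterS => y; rewrite ltr_norml => /andP[_]; lra.
move=> /nbhs_ballP[e /= e0 he].
pose d := Num.min (e / 2) (b - a); have d0 : 0 < d by rewrite lt_min; apply/andP; lra.
have de : d <= e / 2 by rewrite ge_min lexx.
have dba : d <= b - a by rewrite ge_min lexx orbT.
have [c [ac cb cx]] : exists c, [/\ a <= c, c + d / 2 <= b & forall y, c <= y <= c + d / 2 -> `|x - y| < e].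
  have [h|h] := leP (x + d / 2) b.
    by exists x; split=> // y /andP[? ?]; rewrite ltr_norml; apply/andP; lra.
  by exists (x - d / 2); split; [lra|lra|move=> y /andP[? ?]; rewrite ltr_norml; apply/andP; lra].
have mf (D : set (measurableTypeR R)) : measurable_fun D (fun y : measurableTypeR R => (f y)%:E).
  by apply/measurable_realfun.measurable_EFinP; apply: measurable_funTS; exact: measurable_realfun.continuous_measurable_fun.
have [c2 c2E] : exists c2, c2 = c + d / 2 by exists (c + d / 2).
rewrite -c2E in cb cx.
have : (\int[mu]_(y in `[c, c2]) (f x / 2)%:E <= \int[mu]_(y in `[a, b]) (f y)%:E)%E.
  apply: (@le_trans _ _ (\int[mu]_(y in `[c, c2]) (f y)%:E)%E).
    apply: ge0_le_integral => //.
    - by move=> y _; rewrite lee_fin; lra.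
    - move=> y /=; rewrite in_itv /= => yc; rewrite lee_fin ltW// he//; exact: cx.
  apply: ge0_subset_integral => //.
  - by move=> y _; rewrite lee_fin.
  - by move=> y /=; rewrite !in_itv /= => /andP[? ?]; apply/andP; lra.
rewrite I0 integral_cst//= lebesgue_measure_itv /= lte_fin (_ : c < c2); last by lra.
rewrite -EFinB -EFinM lee_fin leNgt => /negP; apply.
by rewrite mulr_gt0//; lra.
Qed.

Lemma sqr_nc_split (z u w : R[i]) : nc (z - w) ^+ 2 <= 2 * nc (u - z) ^+ 2 + 2 * nc (u - w) ^+ 2.
Proof.
have := nc_triangle z u w; rewrite (ncBC z u); have := nc_ge0 (z - w); have := nc_ge0 (u - z); have := nc_ge0 (u - w).
move: (nc _) (nc _) (nc _) => s y x x0 y0 s0 h.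
have := sqr_ge0 (y - x); have : s ^+ 2 <= (y + x) ^+ 2 by rewrite lerXn2r ?nnegrE//; lra.
have -> : (y + x) ^+ 2 = 2 * y ^+ 2 + 2 * x ^+ 2 - (y - x) ^+ 2 by ring.
by lra.
Qed.

Lemma ccontinuousB (f h : R -> R[i]) : ccontinuous f -> ccontinuous h -> ccontinuous (fun y => f y - h y).
Proof.
move=> fc hc; have := ccontinuousD fc (ccontinuousZ (-1) hc).
by rewrite (_ : (fun y => f y + -1 * h y) = (fun y => f y - h y))//; apply/funext => y; rewrite mulN1r.
Qed.

Lemma ccontinuous_sqr_nc (f : R -> R[i]) : ccontinuous f -> continuous (fun y => nc (f y) ^+ 2).
Proof.
move=> [f1 f2] y; rewrite (_ : (fun y => _) = (fun y => Re (f y) * Re (f y) + Im (f y) * Im (f y))).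
  by apply: cvgD; apply: cvgM; [exact: f1|exact: f1|exact: f2|exact: f2].
by apply/funext => z; rewrite nc_sqr.
Qed.

Context (t : R) (g : R -> R[i]).

Lemma ccontinuous_evo_sum M : ccontinuous (evo_sum t g M).
Proof.
have hc n : ccontinuous (evo_coef t g n).
  rewrite (_ : evo_coef t g n = (fun y => fourier g n * expi (n%:~R * y + t * omega32 n))).
    by apply: ccontinuousZ; exact: ccontinuous_expi.
  by apply/funext => y; rewrite /evo_coef addrC.
apply: ccontinuousD => //; apply: (@ccontinuous_sum R _ _ (fun n y => evo_coef t g n%:Z y + evo_coef t g (- n%:Z) y)) => n.
exact: ccontinuousD.
Qed.

Lemma evo_coef_periodic n : periodic (evo_coef t g n) (2 * pi).
Proof. by move=> x; rewrite /evo_coef mulrDr addrA expiD [n%:~R * (2 * pi)]mulrC expi2piz mulr1. Qed.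

Lemma evo_sum_periodic M : periodic (evo_sum t g M) (2 * pi).
Proof.
move=> x; rewrite /evo_sum evo_coef_periodic; congr (_ + _); apply: eq_bigr => n _.
by rewrite !evo_coef_periodic.
Qed.

(** Two mean-square limits of the same sums are at distance 0, and continuity makes them equal
    everywhere. This identifies [evolution], a chosen value, with the uniform limit of the partial
    sums. *)
Lemma is_evolution_unique u v : is_evolution omega32 t g u -> is_evolution omega32 t g v -> u = v.
Proof.
move=> [up uc1 uc2 ul] [vp vc1 vc2 vl]; apply/funext => x.
have p0 : 0 < 2 * pi :> R by rewrite mulr_gt0// pi_gt0.
have uc : ccontinuous u by [].
have vc : ccontinuous v by [].
have [n xn] := periodic_reduce x; rewrite -(periodicz n x up) -(periodicz n x vp).
move: (x + _) xn => y yp; apply/eqP; rewrite -subr_eq0 -sqrf_eq0.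
have I0 : (\int[mu]_(x in per) (nc (u x - v x) ^+ 2)%:E = 0)%E.
  apply/eqP; rewrite eq_le integral_ge0 ?andbT; last by move=> z _; rewrite lee_fin sqr_ge0.
  apply/lee_addgt0Pr => e e0; rewrite add0e.
  have I0N (w : R -> R[i]) N : (0 <= \int[mu]_(x in per) (nc (evolution_partial_sum omega32 t g N x - w x) ^+ 2)%:E)%E.
    by apply: integral_ge0 => z _; rewrite lee_fin sqr_ge0.
  have [N hN] := (cvge0P (I0N u)).1 ul (e / 4) ltac:(lra).
  have [N' hN'] := (cvge0P (I0N v)).1 vl (e / 4) ltac:(lra).
  have {}hN := hN (maxn N N') (leq_maxl _ _).
  have {}hN' := hN' (maxn N N') (leq_maxr _ _).
  move: (maxn N N') hN hN' => k hN hN'.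
  have Tc : ccontinuous (evolution_partial_sum omega32 t g k).
    by rewrite (_ : evolution_partial_sum omega32 t g k = evo_sum t g k.+1);
      [exact: ccontinuous_evo_sum|apply/funext => z; rewrite evolution_partial_sumE].
  have mE (f : R -> R[i]) (D : set (measurableTypeR R)) : ccontinuous f -> measurable_fun D (fun x => (nc (f x) ^+ 2)%:E).
    by move=> fc; apply/measurable_realfun.measurable_EFinP; exact: ccontinuous_measurable.
  have m2E (f : R -> R[i]) (D : set (measurableTypeR R)) : ccontinuous f -> measurable_fun D (fun x => (2 * nc (f x) ^+ 2)%:E).
    move=> fc; apply/measurable_realfun.measurable_EFinP; apply: measurable_funM; first exact: measurable_cst.
    exact: ccontinuous_measurable.
  have ZE (f : R -> R[i]) : ccontinuous f -> (\int[mu]_(x in per) (2 * nc (f x) ^+ 2)%:E = 2%:E * \int[mu]_(x in per) (nc (f x) ^+ 2)%:E)%E.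
    move=> fc; under eq_integral do rewrite EFinM.
    by rewrite ge0_integralZl_EFin//; [move=> z _; rewrite lee_fin sqr_ge0|exact: mE].
  apply: (@le_trans _ _ (\int[mu]_(x in per) ((2 * nc (evolution_partial_sum omega32 t g k x - u x) ^+ 2)%:E +
     (2 * nc (evolution_partial_sum omega32 t g k x - v x) ^+ 2)%:E))%E).
    apply: ge0_le_integral => //.
    - by move=> z _; rewrite lee_fin sqr_ge0.
    - exact: mE (ccontinuousB uc vc).
    - by apply: emeasurable_funD; apply: m2E; exact: ccontinuousB.
    - move=> z _; rewrite -EFinD lee_fin; exact: sqr_nc_split.
  rewrite ge0_integralD//=; last 4 first.
  - by move=> z _; rewrite lee_fin mulr_ge0 ?sqr_ge0.
  - by apply: m2E; exact: ccontinuousB.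
  - by move=> z _; rewrite lee_fin mulr_ge0 ?sqr_ge0.
  - by apply: m2E; exact: ccontinuousB.
  rewrite (ZE _ (ccontinuousB Tc uc)) (ZE _ (ccontinuousB Tc vc)).
  apply: (@le_trans _ _ (2%:E * (e / 4)%:E + 2%:E * (e / 4)%:E)%E).
    by apply: leeD; rewrite lee_pmul2l.
  by rewrite -!EFinM -EFinD lee_fin; lra.
have := integral0_continuous_eq0 p0 (ccontinuous_sqr_nc (ccontinuousB uc vc)) (fun x => sqr_ge0 _) I0 yp.
rewrite !sqrf_eq0 => /eqP; rewrite sqrf_eq0 => /eqP /ComplexField.Normc.eq0_normc ->; exact: eqxx.
Qed.

End EvolutionLimit.

(** * Existence and Hoelder continuity of the evolution *)

Section EvolutionRegularity.
Context {R : realType}.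
Local Notation mu := (@lebesgue_measure R).
Local Notation per := `[0, 2 * pi]%classic.
Context (t : R) (g : R -> R[i]).
Context (gBV : BV_torus g) (t0 : t != 0) (KL : Khinchin_Levy (4 / 27 * (t / (2 * pi)) ^- 2)).
Local Notation S := (evo_sum t g).

Lemma evo_sum_dyadic_bounds (a : R) : a < 3 / 8 -> exists2 C : R, 0 < C & forall M L : nat, (0 < M)%N -> (L <= M)%N ->
  (forall x, nc (S (M + L) x - S M x) <= C * M%:R `^ (- a)) /\
  (forall x h, nc ((S (M + L) (x + h) - S (M + L) x) - (S M (x + h) - S M x)) <= C * (`|h| * M%:R `^ (1 - a))).
Proof.
move=> a38; have [C1 C10 H1] := evo_block_bounds gBV t0 KL false a38.
have [C2 C20 H2] := evo_block_bounds gBV t0 KL true a38.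
exists (C1 + C2) => [|M L M0 LM]; first exact: addr_gt0.
have [A1 B1] := H1 M L M0 LM; have [A2 B2] := H2 M L M0 LM; split => [x|x h].
  by rewrite evo_sum_block// mulrDl; apply: (le_trans (ncD _ _)); exact: lerD.
rewrite (_ : _ - _ = (S (M + L) (x + h) - S M (x + h)) - (S (M + L) x - S M x)); last by ring.
rewrite !evo_sum_block// opprD addrACA -!sumrB mulrDl.
by apply: (le_trans (ncD _ _)); exact: lerD.
Qed.

Lemma evolution_limit (a : R) : 0 < a -> a < 3 / 8 -> exists u : R -> R[i], exists2 C : R, 0 < C &
  forall M x, (0 < M)%N -> nc (S M x - u x) <= C * M%:R `^ (- a).
Proof.
move=> a0 a38; have [C C0 H] := evo_sum_dyadic_bounds a38.
have D0 : 0 < C / (1 - 2 `^ (- a)).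
  rewrite divr_gt0// subr_gt0 powRN invf_lt1 ?powR_gt0//.
  have := @gt0_ltr_powR R _ a0 1 2.
  by rewrite powR1 !nnegrE !ler0n => -> //; rewrite ltr1n.
move: (C / _) D0 (fun x => dyadic_tail a0 (ltW C0) (fun M L M0 LM => (H M L M0 LM).1 x)) => D D0 HD.
have ex x : exists l, forall m, nc (S m.+1 x - l) <= 2 * (D * m.+1%:R `^ (- a)).
  apply: (@complex_limit _ (fun m => S m.+1 x) (fun m => D * m.+1%:R `^ (- a))) => [m|m n mn].
    by rewrite mulr_ge0 ?powR_ge0// ltW.
  exact: HD.
have [u hu] := choice ex; exists u, (2 * D) => [|[//|M] x _]; first by rewrite mulr_gt0.
by rewrite -mulrA; exact: hu.
Qed.

(** The sum of index [2 ^ 0 = 1] is the constant mode, without increments; from there the increments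
    of the dyadic blocks grow geometrically, since [1 - a > 0]. *)
Lemma evo_sum_lipschitz (a : R) : a < 3 / 8 -> exists2 C : R, 0 < C &
  forall J x h, nc (S (2 ^ J) (x + h) - S (2 ^ J) x) <= C * (`|h| * (2 ^ J)%:R `^ (1 - a)).
Proof.
move=> a38; have [C C0 H] := evo_sum_dyadic_bounds a38.
have b0 : 0 < 1 - a by lra.
exists (C / (2 `^ (1 - a) - 1)) => [|J x h].
  rewrite divr_gt0// subr_gt0.
  have := @gt0_ltr_powR R _ b0 1 2.
  by rewrite powR1 !nnegrE !ler0n => -> //; rewrite ltr1n.
have := @dyadic_growth R (fun M => S M (x + h) - S M x) (1 - a) (C * `|h|) b0 _ _ _ J.
rewrite (mulrAC C `|h|) -(mulrA (C / _)); apply.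
- by rewrite mulr_ge0// ltW.
- by rewrite /evo_sum !big_geq// !addr0 /evo_coef !mul0r subrr.
- by move=> M L M0 LM; rewrite -mulrA; exact: (H M L M0 LM).2.
Qed.

(** The frequencies are cut at a power of 2 comparable to [1 / |h|]: there the tail [M ^ - a] and
    the increment [|h| M ^ (1 - a)] of the partial sum are both of order [|h| ^ a]. *)
Lemma limit_holder (u : R -> R[i]) (a C : R) : 0 < a -> a < 3 / 8 -> 0 < C ->
  (forall M x, (0 < M)%N -> nc (S M x - u x) <= C * M%:R `^ (- a)) ->
  exists2 D : R, 0 < D & forall x h, `|h| <= 1 -> nc (u (x + h) - u x) <= D * `|h| `^ a.
Proof.
move=> a0 a38 C0 hu; have [C' C'0 H] := evo_sum_lipschitz a38.
exists (2 * (C * 2 `^ a) + C').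
  by rewrite addr_gt0// mulr_gt0// mulr_gt0// powR_gt0.
move=> x h h1; have [->|h0] := eqVneq h 0.
  by rewrite addr0 subrr nc0 normr0 powR0 ?mulr0// gt_eqF.
have hp : 0 < `|h| by rewrite normr_gt0.
have := @increasing_bracket (fun J => 2 ^ J)%N 0 (Num.trunc `|h|^-1) (fun n => ltac:(by rewrite ltn_exp2l)).
have trh := truncn_itv (ltW (etrans (invr_gt0 _) hp)).
case=> [|J [_ J1 J2]].
  by rewrite expn0 truncn_gt0 invf_ge1.
have M0 : (0 < 2 ^ J)%N by rewrite expn_gt0.
have M1 : (2 ^ J)%:R <= `|h|^-1.
  by case/andP: trh => h2 _; apply: (le_trans _ h2); rewrite ler_nat.
have M2 : `|h|^-1 <= 2 * (2 ^ J)%:R.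
  case/andP: trh => _ h2; rewrite ltW// -natrM -expnS; apply: (lt_le_trans h2); rewrite ler_nat.
  exact: J2.
have M0' : 0 < (2 ^ J)%:R :> R by rewrite ltr0n.
move: M0 (hu _ x M0) (hu _ (x + h) M0) (H J x h); move: (2 ^ J)%N M0' M1 M2 => M M0' M1 M2 M0 e1 e2 e3.
have f1 : M%:R `^ (- a) <= 2 `^ a * `|h| `^ a.
  have k0 : 0 < (2 * `|h|)^-1 by rewrite invr_gt0 mulr_gt0.
  have kM : (2 * `|h|)^-1 <= M%:R by rewrite invfM mulrC ler_pdivrMr// mulrC.
  apply: (le_trans (powRN_decr a0 k0 kM)).
  by rewrite -powR_inv1 ?mulr_ge0// -powRrM mulrNN mul1r powRM.
have f2 : `|h| * M%:R `^ (1 - a) <= `|h| `^ a.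
  have := @powR_le R M%:R `|h|^-1 (1 - a) ltac:(lra) (ltW M0') M1.
  rewrite -powR_inv1// -powRrM => f; apply: (le_trans (ler_wpM2l (normr_ge0 h) f)).
  by rewrite -{1}[`|h|]powRr1// -powRDp// (_ : 1 + _ = a)//; ring.
have f3 := ler_wpM2l (ltW C0) f1.
have f4 := ler_wpM2l (ltW C'0) f2.
have -> : u (x + h) - u x = (S M (x + h) - S M x) + (S M x - u x) - (S M (x + h) - u (x + h)) by ring.
apply: (le_trans (ncB _ _)); apply: (le_trans (lerD (ncD _ _) (lexx _))).
rewrite mulrDl -!mulrA.
move: (nc _) (nc _) (nc _) (_ * _) (_ * _) (_ * _) e1 e2 e3 f3 f4 => A B D E F G e1 e2 e3 f3 f4; lra.
Qed.

Lemma holder_ccontinuous (u : R -> R[i]) (a C : R) : 0 < a -> 0 < C ->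
  (forall x h, `|h| <= 1 -> nc (u (x + h) - u x) <= C * `|h| `^ a) -> ccontinuous u.
Proof.
move=> a0 C0 hu.
suff H (f : R -> R) : (forall x y, `|f x - f y| <= nc (u x - u y)) -> continuous f.
  split; apply: H => x y; first by rewrite -ReB; exact: nc_Re.
  by rewrite -ImB; exact: nc_Im.
move=> hf x; apply/cvgrPdist_le => e e0.
pose d := Num.min 1 ((e / C) `^ a^-1).
have d0 : 0 < d by rewrite lt_min ltr01 powR_gt0// divr_gt0.
near=> y.
have hy : `|x - y| <= d by near: y; apply: cvgr_dist_le.
have d1 : d <= 1 by rewrite ge_min lexx.
apply: (le_trans (hf _ _)); have := hu y (x - y) (le_trans hy d1); rewrite addrCA subrr addr0 => /le_trans; apply.
rewrite mulrC -ler_pdivlMr//.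
apply: (@le_trans _ _ (((e / C) `^ a^-1) `^ a)).
  by apply: powR_le => //; [exact: ltW|apply: (le_trans hy); rewrite ge_min lexx orbT].
by rewrite -powRrM mulVf ?gt_eqF// powRr1// ltW// divr_gt0.
Unshelve. all: by end_near.
Qed.

Lemma limit_is_evolution (u : R -> R[i]) (a C : R) : 0 < a -> a < 3 / 8 -> 0 < C ->
  (forall M x, (0 < M)%N -> nc (S M x - u x) <= C * M%:R `^ (- a)) -> is_evolution omega32 t g u.
Proof.
move=> a0 a38 C0 hu; have [D D0 hD] := limit_holder a0 a38 C0 hu.
have [uc1 uc2] := holder_ccontinuous a0 D0 hD.
have up : periodic u (2 * pi).
  move=> x; apply/eqP; rewrite -subr_eq0; apply/eqP/ComplexField.Normc.eq0_normc/eqP.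
  rewrite eq_le nc_ge0 andbT; apply: (@le_powRN_le0 R _ (2 * C) a) => // [|n].
    by rewrite mulr_ge0// ltW.
  have := hu n.+1 x isT; have := hu n.+1 (x + 2 * pi) isT; rewrite evo_sum_periodic.
  have -> : u (x + 2 * pi) - u x = (S n.+1 x - u x) - (S n.+1 x - u (x + 2 * pi)) by ring.
  have := ncB (S n.+1 x - u x) (S n.+1 x - u (x + 2 * pi)).
  by rewrite -mulrA; move: (nc _) (nc _) (nc _) (_ * _ `^ _) => A B E F; lra.
split=> //; apply/cvge0P => [n|e e0].
  by apply: integral_ge0 => z _; rewrite lee_fin sqr_ge0.
have p0 : 0 < pi :> R by exact: pi_gt0.
have K0 : 0 < 2 * pi * C ^+ 2 by rewrite !mulr_gt0// exprn_gt0.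
have a20 : 0 < a * 2 by rewrite mulr_gt0.
have [N hN] := powRN_small a20 (divr_gt0 e0 K0).
exists N => n Nn.
have le1 (x : R) : nc (evolution_partial_sum omega32 t g n x - u x) ^+ 2 <= C ^+ 2 * n.+1%:R `^ (- (a * 2)).
  rewrite evolution_partial_sumE -mulNr powRrM [_ `^ 2](powR_mulrn 2) ?powR_ge0// -exprMn.
  by rewrite lerXn2r ?nnegrE ?nc_ge0 ?mulr_ge0 ?powR_ge0 ?(ltW C0)//; exact: hu.
apply: (@le_trans _ _ (\int[mu]_(x in per) (C ^+ 2 * n.+1%:R `^ (- (a * 2)))%:E)%E).
  apply: ge0_le_integral => //.
  - by move=> z _; rewrite lee_fin sqr_ge0.
  - apply/measurable_realfun.measurable_EFinP; apply: ccontinuous_measurable; apply: ccontinuousB; last by [].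
    rewrite (_ : evolution_partial_sum omega32 t g n = S n.+1); first exact: ccontinuous_evo_sum.
    by apply/funext => z; rewrite evolution_partial_sumE.
  - by move=> z _; rewrite lee_fin.
rewrite integral_cst//= lebesgue_measure_itv /= lte_fin mulr_gt0// sube0 -EFinM lee_fin.
have := hN n Nn; rewrite ler_pdivlMr// => h.
by apply: le_trans h; rewrite le_eqVlt; apply/orP; left; apply/eqP; ring.
Qed.

Lemma evolution_exists : exists u, is_evolution omega32 t g u.
Proof.
have [] := @evolution_limit (1 / 8); [lra|lra|move=> u [C C0 hu]].
by exists u; apply: (limit_is_evolution _ _ C0 hu); lra.
Qed.

(** Each exponent [a] comes with its own limit; uniqueness identifies all of them with [evolution],
    so that [a] can approach 3/8 for one and the same function. *)
Lemma evolution_regularity (a : R) : 0 < a -> a < 3 / 8 -> exists2 C : R, 0 < C &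
  (forall x h, `|h| <= 1 -> nc (evolution omega32 t g (x + h) - evolution omega32 t g x) <= C * `|h| `^ a) /\
  (forall M x, (0 < M)%N -> nc (S M x - evolution omega32 t g x) <= C * M%:R `^ (- a)).
Proof.
move=> a0 a38; have [u [C C0 hu]] := evolution_limit a0 a38.
have uE : evolution omega32 t g = u.
  apply: is_evolution_unique; last exact: limit_is_evolution hu.
  exact: (xgetPex _ evolution_exists).
have [D D0 hD] := limit_holder a0 a38 C0 hu.
exists (C + D); rewrite ?addr_gt0// uE; split=> [x h h1|M x M0].
  by apply: (le_trans (hD x h h1)); rewrite ler_wpM2r ?powR_ge0// lerDr ltW.
by apply: (le_trans (hu M x M0)); rewrite ler_wpM2r ?powR_ge0// lerDl ltW.
Qed.

Lemma evolution_periodic : periodic (evolution omega32 t g) (2 * pi).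
Proof. by have [] := xgetPex (fun=> 0) evolution_exists. Qed.

Lemma evolution_ccontinuous : ccontinuous (evolution omega32 t g).
Proof. by have [] := xgetPex (fun=> 0) evolution_exists. Qed.
End EvolutionRegularity.

(** * Box dimension and Hoelder continuity *)

Section BoxDimension.
Context {R : realType}.
Implicit Types (E : set (R * R)) (e s C : R).

Definition covers E k e := exists c : 'I_k -> R * R, E `<=` \bigcup_i eball (c i) e.

Lemma fractal_dim_le E C s : 0 < C ->
  (forall e, 0 < e -> e <= 1 -> exists2 k, covers E k e & k%:R <= C * e `^ (- s)) -> (fractal_dim E <= s%:E)%E.
Proof.
move=> C0 h; apply/lee_addgt0Pr => eta eta0.
pose C1 := C + 1; have C11 : 1 < C1 by rewrite /C1; lra.
(* For [e < d], [ln (1 / e)] exceeds [ln C1 / eta], so the multiplicative constant costs at most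
   [eta] in the exponent. [C1 > 1] keeps [ln C1] nonnegative. *)
pose d : R := expR (- (ln C1 / eta + 1)).
have d0 : 0 < d by exact: expR_gt0.
have lC0 : 0 <= ln C1 / eta by rewrite divr_ge0 ?ln_ge0// ltW.
have d1 : d <= 1 by rewrite -expR0 ler_expR; lra.
have le1 e : 0 < e -> e < d -> (lne (covering_number E e) * (ln e^-1)^-1%:E <= (s + eta)%:E)%E.
  move=> e0 ed; have [k hk ke] := h e e0 (le_trans (ltW ed) d1).
  have le0 : ln C1 / eta + 1 < ln e^-1.
    rewrite lnV ?posrE// -ltrNr -[ltRHS]expRK -/d ltr_ln// posrE//.
  have lp : 0 < ln e^-1 by lra.
  have e1 : 0 < C1 * e `^ (- s) by rewrite mulr_gt0 ?powR_gt0//; lra.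
  have Nk : (covering_number E e <= (C1 * e `^ (- s))%:E)%E.
    apply: (@le_trans _ _ k%:R%:E); first by apply: ereal_inf_lbound; exists k.
    rewrite lee_fin; apply: (le_trans ke); rewrite ler_wpM2r ?powR_ge0// /C1; lra.
  have N0 : (0 <= covering_number E e)%E by apply: le_ereal_inf_tmp => _ [j _ <-]; rewrite lee_fin.
  rewrite lee_pdivrMr// -EFinM.
  apply: (@le_trans _ _ (lne (C1 * e `^ (- s))%:E)).
    rewrite lee_lne//; rewrite in_itv/= ?leey ?andbT// lee_fin ltW//.
  rewrite lne_EFin// lee_fin lnM ?posrE ?powR_gt0//; last lra.
  rewrite ln_powR mulNr -mulrN -lnV ?posrE// mulrDl addrC lerD2l.
  by rewrite mulrC -ler_pdivrMr//; lra.
rewrite /fractal_dim limf_esupE -EFinD.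
apply: (@le_trans _ _ (ereal_sup [set (lne (covering_number E e) * (ln e^-1)^-1%:E)%E | e in [set e | 0 < e < d]])).
  apply: ereal_inf_lbound; exists [set e | 0 < e < d] => //.
  near=> e; rewrite /=; apply/andP; split; near: e; [exact: nbhs_right_gt|exact: nbhs_right_lt].
by apply: ge_ereal_sup => _ [e /andP[e0 ed] <-]; exact: le1.
Unshelve. all: by end_near.
Qed.

(** A limit superior below [s] provides economical covers at every small scale; the decay argument
    uses one for each [N]. *)
Lemma fractal_dim_lt E s : (fractal_dim E < s%:E)%E ->
  exists2 d, 0 < d & forall e, 0 < e -> e < d -> exists2 k, covers E k e & k%:R <= e `^ (- s).
Proof.
rewrite /fractal_dim limf_esupE => /ereal_inf_lt[_ [V nV <-] hV].
move: nV; rewrite /at_right /= => /nbhs_ballP[d0 /= d00 hd].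
exists (Num.min d0 1) => [|e e0]; first by rewrite lt_min d00 ltr01.
rewrite lt_min => /andP[ed e1].
have eV : V e.
  by apply: hd => //=; rewrite /ball /= sub0r normrN gtr0_norm.
have lp : 0 < ln e^-1 by rewrite ln_gt0// invf_gt1.
have : (lne (covering_number E e) * (ln e^-1)^-1%:E < s%:E)%E.
  by apply: le_lt_trans hV; apply: ereal_sup_ubound; exists e.
rewrite lte_pdivrMr// -EFinM.
have -> : s * ln e^-1 = ln (e `^ (- s)) by rewrite ln_powR lnV ?posrE//; ring.
rewrite -lne_EFin ?powR_gt0// lte_lne; last 2 first.
- rewrite in_itv/= leey andbT; apply: le_ereal_inf_tmp => _ [j _ <-]; by rewrite lee_fin.
- by rewrite in_itv/= leey andbT lee_fin powR_ge0.
by move=> /ereal_inf_lt[_ [k hk <-]]; rewrite lte_fin => /ltW ke; exists k.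
Qed.

(** Columns of width [e / 2], and in each column centres spaced by [e / 2] over a height [2 W], the
    largest oscillation there. Quotient and remainder by [L] encode column and level in one
    index. *)
Lemma holder_covers (f : R -> R) (a C : R) : 0 < a -> a < 1 -> 0 < C ->
  (forall x h, `|h| <= 1 -> `|f (x + h) - f x| <= C * `|h| `^ a) ->
  forall e, 0 < e -> e <= 1 -> exists2 k, covers (graph_torus f) k e & k%:R <= (4 * pi + 1) * (4 * C + 1) * e `^ (- (2 - a)).
Proof.
move=> a0 a1 C0 hf e e0 e1; have p0 : 0 < pi :> R by exact: pi_gt0.
pose W := C * e `^ a; have W0 : 0 < W by rewrite mulr_gt0 ?powR_gt0.
pose J := (Num.trunc (4 * pi / e)).+1; pose L := (Num.trunc (4 * W / e)).+1.
pose X i : R := i%:R * (e / 2).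
exists (J * L)%N; last first.
  have J1 : J%:R <= (4 * pi + 1) * e^-1.
    have := truncn_itv (_ : 0 <= 4 * pi / e); rewrite divr_ge0 ?mulr_ge0// ?(ltW e0)// ?(ltW p0)// => /(_ isT)/andP[h _].
    have -> : J%:R = (Num.trunc (4 * pi / e))%:R + 1 :> R by rewrite natr1.
    by rewrite [leRHS]mulrDl mul1r lerD// invf_ge1.
  have L1 : L%:R <= (4 * C + 1) * e `^ (a - 1).
    have We0 : 0 <= 4 * W / e by apply: divr_ge0; [apply: mulr_ge0 => //; exact: ltW|exact: ltW].
    have /andP[h _] := truncn_itv We0.
    have -> : L%:R = (Num.trunc (4 * W / e))%:R + 1 :> R by rewrite natr1.
    rewrite [leRHS]mulrDl mul1r lerD//.
      by apply: (le_trans h); rewrite /W powRDp// powR_inv1 ?(ltW e0)// !mulrA.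
    rewrite (_ : a - 1 = -1 * (1 - a)); last by ring.
    by rewrite powRrM powR_inv1 ?(ltW e0)// powR_ge1 ?invf_ge1//; lra.
  rewrite natrM (_ : - (2 - a) = - 1 + (a - 1)); last by ring.
  rewrite powRDp// powR_inv1 ?(ltW e0)// mulrACA; exact: ler_pM.
exists (fun i => (X (i %/ L)%N, f (X (i %/ L)%N) - W + (i %% L)%:R * (e / 2))) => -[x y] [/= xI ->].
move: xI; rewrite in_itv /= => /andP[x0 x2].
have xe0 : 0 <= 2 * x / e by rewrite divr_ge0 ?mulr_ge0// ltW.
set i := Num.trunc (2 * x / e).
have iI := truncn_itv xe0; rewrite -/i in iI.
have iJ : (i < J)%N by rewrite ltnS; apply: le_truncn; rewrite ler_wpM2r ?invr_ge0 ?(ltW e0)//; lra.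
have Xx : X i <= x < X i + e / 2.
  rewrite /X -[X in _ < _ + X]mul1r -mulrDl natr1 !mulrA.
  move: iI; rewrite ler_pdivlMr// ltr_pdivrMr//; lra.
have hfx : `|f x - f (X i)| <= W.
  have := hf (X i) (x - X i); rewrite (addrC (X i)) subrK (ger0_norm (_ : 0 <= x - X i)); last by lra.
  move=> /(_ ltac:(lra)) /le_trans; apply; rewrite ler_pM2l//; apply: powR_le; lra.
have y0 : 0 <= f x - f (X i) + W by move: hfx; rewrite ler_norml => /andP[]; lra.
have y2 : f x - f (X i) + W <= 2 * W by move: hfx; rewrite ler_norml => /andP[]; lra.
have ye0 : 0 <= 2 * (f x - f (X i) + W) / e by rewrite divr_ge0 ?mulr_ge0// ltW.
set l := Num.trunc (2 * (f x - f (X i) + W) / e).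
have lI := truncn_itv ye0; rewrite -/l in lI.
have lL : (l < L)%N by rewrite ltnS; apply: le_truncn; rewrite ler_wpM2r ?invr_ge0 ?(ltW e0)//; lra.
have ilJ : (i * L + l < J * L)%N.
  by apply: (@leq_trans (i.+1 * L)); [rewrite mulSn addnC ltn_add2r|rewrite leq_mul2r iJ orbT].
exists (Ordinal ilJ) => //; rewrite /eball /= divnMDl// modnMDl divn_small// addn0 modn_small//.
set u := x - X i; set v := _ - (_ + _).
have u1 : 0 <= u <= e / 2 by rewrite /u; lra.
have v1 : 0 <= v <= e / 2.
  rewrite /v; move: lI; rewrite ler_pdivlMr// ltr_pdivrMr// -[l.+1%:R]natr1; clear; move: (l%:R : R) (f x) (f (X i)) => ll fx fX; lra.
rewrite -[ltRHS]ger0_norm ?(ltW e0)// -sqrtr_sqr ltr_sqrt ?exprn_gt0//.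
have : u ^+ 2 <= (e / 2) ^+ 2 by rewrite lerXn2r ?nnegrE; lra.
have : v ^+ 2 <= (e / 2) ^+ 2 by rewrite lerXn2r ?nnegrE; lra.
have : 0 < e ^+ 2 by rewrite exprn_gt0.
rewrite (_ : (e / 2) ^+ 2 = e ^+ 2 / 4); last by field.
lra.
Qed.

End BoxDimension.

(** * Oscillation and discrete Parseval *)

Section OscillationSum.
Context {R : realType}.

Lemma eball_coord (c p : R * R) (e : R) : eball c e p -> `|p.1 - c.1| < e /\ `|p.2 - c.2| < e.
Proof.
rewrite /eball /= => h.
have H (x y : R) : Num.sqrt (x ^+ 2 + y ^+ 2) < e -> `|x| < e.
  by apply: le_lt_trans; rewrite -sqrtr_sqr ler_sqrt ?addr_ge0 ?sqr_ge0// lerDl sqr_ge0.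
by split; [exact: H h|move: h; rewrite addrC; exact: H].
Qed.

Lemma natr_dist_ge1 (a b : nat) : a != b -> 1 <= `|a%:R - b%:R| :> R.
Proof.
wlog ba : a b / (b < a)%N => [H ab|_].
  have [|/H -> //|e] := ltngtP a b; last by rewrite e eqxx in ab.
  - by move=> /H; rewrite distrC => -> //; rewrite eq_sym.
rewrite -natrB ?(ltnW ba)// normr_nat ler1n subn_gt0 //.
Qed.

Lemma mod3_gap (a b : nat) : a = b %[mod 3] -> (b < a)%N -> (b.+3 <= a)%N.
Proof. lia. Qed.

(* Along the graph over each step pick points whose heights are [2 h] apart, one
   per [2 h] of increment: an [h]-ball then contains at most one of the points over
   the steps of a given residue modulo 3. *)
Lemma oscillation_sum (f : R -> R) (z h : R) (m k : nat) : 0 < h -> continuous f ->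
  0 <= z -> z + m%:R * h <= 2 * pi -> covers (graph_torus f) k h ->
  \sum_(j < m) `|f (z + j.+1%:R * h) - f (z + j%:R * h)| <= 6 * h * k%:R.
Proof.
move=> h0 fc z0 zm [c hc].
pose X (j : nat) : R := z + j%:R * h.
pose mi (j : nat) : R := Num.min (f (X j)) (f (X j.+1)).
pose osc (j : nat) : R := `|f (X j.+1) - f (X j)|.
have XS j : X j.+1 = X j + h by rewrite /X -natr1 mulrDl mul1r addrA.
have Xmono j j' : (j <= j')%N -> X j <= X j'.
  by move=> jj; rewrite /X lerD2l ler_pM2r// ler_nat.
pose n (j : 'I_m) : nat := (Num.trunc (osc j / (2 * h))).+1.
have h20 : 0 < 2 * h by lra.
have nI (j : 'I_m) : (n j)%:R - 1 <= osc j / (2 * h) < (n j)%:R.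
  have := truncn_itv (_ : 0 <= osc j / (2 * h)).
  rewrite divr_ge0 ?(ltW h20) ?normr_ge0// => /(_ isT) H.
  have e : (n j)%:R - 1 = (Num.trunc (osc j / (2 * h)))%:R :> R by rewrite /n -natr1 addrK.
  by rewrite e.
have minmax j : Num.max (f (X j)) (f (X j.+1)) = mi j + osc j.
  rewrite /mi /osc; have [ab|ab] := leP (f (X j)) (f (X j.+1)).
    by rewrite ger0_norm ?subr_ge0// addrC subrK.
  by rewrite ler0_norm ?subr_le0 ?(ltW ab)// opprB addrC subrK.
pose T := {j : 'I_m & 'I_(n j)}.
have pt (w : T) : exists p : R * R, [/\ graph_torus f p, X (tag w) <= p.1 <= X (tag w).+1 &
    p.2 = mi (tag w) + 2 * h * (tagged w)%:R].
  case: w => j l /=.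
  have XX : X j <= X j.+1 by exact: Xmono.
  have [||x xI fx] := @IVT R f (X j) (X j.+1) (mi j + 2 * h * l%:R) XX.
  - exact: continuous_subspaceT.
  - apply/andP; split; first by rewrite -/(mi j) lerDl mulr_ge0// ltW.
    rewrite minmax lerD2l mulrC -ler_pdivlMr//.
    have /andP[+ _] := nI j; apply: le_trans; rewrite lerBrDr natr1 ler_nat.
    exact: ltn_ord.
  move: xI; rewrite in_itv /= => xI; exists (x, f x); split => //; split => //=.
  rewrite in_itv /=; case/andP: xI => x1 x2; apply/andP; split.
    by apply: le_trans x1; rewrite addr_ge0// mulr_ge0// ltW.
  by apply: (le_trans x2); apply: le_trans zm; apply: (Xmono j.+1 m).
have exq (w : T) : exists q : 'I_k * 'I_3, (q.2 = (tag w) %% 3 :> nat)%N /\ exists p : R * R,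
   [/\ eball (c q.1) h p, X (tag w) <= p.1 <= X (tag w).+1 & p.2 = mi (tag w) + 2 * h * (tagged w)%:R].
  have [p [gp p1 p2]] := pt w; have [i _ ip] := hc p gp.
  by exists (i, inord (tag w %% 3)); split; [rewrite inordK// ltn_mod|exists p].
have [F hF] := choice exq.
have Finj : injective F.
  move=> [j l] [j' l'] Fe.
  have [q2 [p [pb p1 pE]]] := hF (existT _ j l); have [q2' [p' [pb' p1' pE']]] := hF (existT _ j' l').
  move: q2' pb'; rewrite -Fe q2 /= => jj3 pb'.
  have [d1 d2] := eball_coord pb; have [d1' d2'] := eball_coord pb'.
  have D1 : `|p.1 - p'.1| < 2 * h.
    by move: d1 d1'; rewrite !ltr_norml => /andP[? ?] /andP[? ?]; apply/andP; split; lra.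
  have D2 : `|p.2 - p'.2| < 2 * h.
    by move: d2 d2'; rewrite !ltr_norml => /andP[? ?] /andP[? ?]; apply/andP; split; lra.
  have far (a b : nat) (r s : R) : X a <= r <= X a.+1 -> X b <= s <= X b.+1 -> (a.+3 <= b)%N -> 2 * h <= s - r.
    move=> /andP[_ r2] /andP[s1 _] ab.
    have := Xmono _ _ ab; rewrite !XS; rewrite XS in r2; lra.
  have jj : j = j'.
    apply: val_inj => /=; apply/eqP; rewrite eqn_leq; apply/negPn/negP; rewrite negb_and -!ltnNge => /orP[lt|lt].
      have f3 := mod3_gap jj3 lt.
      by have := far _ _ _ _ p1' p1 f3; rewrite leNgt => /negP; apply; apply: le_lt_trans D1; exact: ler_norm.
    have f3 := mod3_gap (esym jj3) lt.
    have := far _ _ _ _ p1 p1' f3; rewrite leNgt => /negP; apply; apply: le_lt_trans D1.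
    by rewrite distrC; exact: ler_norm.
  subst j'; congr existT; apply: val_inj => /=; apply/eqP; apply/negPn/negP => ll.
  move: D2; rewrite pE pE' /= opprD addrACA subrr add0r -mulrBr normrM (gtr0_norm h20) gtr_pMr// ltNge => /negP; apply.
  exact: natr_dist_ge1.
have card : (\sum_(j < m) n j <= k * 3)%N.
  have := leq_card F Finj; rewrite card_tagged card_prod !card_ord.
  rewrite sumnE big_map big_enum /=.
  by under eq_bigr do rewrite card_ord.
apply: (@le_trans _ _ (\sum_(j < m) 2 * h * (n j)%:R)).
  apply: ler_sum => j _; rewrite [leRHS]mulrC -ler_pdivrMr//.
  by have /andP[_ /ltW] := nI j.
rewrite -mulr_sumr -natr_sum.
have : (\sum_(j < m) n j)%:R <= (k * 3)%:R :> R by rewrite ler_nat.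
rewrite natrM; move: (_%:R : R) (k%:R : R) => S K SK.
by rewrite (_ : 6 * h * K = 2 * h * (K * 3)); [rewrite ler_pM2l|ring].
Qed.

End OscillationSum.

(** * Parseval's identity on a finite grid *)

Section DiscreteParseval.
Context {R : realType}.

Lemma expi_eq1 (a : R) : 0 < a -> a < 2 * pi -> expi a != 1.
Proof.
move=> a0 a2; apply/negP => /eqP ea.
have := sqr_nc_expiB1 a; rewrite ea subrr nc0 expr0n /= => h.
have s : 0 < sin (a / 2) by apply: sin_gt0_pi; apply/andP; split; lra.
have : 0 < sin (a / 2) ^+ 2 by rewrite exprn_gt0.
have : cos a = 1 - 2 * sin (a / 2) ^+ 2.
  have {1}-> : a = a / 2 + a / 2 by field.
  by rewrite cosD; have := cos2Dsin2 (a / 2); rewrite -!expr2; lra.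
lra.
Qed.

Lemma root_of_unity_sum (M : nat) (i k : nat) : (i < M)%N -> (k < M)%N ->
  \sum_(p < M) expi ((i%:R - k%:R) * (2 * pi * p%:R / M%:R) : R) = if i == k then M%:R else 0.
Proof.
move=> iM kM; have [->|ik] := eqVneq i k.
  rewrite (eq_bigr (fun=> 1)) => [|p _]; last by rewrite subrr mul0r expi0.
  by rewrite sumr_const card_ord.
have M0 : (0 < M)%N by case: M iM kM.
have M0' : 0 < M%:R :> R by rewrite ltr0n.
pose w : R[i] := expi ((i%:R - k%:R) * (2 * pi / M%:R)).
have E p : expi ((i%:R - k%:R) * (2 * pi * p%:R / M%:R) : R) = w ^+ p.
  elim: p => [|p ih]; first by rewrite mulr0 mul0r mulr0 expi0.
  by rewrite exprS -ih -expiD; congr expi; rewrite -[p.+1%:R]natr1; field; rewrite gt_eqF.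
under eq_bigr do rewrite E.
have w1 : w != 1.
  have p0 := pi_gt0 R.
  have pos (a b : nat) : (a < M)%N -> (b < a)%N -> expi ((a%:R - b%:R) * (2 * pi / M%:R) : R) != 1.
    move=> aM ba; have ab0 : 0 < a%:R - b%:R :> R by rewrite subr_gt0 ltr_nat.
    apply: expi_eq1; first by rewrite mulr_gt0// divr_gt0//; lra.
    rewrite mulrA ltr_pdivrMr// mulrC ltr_pM2l; last lra.
    have : a%:R < M%:R :> R by rewrite ltr_nat.
    have : 0 <= b%:R :> R by []; lra.
  have [lt|lt|e] := ltngtP k i; [exact: pos| |by rewrite e eqxx in ik].
  apply/negP => /eqP w1; have := pos _ _ kM lt.
  have -> : expi ((k%:R - i%:R) * (2 * pi / M%:R) : R) = w * expi ((k%:R - i%:R) * (2 * pi / M%:R)) by rewrite w1 mul1r.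
  by rewrite /w -expiD -mulrDl addrA subrK subrr mul0r expi0 eqxx.
have : (w - 1) * \sum_(p < M) w ^+ p = 0.
  rewrite -subrX1 -E mulfK ?gt_eqF//.
  have -> : i%:R - k%:R = (i%:Z - k%:Z)%:~R :> R by rewrite intrB.
  by rewrite mulrC expi2piz subrr.
by move/eqP; rewrite mulf_eq0 subr_eq0 (negbTE w1) /= => /eqP.
Qed.

Lemma sqr_ncE (z : R[i]) : (nc z ^+ 2)%:C = z * z^*%C.
Proof. by apply: complexE2; rewrite ?cReM ?cImM nc_sqr; case: z => a b /=; ring. Qed.

(** Orthogonality of the roots of unity: [m <= M] keeps the frequencies distinct modulo [M]. The
    shift [n0] cancels in their differences and allows frequencies from [- K] to [K]. *)
Lemma discrete_parseval (m M : nat) (c : 'I_m -> R[i]) (n0 : R) : (m <= M)%N ->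
  \sum_(p < M) nc (\sum_(i < m) c i * expi ((i%:R - n0) * (2 * pi * p%:R / M%:R))) ^+ 2 =
  M%:R * \sum_(i < m) nc (c i) ^+ 2.
Proof.
move=> mM.
have cs (F : 'I_m -> R[i]) : (\sum_(i < m) F i)^*%C = \sum_(i < m) (F i)^*%C by exact: rmorph_sum.
have cj (z : R[i]) a : (z * expi a)^*%C = z^*%C * expi (- a) by rewrite expi_conj; exact: rmorphM.
suff : (\sum_(p < M) nc (\sum_(i < m) c i * expi ((i%:R - n0) * (2 * pi * p%:R / M%:R))) ^+ 2)%:C =
  (M%:R * \sum_(i < m) nc (c i) ^+ 2)%:C by case.
rewrite rmorphM rmorph_nat !rmorph_sum /=.
under eq_bigr => p _.
  rewrite sqr_ncE cs mulr_suml.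
  under eq_bigr => i _.
    rewrite mulr_sumr.
    under eq_bigr => k _.
      rewrite cj mulrACA -expiD -mulrBl opprB addrA subrK.
      over.
    over.
  over.
rewrite exchange_big /= mulr_sumr; apply: eq_bigr => i _.
rewrite exchange_big /= (bigD1 i)//= [X in _ + X]big1 => [|k ki].
  rewrite -mulr_sumr root_of_unity_sum ?(leq_trans (ltn_ord i) mM)// eqxx addr0 sqr_ncE; ring.
rewrite -mulr_sumr root_of_unity_sum ?(leq_trans (ltn_ord _) mM)//.
by rewrite (negbTE (_ : i != k :> nat)) ?mulr0//; rewrite eq_sym.
Qed.

End DiscreteParseval.

(** * From small dimension to decay of the Fourier coefficients *)

Section FourierDecay.
Context {R : realType}.

Lemma powRN_sqr (x a : R) : x `^ (- (a * 2)) = (x `^ (- a)) ^+ 2.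
Proof. by rewrite -mulNr powRrM (powR_mulrn 2) ?powR_ge0. Qed.

(** The last step may leave [[0, 2 pi]], where the graph is not covered. By periodicity its
    increment is the opposite of the sum of the others, which doubles the constant 6. *)
Lemma periodic_increments_sum (f : R -> R) (z h : R) (J k : nat) : (0 < J)%N -> J%:R * h = 2 * pi ->
  continuous f -> periodic f (2 * pi) -> 0 <= z -> z <= h -> covers (graph_torus f) k h ->
  \sum_(j < J) `|f (z + j.+1%:R * h) - f (z + j%:R * h)| <= 12 * h * k%:R.
Proof.
case: J => // m _ Jh fc fp z0 zh hc.
have h0 : 0 < h.
  have : 0 < m.+1%:R * h by rewrite Jh mulr_gt0// pi_gt0.
  by rewrite pmulr_rgt0// ltr0n.
have zm : z + m%:R * h <= 2 * pi by rewrite -Jh -[m.+1%:R]natr1 mulrDl mul1r addrC lerD2l.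
rewrite big_ord_recr /= Jh fp.
have := oscillation_sum h0 fc z0 zm hc.
set S := \sum_(_ < m) _ => SS.
have : `|f z - f (z + m%:R * h)| <= S.
  have -> : f z - f (z + m%:R * h) = - \sum_(j < m) (f (z + j.+1%:R * h) - f (z + j%:R * h)).
    rewrite -(big_mkord predT (fun j => f (z + j.+1%:R * h) - f (z + j%:R * h))).
    by rewrite (telescope_sumr (fun j => f (z + j%:R * h)))//= mul0r addr0 opprB.
  by rewrite normrN; exact: ler_norm_sum.
by move=> S2; lra.
Qed.

Lemma sum_grid (F : nat -> R) (J L : nat) :
  \sum_(p < J * L) F p = \sum_(l < L) \sum_(j < J) F (j * L + l)%N.
Proof.
rewrite -(big_mkord predT F) big_nat_mul big_mkord exchange_big /=.
apply: eq_bigr => j _; rewrite mulSn addnC.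
rewrite (sum_nat_shift F) addKn; exact: eq_bigr.
Qed.

(** Parseval requires many sample points while the step [h = 2 pi / J] is fixed, so the fine grid is
    split into [L] translates of the grid of step [h]. On each, one factor of the square is bounded
    by Hoelder continuity and the other is summed over the cover: [h ^ a * h * h ^ - D]. *)
Lemma grid_increments_sqr (f : R -> R) (a C D : R) (J L k : nat) : (0 < J)%N -> (0 < L)%N ->
  continuous f -> periodic f (2 * pi) -> 0 < C ->
  (forall x h, `|h| <= 1 -> `|f (x + h) - f x| <= C * `|h| `^ a) -> 2 * pi / J%:R <= 1 :> R ->
  covers (graph_torus f) k (2 * pi / J%:R) -> k%:R <= (2 * pi / J%:R) `^ (- D) ->
  \sum_(p < J * L) `|f (2 * pi * p%:R / (J * L)%:R + 2 * pi / J%:R) - f (2 * pi * p%:R / (J * L)%:R)| ^+ 2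
    <= L%:R * (12 * C * (2 * pi / J%:R) `^ (a + 1 - D)).
Proof.
move=> J0 L0 fc fp C0 hf; have p0 := pi_gt0 R.
have J0' : 0 < J%:R :> R by rewrite ltr0n.
have L0' : 0 < L%:R :> R by rewrite ltr0n.
have Jh : J%:R * (2 * pi / J%:R) = 2 * pi :> R by field; rewrite gt_eqF.
have h0 : 0 < 2 * pi / J%:R :> R by rewrite divr_gt0// mulr_gt0.
rewrite natrM.
have grid (j l : nat) : 2 * pi * (j * L + l)%:R / (J%:R * L%:R) = 2 * pi / J%:R * (l%:R / L%:R) + j%:R * (2 * pi / J%:R) :> R.
  by rewrite natrD natrM; move: (pi : R) => p; field; rewrite !gt_eqF.
move: (2 * pi / _) Jh h0 grid => h Jh h0 grid h1 hc hk.
rewrite (sum_grid (fun p => `|f (2 * pi * p%:R / (J%:R * L%:R) + h) - f (2 * pi * p%:R / (J%:R * L%:R))| ^+ 2)).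
have -> : L%:R * (12 * C * h `^ (a + 1 - D)) = \sum_(l < L) (12 * C * h `^ (a + 1 - D)).
  by rewrite sumr_const card_ord mulr_natl.
apply: ler_sum => l _.
have lL : l%:R / L%:R <= 1 :> R by rewrite ler_pdivrMr// mul1r ler_nat ltnW.
have := @periodic_increments_sum f (h * (l%:R / L%:R)) h J k J0 Jh fc fp.
move=> /(_ ltac:(by rewrite mulr_ge0 ?divr_ge0// ltW) ltac:(by rewrite ger_pMr) hc) S.
have Ch : 0 <= C * h `^ a by rewrite mulr_ge0 ?powR_ge0 ?(ltW C0).
apply: (@le_trans _ _ (C * h `^ a * (12 * h * k%:R))).
  apply: (le_trans _ (ler_wpM2l Ch S)); rewrite mulr_sumr; apply: ler_sum => j _.
  rewrite grid -[j.+1%:R]natr1 mulrDl mul1r addrA expr2 ler_wpM2r//.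
  by have := hf (h * (l%:R / L%:R) + j%:R * h) h; rewrite gtr0_norm//; apply.
have W0 : 0 <= C * h `^ a * (12 * h) by apply: mulr_ge0 => //; rewrite mulr_ge0// ltW.
have := ler_wpM2l W0 hk.
rewrite -!mulrA => /le_trans; apply.
rewrite !powRDp// powRr1 ?(ltW h0)// le_eqVlt; apply/orP; left; apply/eqP; ring.
Qed.

Lemma cos_quarter_le0 (x : R) : pi / 2 <= x <= pi -> cos x <= 0.
Proof.
move=> /andP[x1 x2]; have := @sin_ge0_pi R (x - pi / 2); rewrite sinBpihalf oppr_ge0; apply.
by apply/andP; split; lra.
Qed.

Context (t : R) (g : R -> R[i]).
Context (gBV : BV_torus g) (t0 : (t != 0)%R) (KL : Khinchin_Levy (4 / 27 * (t / (2 * pi)) ^- 2)).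
Local Notation ev := (evolution omega32 t g).
Local Notation T := (evolution_partial_sum omega32 t g).

Lemma partial_sum_increments (K M : nat) (h : R) : (K.*2.+1 <= M)%N ->
  \sum_(p < M) nc (T K (2 * pi * p%:R / M%:R + h) - T K (2 * pi * p%:R / M%:R)) ^+ 2 =
  M%:R * \sum_(i < K.*2.+1) (let n := i%:Z - K%:Z in nc (fourier g n) ^+ 2 * (2 - 2 * cos (n%:~R * h))).
Proof.
move=> KM.
pose n (i : 'I_K.*2.+1) : int := i%:Z - K%:Z.
pose c i : R[i] := fourier g (n i) * expi (t * omega32 (n i)) * (expi ((n i)%:~R * h) - 1).
have cE i : nc (c i) ^+ 2 = nc (fourier g (n i)) ^+ 2 * (2 - 2 * cos ((n i)%:~R * h)).
  by rewrite /c !ncM nc_expi mulr1 exprMn sqr_nc_expiB1.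
rewrite /=; under [in RHS]eq_bigr => i _ do rewrite -(cE i).
rewrite -(discrete_parseval _ (K%:R) KM); apply: eq_bigr => p _; congr (nc _ ^+ 2).
rewrite /evolution_partial_sum -sumrB; apply: eq_bigr => i _.
rewrite /= -/(n i) /c; have -> : i%:R - K%:R = (n i)%:~R :> R by rewrite intrB.
by rewrite !mulrDr !expiD; ring.
Qed.

Lemma fourier_dyadic_decay (D : R) : 1 <= D -> D < 11 / 8 ->
  (fractal_dim (graph_torus (fun x => Re (ev x))) < D%:E)%E ->
  (fractal_dim (graph_torus (fun x => Im (ev x))) < D%:E)%E ->
  exists b C : R, exists N0 : nat, [/\ 1 < b, 0 < C & forall N, (N0 <= N)%N ->
    \sum_(N <= n < N.*2) (nc (fourier g n%:Z) ^+ 2 + nc (fourier g (- n%:Z)) ^+ 2) <= C * N%:R `^ (- b)].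
Proof.
(* [a] is the midpoint between [D - 1] and 3/8: smaller than 3/8, yet large enough for [b > 1]. *)
move=> D1 D118 /fractal_dim_lt[d1 d10 h1] /fractal_dim_lt[d2 d20 h2].
pose a : R := (D - 1 + 3 / 8) / 2; pose b : R := a + 2 - D.
have a0 : 0 < a by rewrite /a; lra.
have a38 : a < 3 / 8 by rewrite /a; lra.
have b1 : 1 < b by rewrite /b /a; lra.
have [C C0 [hH hT]] := evolution_regularity gBV t0 KL a0 a38.
have [ec1 ec2] := evolution_ccontinuous gBV t0 KL.
have ep := evolution_periodic gBV t0 KL.
have p0 := pi_gt0 R.
pose d := Num.min 1 (Num.min d1 d2).
have d0 : 0 < d by rewrite !lt_min ltr01 d10.
pose N0 := (Num.bound (pi / d)).+1.
exists b, (50 * C * (pi / 2) `^ b + (pi / 2) `^ b), N0; split => //.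
  by rewrite addr_gt0 ?mulr_gt0 ?powR_gt0//; lra.
move=> N NN0; have N1 : (0 < N)%N by exact: leq_trans NN0.
have N1' : 0 < N%:R :> R by rewrite ltr0n.
(* The step [h] is [pi / (2 N)], so that [n h] lies in [[pi / 2, pi]] for [N <= n < 2 N] and the
   multiplier [2 - 2 cos (n h)] is at least 2. *)
pose J := (4 * N)%N; have J0 : (0 < J)%N by rewrite muln_gt0.
pose h : R := 2 * pi / J%:R.
have hE : h = pi / 2 / N%:R by rewrite /h /J natrM; field; rewrite gt_eqF.
have h0 : 0 < h by rewrite hE !divr_gt0.
have hd : h < d.
  have : pi / d < N%:R.
    apply: (lt_le_trans (archi_boundP _)); first by rewrite divr_ge0// ltW.
    by rewrite ler_nat ltnW.
  rewrite ltr_pdivrMr// hE ltr_pdivrMr// [d * _]mulrC; lra.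
have [hl1 [hld1 hld2]] : h < 1 /\ h < d1 /\ h < d2 by move: hd; rewrite !lt_min => /andP[-> /andP[-> ->]].
have [k1 c1 k1D] := h1 h h0 hld1.
have [k2 c2 k2D] := h2 h h0 hld2.
have hb0 : 0 < h `^ b by rewrite powR_gt0.
have C20 : 0 < 8 * C ^+ 2 by rewrite mulr_gt0// exprn_gt0.
have a20 : 0 < a * 2 by rewrite mulr_gt0.
have [K0 hK0] := powRN_small a20 (divr_gt0 hb0 C20).
(* [K0] makes the squared truncation error smaller than [h ^ b], and [2 N] keeps the block of
   interest within the partial sum. *)
pose K := maxn K0 N.*2.
have := hK0 K (leq_maxl K0 N.*2); rewrite ler_pdivlMr// => hK.
pose L := K.*2.+1; pose M := (J * L)%N.
have KM : (K.*2.+1 <= M)%N by rewrite /M leq_pmull.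
have M0' : 0 < M%:R :> R by rewrite ltr0n; exact: leq_trans KM.
have L0' : 0 < L%:R :> R by rewrite ltr0n.
have := partial_sum_increments h KM.
pose x (p : nat) : R := 2 * pi * p%:R / M%:R.
set S := \sum_(i < K.*2.+1) _ => P.
have G (f : R -> R) k : continuous f -> periodic f (2 * pi) ->
    (forall x y, `|f x - f y| <= nc (ev x - ev y)) -> covers (graph_torus f) k h -> k%:R <= h `^ (- D) ->
    \sum_(p < M) `|f (x p + h) - f (x p)| ^+ 2 <= L%:R * (12 * C * h `^ (a + 1 - D)).
  move=> fc fp hf hc hk; apply: (@grid_increments_sqr f a C D J L k) => //; last exact: ltW.
  by move=> y e e1; apply: (le_trans (hf _ _)); exact: hH.
have G1 : \sum_(p < M) `|Re (ev (x p + h)) - Re (ev (x p))| ^+ 2 <= L%:R * (12 * C * h `^ (a + 1 - D)).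
  apply: (G (fun y => Re (ev y)) k1) => // [y|y z]; first by rewrite ep.
  by rewrite -ReB nc_Re.
have G2 : \sum_(p < M) `|Im (ev (x p + h)) - Im (ev (x p))| ^+ 2 <= L%:R * (12 * C * h `^ (a + 1 - D)).
  apply: (G (fun y => Im (ev y)) k2) => // [y|y z]; first by rewrite ep.
  by rewrite -ImB nc_Im.
have G3 : M%:R * S <= 4 * (L%:R * (12 * C * h `^ (a + 1 - D))) + M%:R * h `^ b.
  rewrite -P.
  have le1 (p : 'I_M) : nc (T K (x p + h) - T K (x p)) ^+ 2 <=
     2 * (`|Re (ev (x p + h)) - Re (ev (x p))| ^+ 2 + `|Im (ev (x p + h)) - Im (ev (x p))| ^+ 2) + h `^ b.
    have e y : nc (T K y - ev y) <= C * K.+1%:R `^ (- a) by rewrite evolution_partial_sumE; exact: hT.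
    have := sqr_nc_split (T K (x p + h) - T K (x p)) (ev (x p + h) - ev (x p)) 0.
    rewrite !subr0 (nc_sqr (ev _ - _)) ReB ImB !real_normK ?num_real//.
    have : nc (ev (x p + h) - ev (x p) - (T K (x p + h) - T K (x p))) <= 2 * (C * K.+1%:R `^ (- a)).
      have -> : ev (x p + h) - ev (x p) - (T K (x p + h) - T K (x p)) = (T K (x p) - ev (x p)) - (T K (x p + h) - ev (x p + h)) by ring.
      by apply: (le_trans (ncB _ _)); have := e (x p); have := e (x p + h); lra.
    move=> dn; have {dn} : nc (ev (x p + h) - ev (x p) - (T K (x p + h) - T K (x p))) ^+ 2 <= (2 * (C * K.+1%:R `^ (- a))) ^+ 2.
      by rewrite ler_pXn2r ?nnegrE ?nc_ge0// !mulr_ge0 ?powR_ge0 ?(ltW C0).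
    have -> : (2 * (C * K.+1%:R `^ (- a))) ^+ 2 = 4 * C ^+ 2 * K.+1%:R `^ (- (a * 2)).
      by rewrite powRN_sqr; ring.
    move: hK; rewrite mulrA [_ * 8]mulrC -[8 * _ * _]mulrA -[4 * _ * _]mulrA [_ * C ^+ 2]mulrC.
    move: (C ^+ 2 * _) (nc (ev _ - ev _ - _) ^+ 2) (nc (T K _ - _) ^+ 2) ((Re (ev _) - _) ^+ 2 + _) (h `^ b) => A1 A2 A3 A4 A5.
    lra.
  apply: (le_trans (ler_sum _ (fun p _ => le1 p))).
  rewrite big_split /= sumr_const card_ord [M%:R * _]mulr_natl lerD2r -mulr_sumr big_split /=.
  move: G1 G2; move: (\sum_(_ < _) _) (\sum_(_ < _) _) (L%:R * _) => A1 A2 A3; lra.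
have S0 : 2 * \sum_(N <= n < N.*2) (nc (fourier g n%:Z) ^+ 2 + nc (fourier g (- n%:Z)) ^+ 2) <= S.
  pose F (n : int) : R := nc (fourier g n) ^+ 2 * (2 - 2 * cos (n%:~R * h)).
  have F0 n : 0 <= F n by rewrite mulr_ge0 ?sqr_ge0//; have := cos_le1 (n%:~R * h); lra.
  have -> : S = F 0 + \sum_(1 <= n < K.+1) (F n%:Z + F (- n%:Z)).
    exact: (symmetric_sum F).
  have F2 (n : nat) : (N <= n < N.*2)%N -> 2 * (nc (fourier g n%:Z) ^+ 2 + nc (fourier g (- n%:Z)) ^+ 2) <= F n%:Z + F (- n%:Z).
    move=> /andP[n1 n2].
    have cn : cos (n%:R * h) <= 0.
      apply: cos_quarter_le0; rewrite hE mulrCA.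
      have r1 : 1 <= n%:R / N%:R :> R by rewrite ler_pdivlMr// mul1r ler_nat.
      have r2 : n%:R / N%:R <= 2 :> R by rewrite ler_pdivrMr// -natrM ler_nat mul2n ltnW.
      have p20 : 0 < pi / 2 :> R by rewrite divr_gt0.
      by rewrite ler_pMr// r1 /= -[leRHS](divfK (_ : 2 != 0))// ler_pM2l.
    rewrite /F intrN mulNr cosN -mulrDl mulrC ler_wpM2l ?addr_ge0 ?sqr_ge0//.
    by rewrite -pmulrn; lra.
  have N2K : (N.*2 <= K.+1)%N by rewrite leqW// leq_maxr.
  have NN2 : (N <= N.*2)%N by rewrite -addnn leq_addl.
  rewrite (@big_cat_nat _ _ _ N 1 K.+1)//=; last exact: leq_trans N2K.
  rewrite (@big_cat_nat _ _ _ N.*2 N K.+1)//=.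
  have pos c e : 0 <= \sum_(c <= n < e) (F n%:Z + F (- n%:Z)) by apply: sumr_ge0 => n _; exact: addr_ge0.
  have : 2 * \sum_(N <= n < N.*2) (nc (fourier g n%:Z) ^+ 2 + nc (fourier g (- n%:Z)) ^+ 2) <= \sum_(N <= n < N.*2) (F n%:Z + F (- n%:Z)).
    by rewrite mulr_sumr; apply: ler_sum_nat.
  have := F0 0; have := pos 1 N; have := pos N.*2 K.+1; lra.
have hb : h `^ b = (pi / 2) `^ b * N%:R `^ (- b).
  by rewrite hE powRM ?divr_ge0 ?invr_ge0 ?(ltW p0)// -(powR_inv1 (ler0n R N)) -powRrM mulN1r.
rewrite mulrDl -[50 * C * _ * _]mulrA -hb.
(* The missing power of [h] comes from the number of translates: [L / h = M / (2 pi)]. *)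
have h1' : h `^ (a + 1 - D) = h `^ b / h.
  by rewrite -(powR_inv1 (ltW h0)) -powRDp//; congr (_ `^ _); rewrite /b; ring.
have Lh : L%:R / h = M%:R / (2 * pi).
  by rewrite /h /M natrM invf_div mulrA [L%:R * _]mulrC.
have G4 : M%:R * S <= M%:R * (50 * C * h `^ b + h `^ b).
  apply: (le_trans G3); rewrite mulrDr lerD2r h1'.
  rewrite (_ : 4 * _ = (L%:R / h) * (48 * C * h `^ b)); last by ring.
  rewrite Lh -mulrA ler_wpM2l ?(ltW M0')// -!mulrA.
  have X0 : 0 < C * h `^ b by rewrite mulr_gt0.
  apply: (@le_trans _ _ (48 * (C * h `^ b))); last lra.
  have p2 := pi_ge2 R.
  by apply: ler_piMl; [rewrite mulr_ge0// ltW|rewrite invf_le1; lra].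
move: G4; rewrite ler_pM2l// => G4; apply: le_trans G4; apply: le_trans S0.
by rewrite ler_peMl// ?ler1n//; apply: sumr_ge0 => n _; rewrite addr_ge0 ?sqr_ge0.
Qed.
End FourierDecay.

(** * Sobolev regularity *)

Section SobolevDecay.
Context {R : realType}.
Local Notation mu := (@lebesgue_measure R).
Local Notation per := `[0, 2 * pi]%classic.

Lemma bounded_variation_measurable_bounded (f : R -> R) (T : R) : 0 <= T -> bounded_variation 0 T f ->
  measurable_fun `[0, T]%classic f /\ exists B : R, forall x, 0 <= x <= T -> `|f x| <= B.
Proof.
move=> T0 bv; have [p [q [pm qm fE]]] := bounded_variation_monotone_sub T0 bv; split.
  apply: (@eq_measurable_fun _ _ _ _ _ (fun x => p x - q x)).
    by move=> x; rewrite inE /= in_itv /= => xT; rewrite fE.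
  apply: measurable_funB; apply: measurable_funTS; exact: nondecreasing_measurable.
exists (Num.max `|p 0| `|p T| + Num.max `|q 0| `|q T|) => x xT; rewrite fE//.
have H (r : R -> R) : {homo r : x y / x <= y} -> `|r x| <= Num.max `|r 0| `|r T|.
  move=> rm; case/andP: xT => /rm h1 /rm h2; rewrite le_max.
  have [r0|r0] := leP 0 (r x).
    by apply/orP; right; rewrite (ger0_norm r0); exact: le_trans (ler_norm _).
  apply/orP; left; rewrite (ltr0_norm r0) (ltr0_norm (le_lt_trans h1 r0)); lra.
by apply: (le_trans (ler_normB _ _)); exact: lerD (H _ pm) (H _ qm).
Qed.

Lemma BV_L2_torus (g : R -> R[i]) : BV_torus g -> L2_torus g.
Proof.
move=> [gp bv1 bv2]; have T0 := @twopi_ge0 R.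
have [m1 [B1 b1]] := bounded_variation_measurable_bounded T0 bv1.
have [m2 [B2 b2]] := bounded_variation_measurable_bounded T0 bv2.
split => //.
apply: (@le_lt_trans _ _ (\int[mu]_(x in per) ((B1 + B2) ^+ 2)%:E)%E).
  apply: ge0_le_integral => //.
  - by move=> x _; rewrite lee_fin sqr_ge0.
  - apply: (@eq_measurable_fun _ _ _ _ _ (fun x => (Re (g x) ^+ 2 + Im (g x) ^+ 2)%:E)) => [x _|].
      by rewrite nc_sqr.
    by apply/measurable_realfun.measurable_EFinP; apply: measurable_funD; apply: measurable_funX.
  - move=> x; rewrite /= in_itv /= => xT; rewrite lee_fin lerXn2r ?nnegrE ?nc_ge0//.
      by rewrite (le_trans _ (lerD (b1 x xT) (b2 x xT)))// addr_ge0.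
    by apply: (le_trans (nc_ReIm _)); exact: lerD (b1 x xT) (b2 x xT).
rewrite integral_cst//= lebesgue_measure_itv /= lte_fin.
by case: ifP => _; rewrite ?mule0 ?sube0 -?EFinM ltry.
Qed.

Lemma ler_sum_uniq_subset (I : eqType) (X Y : seq I) (F : I -> R) : uniq X -> uniq Y ->
  {subset X <= Y} -> (forall i, 0 <= F i) -> \sum_(i <- X) F i <= \sum_(i <- Y) F i.
Proof.
move=> uX uY XY F0; rewrite (perm_big [seq y <- Y | y \in X]).
  by rewrite big_filter [leRHS](bigID (fun y => y \in X)) /= lerDl sumr_ge0.
apply: uniq_perm => //; first exact: filter_uniq.
by move=> x; rewrite mem_filter andb_idr// => /XY.
Qed.

Lemma sum_uniq_int_le (F : int -> R) (B : R) (xs : seq int) : (forall n, 0 <= F n) -> uniq xs ->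
  (forall M : nat, \sum_(1 <= n < M) (F n%:Z + F (- n%:Z)) <= B) -> \sum_(i <- xs) F i <= F 0 + B.
Proof.
move=> F0 uxs hB; pose K := \max_(x <- xs) `|x|%N.
apply: (@le_trans _ _ (\sum_(i <- [seq (k : nat)%:Z - K%:Z | k <- iota 0 K.*2.+1]) F i)).
  apply: ler_sum_uniq_subset => //.
    by rewrite map_inj_uniq ?iota_uniq// => a b; lia.
  move=> x xX; have xK : (`|x| <= K)%N by apply: leq_bigmax_seq.
  apply/mapP; exists `|(x + K%:Z)%R|%N; first by rewrite mem_iota; lia.
  lia.
rewrite big_map -[iota 0 _]/(index_iota 0 K.*2.+1) big_mkord.
by rewrite (symmetric_sum F) lerD2l.
Qed.

Lemma esum_int_lt_pinfty (F : int -> R) (B : R) : (forall n, 0 <= F n) ->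
  (forall M : nat, \sum_(1 <= n < M) (F n%:Z + F (- n%:Z)) <= B) ->
  (\esum_(n in [set: int]) (F n)%:E < +oo)%E.
Proof.
move=> F0 hB; apply: (@le_lt_trans _ _ (F 0 + B)%:E); last exact: ltry.
apply: ge_ereal_sup => _ [A [/finite_fsetP[X ->] _] <-].
rewrite fsbig_finite//= sumEFin lee_fin set_fsetK.
exact: (sum_uniq_int_le F0 (finmap.fset_uniq X) hB).
Qed.

Lemma dyadic_decay_Sobolev (g : R -> R[i]) (b C : R) (N0 : nat) : BV_torus g -> 1 < b -> 0 < C ->
  (forall N, (N0 <= N)%N ->
    \sum_(N <= n < N.*2) (nc (fourier g n%:Z) ^+ 2 + nc (fourier g (- n%:Z)) ^+ 2) <= C * N%:R `^ (- b)) ->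
  Sobolev_half_plus g.
Proof.
(* [s] lies halfway between 1/2 and [b / 2]; the remaining decay exponent is [c = b - 2 s > 0]. *)
move=> gBV b1 C0 hd; pose s : R := (b + 1) / 4; pose c : R := (b - 1) / 2.
have c0 : 0 < c by rewrite /c; lra.
have s0 : 0 < s by rewrite /s; lra.
exists s; first by rewrite /s; lra.
split; first exact: BV_L2_torus.
pose F (n : int) : R := (1 + n%:~R ^+ 2) `^ s * nc (fourier g n) ^+ 2.
have F0 n : 0 <= F n by rewrite mulr_ge0 ?powR_ge0 ?sqr_ge0.
pose G (n : nat) := F n%:Z + F (- n%:Z).
have G0 n : 0 <= G n by rewrite addr_ge0.
have mono a k e : (k <= e)%N -> (a <= k)%N -> \sum_(a <= n < k) G n <= \sum_(a <= n < e) G n.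
  by move=> ke ak; rewrite [leRHS](@big_cat_nat _ _ _ k)//= lerDl sumr_ge0.
have big N : (0 < N)%N -> (N0 <= N)%N -> \sum_(N <= n < N.*2) G n <= 4 `^ s * C * N%:R `^ (- c).
  move=> N1 NN; have N1' : 0 < N%:R :> R by rewrite ltr0n.
  apply: (@le_trans _ _ (\sum_(N <= n < N.*2) 4 `^ s * N%:R `^ (2 * s) * (nc (fourier g n%:Z) ^+ 2 + nc (fourier g (- n%:Z)) ^+ 2))).
    apply: ler_sum_nat => n /andP[n1 n2].
    have w : (1 + n%:R ^+ 2) `^ s <= 4 `^ s * N%:R `^ (2 * s) :> R.
      rewrite powRrM [_ `^ 2](powR_mulrn 2) ?ler0n// -powRM ?exprn_ge0//.
      apply: powR_le; [exact: ltW|by rewrite addr_ge0 ?sqr_ge0|].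
      have n0 : 0 <= n%:R :> R by [].
      have nN : n%:R + 1 <= 2 * N%:R :> R by rewrite natr1 -natrM ler_nat mul2n.
      have : (n%:R + 1) ^+ 2 <= (2 * N%:R) ^+ 2 :> R by rewrite ler_pXn2r// nnegrE; lra.
      by move: (n%:R : R) (N%:R : R) n0 => x y x0; rewrite !expr2; lra.
    rewrite /G /F intrN sqrrN -pmulrn -mulrDr ler_wpM2r ?addr_ge0 ?sqr_ge0//.
  rewrite -mulr_sumr; apply: (le_trans (ler_wpM2l _ (hd N NN))); first by rewrite mulr_ge0 ?powR_ge0.
  rewrite (_ : - c = 2 * s + - b); last by rewrite /c /s; field.
  by rewrite powRDp// le_eqVlt; apply/orP; left; apply/eqP; ring.
pose B0 := \sum_(1 <= n < N0.+1.*2) G n.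
have B00 : 0 <= B0 by exact: sumr_ge0.
(* The second summand covers the blocks starting below [N0], where no decay is assumed. *)
pose D := 4 `^ s * C + B0 * N0.+1%:R `^ c.
have D0 : 0 <= D by rewrite addr_ge0 ?mulr_ge0 ?powR_ge0 ?(ltW C0).
have all N : (0 < N)%N -> \sum_(N <= n < N.*2) G n <= D * N%:R `^ (- c).
  move=> N1; have N1' : 0 < N%:R :> R by rewrite ltr0n.
  have [NN|NN] := leqP N0 N.
    by apply: (le_trans (big N N1 NN)); rewrite ler_wpM2r ?powR_ge0// lerDl mulr_ge0 ?powR_ge0.
  apply: (@le_trans _ _ B0).
    rewrite /B0 (@big_cat_nat _ _ _ N 1)//=; last by rewrite -addnn; lia.
    apply: (@le_trans _ _ (\sum_(N <= n < N0.+1.*2) G n)); last by rewrite lerDr sumr_ge0.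
    by apply: mono; [rewrite leq_double ltnW// ltnS ltnW|rewrite -addnn leq_addr].
  rewrite /D mulrDl -[leLHS]add0r lerD ?mulr_ge0 ?powR_ge0 ?(ltW C0)//.
  rewrite -mulrA ler_peMr// powRN -[_ / _]/(_ * _) ler_pdivlMr ?powR_gt0// mul1r.
  by apply: powR_le; [exact: ltW|exact: ltW|rewrite ler_nat ltnW// ltnS ltnW].
(* The partial sums are embedded into the complex numbers to reuse [dyadic_tail] as a convergence
   criterion. *)
have block M L : (0 < M)%N -> (L <= M)%N ->
    nc ((\sum_(1 <= n < M + L) G n)%:C - (\sum_(1 <= n < M) G n)%:C) <= D * M%:R `^ (- c).
  move=> M0 LM; rewrite -realCB nc_real (@big_cat_nat _ _ _ M 1 (M + L))//= ?leq_addr// addrAC subrr add0r ger0_norm ?sumr_ge0//.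
  by apply: le_trans (all M M0); rewrite -addnn; apply: mono; rewrite ?leq_add2l ?leq_addr.
have H := dyadic_tail c0 D0 block.
apply: (@esum_int_lt_pinfty F (D / (1 - 2 `^ (- c)))) => // M.
have [M1|M1] := leqP M 1.
  rewrite big_geq//; have := H 1%N 1%N isT isT; rewrite subrr nc0 powR1 mulr1; exact.
have := H 1%N M isT (ltnW M1); rewrite -realCB nc_real [X in _ - X]big_geq// subr0 powR1 mulr1.
by apply: le_trans; rewrite ler_norm.
Qed.

End SobolevDecay.

(** * The two bounds for the dimension *)

Section DimensionBounds.
Context {R : realType}.
Context (t : R) (g : R -> R[i]).
Context (gBV : BV_torus g) (t0 : (t != 0)%R) (KL : Khinchin_Levy (4 / 27 * (t / (2 * pi)) ^- 2)).
Local Notation ev := (evolution omega32 t g).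

Lemma fractal_dim_evolution_le (f : R -> R) : (forall x y, `|f x - f y| <= nc (ev x - ev y)) ->
  (fractal_dim (graph_torus f) <= (13 / 8)%:E)%E.
Proof.
move=> hf; apply/lee_addgt0Pr => e e0.
pose e' := Num.min e (1 / 8); have e'0 : 0 < e' by rewrite lt_min e0 /=; lra.
have e'e : e' <= e by rewrite ge_min lexx.
have e'8 : e' <= 1 / 8 by rewrite ge_min lexx orbT.
pose a := 3 / 8 - e'; have a0 : 0 < a by rewrite /a; lra.
have a38 : a < 3 / 8 by rewrite /a; lra.
have [C C0 [hC _]] := evolution_regularity gBV t0 KL a0 a38.
have p0 := pi_gt0 R.
have K0 : 0 < (4 * pi + 1) * (4 * C + 1) by rewrite mulr_gt0//; lra.
apply: (@le_trans _ _ (2 - a)%:E); last by rewrite -EFinD lee_fin /a; lra.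
apply: (fractal_dim_le K0) => h h0 h1; apply: (holder_covers a0 _ C0 _ h0 h1); first lra.
by move=> x y y1; apply: (le_trans (hf _ _)); exact: hC.
Qed.

Lemma D_t_le : (D_t t omega32 g <= (13 / 8)%:E)%E.
Proof.
rewrite /D_t ge_max; apply/andP; split; apply: fractal_dim_evolution_le => x y.
  by rewrite -ReB nc_Re.
by rewrite -ImB nc_Im.
Qed.

Lemma D_t_ge : ~ Sobolev_half_plus g -> ((11 / 8)%:E <= D_t t omega32 g)%E.
Proof.
move=> gH; rewrite leNgt; apply/negP => lt; apply: gH.
(* The maximum with 1 excludes an infinite value and yields [1 <= D], from which the Hoelder
   exponent in the decay estimate is positive. *)
have [r r1 r2] : exists2 r : R, (maxe (D_t t omega32 g) 1%:E = r%:E)%E & 1 <= r < 11 / 8.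
  have : (maxe (D_t t omega32 g) 1%:E < (11 / 8)%:E)%E by rewrite gt_max lt /= lte_fin; lra.
  have : (1%:E <= maxe (D_t t omega32 g) 1%:E)%E by rewrite le_max lexx orbT.
  case: (maxe _ _) => [r| |]//; rewrite lee_fin lte_fin => h1 h2; exists r => //; apply/andP; split => //.
pose D := (r + 11 / 8) / 2.
have [rD D1 D11] : [/\ r < D, 1 <= D & D < 11 / 8] by case/andP: r2 => ? ?; split; rewrite /D; lra.
have : (D_t t omega32 g < D%:E)%E.
  by apply: (@le_lt_trans _ _ r%:E); [rewrite -r1 le_max lexx|rewrite lte_fin].
rewrite /D_t gt_max => /andP[d1 d2].
have [b [C [N0 [b1 C0 hd]]]] := fourier_dyadic_decay gBV t0 KL D1 D11 d1 d2.
exact: dyadic_decay_Sobolev hd.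
Qed.

End DimensionBounds.

(** * Almost every time *)

Section DiophantineApproximation.
Context {R : realType}.
Implicit Types (be : R).

(** Pigeonhole on the fractional parts of the multiples from 0 to [Q]. The fraction found is then
    reduced to lowest terms, which can only shrink [|q be - a|]. *)
Lemma dirichlet_approx be (Q : nat) : (0 < Q)%N ->
  exists (q : nat) (a : int), [/\ (0 < q)%N, (q <= Q)%N, coprimez a q%:Z & `|q%:R * be - a%:~R| < Q%:R^-1].
Proof.
case: Q => // Q _; pose y (k : nat) : R := k%:R * be - (Num.floor (k%:R * be))%:~R.
have y0 k : 0 <= y k by have /andP[h _] := floor_itv (k%:R * be); rewrite subr_ge0.
have y1 k : y k < 1 by have /andP[_ h] := floor_itv (k%:R * be); rewrite ltrBlDr addrC -(@intrD1 R).
have Q0 : 0 < Q.+1%:R :> R by rewrite ltr0n.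
have Qy k : 0 <= Q.+1%:R * y k by rewrite mulr_ge0 ?ler0n.
pose f (k : 'I_Q.+2) : 'I_Q.+1 := inord (Num.trunc (Q.+1%:R * y k)).
have /injectivePn[k [l kl fkl]] : ~~ injectiveb f.
  by apply/negP => /injectiveP/leq_card; rewrite !card_ord ltnn.
have tQ (m : nat) : (Num.trunc (Q.+1%:R * y m) < Q.+1)%N.
  have /andP[h _] := truncn_itv (Qy m); rewrite -(ltr_nat R); apply: (le_lt_trans h).
  by rewrite gtr_pMr.
have close : `|y k - y l| < Q.+1%:R^-1.
  have E : Num.trunc (Q.+1%:R * y k) = Num.trunc (Q.+1%:R * y l).
    by have := congr1 val fkl; rewrite /= !inordK.
  have := truncn_itv (Qy k); have := truncn_itv (Qy l); rewrite E.
  move: (Num.trunc (Q.+1%:R * y l)) (y k) (y l) => T yk yl; move: (Q.+1%:R : R) Q0 => r r0.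
  rewrite -natr1 => /andP[a1 a2] /andP[a3 a4].
  rewrite -[ltRHS]mul1r ltr_pdivlMr// -[r in ltLHS](gtr0_norm r0) -normrM mulrC mulrBr ltr_norml.
  by apply/andP; split; lra.
have red (q : nat) (a : int) : (0 < q)%N -> (q <= Q.+1)%N -> `|q%:R * be - a%:~R| < Q.+1%:R^-1 ->
  exists (q : nat) (a : int), [/\ (0 < q)%N, (q <= Q.+1)%N, coprimez a q%:Z & `|q%:R * be - a%:~R| < Q.+1%:R^-1].
  move=> q0 qQ hq; pose d := gcdn `|a|%N q.
  have d0 : (0 < d)%N by rewrite gcdn_gt0 q0 orbT.
  have /dvdnP[q1 q1E] : (d %| q)%N by exact: dvdn_gcdr.
  have /dvdzP[a1 a1E] : (d%:Z %| a)%Z by rewrite dvdzE /=; exact: dvdn_gcdl.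
  have q10 : (0 < q1)%N by move: q0; rewrite q1E muln_gt0 => /andP[].
  exists q1, a1; split => //.
  - by apply: leq_trans qQ; rewrite q1E leq_pmulr.
  - rewrite /coprimez /gcdz /=; apply/eqP; congr Posz.
    apply/eqP; rewrite -(eqn_pmul2r d0) mul1n muln_gcdl -q1E.
    by rewrite -[X in gcdn (_ * X) _]/(`|d%:Z|%N) -abszM -a1E.
  - apply: le_lt_trans hq; rewrite q1E a1E natrM intrM -pmulrn mulrAC -mulrBl normrM ler_peMr//.
    by rewrite normr_nat ler1n.
have main (i j : nat) : (i < j)%N -> (j <= Q.+1)%N -> `|y i - y j| < Q.+1%:R^-1 ->
  exists (q : nat) (a : int), [/\ (0 < q)%N, (q <= Q.+1)%N, coprimez a q%:Z & `|q%:R * be - a%:~R| < Q.+1%:R^-1].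
  move=> lt lQ c; apply: (red (j - i)%N (Num.floor (j%:R * be) - Num.floor (i%:R * be))).
  - by rewrite subn_gt0.
  - by rewrite (leq_trans (leq_subr _ _)).
  - rewrite natrB ?(ltnW lt)// intrB; move: c; rewrite /y distrC; congr (`|_| < _); ring.
have [lt|lt|e] := ltngtP k l.
- by apply: (main k l) => //; rewrite -ltnS.
- by apply: (main l k) => //; [rewrite -ltnS|rewrite distrC].
- by move/eqP: kl; case; apply: val_inj.
Qed.

Lemma irrational_dist_gt0 be (q0 : nat) : irrational be ->
  exists2 d : R, 0 < d & forall (q : nat) (a : int), (0 < q)%N -> (q < q0)%N -> d <= `|q%:R * be - a%:~R|.
Proof.
move=> irr; elim: q0 => [|q0 [d d0 ih]]; first by exists 1.
have [->|q00] := posnP q0; first by exists 1 => // q a; lia.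
pose y : R := q0%:R * be - (Num.floor (q0%:R * be))%:~R.
have y0 : 0 < y.
  have /andP[h _] := floor_itv (q0%:R * be); rewrite lt_neqAle subr_ge0 h andbT eq_sym subr_eq0.
  apply/negP => /eqP e; apply: irr; exists ((Num.floor (q0%:R * be))%:~R / q0%:R) => //.
  by rewrite fmorph_div /= ratr_int ratr_nat -e mulrAC mulfV ?mul1r// pnatr_eq0 -lt0n.
have y1 : y < 1 by have /andP[_ h] := floor_itv (q0%:R * be); rewrite ltrBlDr addrC -(@intrD1 R).
exists (Num.min d (Num.min y (1 - y))) => [|q a qp]; first by rewrite !lt_min d0 y0; lra.
rewrite ltnS leq_eqVlt => /orP[/eqP ->|/(ih _ a qp)]; last by apply: le_trans; rewrite ge_min lexx.
have -> : q0%:R * be - a%:~R = y + (Num.floor (q0%:R * be) - a)%:~R by rewrite intrB /y; ring.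
have [n0|n0] := leP 0 (Num.floor (q0%:R * be) - a).
  have : 0 <= (Num.floor (q0%:R * be) - a)%:~R :> R by rewrite ler0z.
  move=> n0'; rewrite ger0_norm; last lra.
  by apply: (@le_trans _ _ y); [rewrite !ge_min lexx orbT|lra].
have : (Num.floor (q0%:R * be) - a)%:~R <= -1 :> R.
  by rewrite -[leRHS](intrN R 1) ler_int; lia.
move=> n0'; rewrite ler0_norm; last lra.
by apply: (@le_trans _ _ (1 - y)); [rewrite !ge_min lexx !orbT|lra].
Qed.

Definition dirichlet_denominator be (q : nat) : Prop :=
  (0 < q)%N /\ exists a : int, coprimez a q%:Z /\ `|be - a%:~R / q%:R| <= 1 / q%:R ^+ 2.

(** Dirichlet's theorem with [Q] the integer part of [n ^ (1 + e)]. A denominator [q <= n] would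
    have [|q be - a| < 1 / Q <= n ^ - (1 + e / 2) <= q ^ - (1 + e / 2)], contradicting the lower
    bound. *)
Lemma next_dirichlet_denominator be (e : R) : irrational be -> 0 < e ->
  (exists q0 : nat, forall (q : nat) (a : int), (0 < q)%N -> (q0 <= q)%N ->
     q%:R `^ (- (2 + e / 2)) <= `|be - a%:~R / q%:R|) ->
  exists N : nat, forall n : nat, (N <= n)%N ->
    exists q : nat, [/\ dirichlet_denominator be q, (n < q)%N & q%:R <= n%:R `^ (1 + e)].
Proof.
move=> irr e0 [q0 hq0]; have [d d0 hd] := irrational_dist_gt0 q0 irr.
have e20 : 0 < e / 2 by lra.
(* The first threshold gives [1 / Q < d]; the second gives [n ^ (e / 2) >= 2], which absorbs the
   rounding in [Q]. *)
exists (maxn (Num.bound (d^-1 + 1)).+1 (Num.bound (2 `^ (e / 2)^-1)).+1) => n; rewrite geq_max => /andP[n1 n2].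
have n0 : (0 < n)%N by exact: leq_trans n1.
have n0' : 0 < n%:R :> R by rewrite ltr0n.
have n1' : 1 <= n%:R :> R by rewrite ler1n.
have nd : d^-1 + 1 <= n%:R.
  apply: (@le_trans _ _ (Num.bound (d^-1 + 1))%:R); first by rewrite ltW// archi_boundP// addr_ge0// invr_ge0 ltW.
  by rewrite ler_nat ltnW.
have n2' : 2 <= n%:R `^ (e / 2).
  have : 2 `^ (e / 2)^-1 <= n%:R :> R.
    apply: (@le_trans _ _ (Num.bound (2 `^ (e / 2)^-1))%:R); first by rewrite ltW// archi_boundP// powR_ge0.
    by rewrite ler_nat ltnW.
  move=> /(powR_le (ltW e20) (powR_ge0 _ _)); rewrite -powRrM mulVf ?gt_eqF// powRr1//.
pose Q := Num.trunc (n%:R `^ (1 + e)).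
have /andP[Q1 Q2] := truncn_itv (powR_ge0 n%:R (1 + e)); rewrite -/Q in Q1 Q2.
have nne : n%:R <= n%:R `^ (1 + e) by rewrite powRDp// powRr1// ler_peMr ?(ltW n0')// powR_ge1 ?(ltW e0).
have Qd : d^-1 < Q%:R by move: Q2; rewrite -natr1; lra.
have Q0 : (0 < Q)%N by rewrite -(ltr_nat R); apply: lt_trans Qd; rewrite invr_gt0.
have Q0' : 0 < Q%:R :> R by rewrite ltr0n.
have nQ : n%:R `^ (1 + e / 2) <= Q%:R.
  have : n%:R `^ (1 + e) = n%:R `^ (1 + e / 2) * n%:R `^ (e / 2).
    by rewrite -powRDp//; congr (_ `^ _); lra.
  have : 1 <= n%:R `^ (1 + e / 2) by rewrite powR_ge1//; lra.
  move: Q2 n2'; rewrite -natr1; move: (_ `^ _) (_ `^ _) (_ `^ _) => A B X; nra.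
have [q [a [qp qQ cop qa]]] := dirichlet_approx be Q0.
have qp' : 0 < q%:R :> R by rewrite ltr0n.
have qbe : `|be - a%:~R / q%:R| = `|q%:R * be - a%:~R| / q%:R.
  have -> : be - a%:~R / q%:R = (q%:R * be - a%:~R) / q%:R by field; rewrite gt_eqF.
  by rewrite normrM normfV (gtr0_norm qp').
exists q; split; last by apply: le_trans Q1; rewrite ler_nat.
  split=> //; exists a; split=> //; rewrite qbe ler_pdivrMr// div1r.
  have -> : (q%:R ^+ 2)^-1 * q%:R = q%:R^-1 :> R by field; rewrite gt_eqF.
  by rewrite ltW// (lt_le_trans qa)// lef_pV2 ?posrE// ler_nat.
rewrite ltnNge; apply/negP => qn.
have [lt|le] := ltnP q q0.
  have := le_lt_trans (hd q a qp lt) qa; rewrite -[ltLHS]invrK ltf_pV2 ?posrE ?invr_gt0//.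
  by rewrite ltNge (ltW Qd).
have := hq0 q a qp le; rewrite qbe ler_pdivlMr// => h.
have := le_lt_trans h qa; rewrite -[X in _ * X](powRr1 (ltW qp')) -powRDp// (_ : _ + 1 = - (1 + e / 2)); last by ring.
rewrite powRN ltf_pV2 ?posrE ?powR_gt0// ltNge => /negP; apply; apply: le_trans nQ.
by apply: powR_le; rewrite ?ler_nat//; lra.
Qed.

(** The sequence consists of all Dirichlet denominators in increasing order: [f n] is the least one
    above [n]. Minimality lets the bound for some next denominator, at every [e], pass to a sequence
    chosen independently of [e]. *)
Lemma Khinchin_Levy_diophantine be : irrational be ->
  (forall e : R, 0 < e -> exists q0 : nat, forall (q : nat) (a : int), (0 < q)%N -> (q0 <= q)%N ->
     q%:R `^ (- (2 + e)) <= `|be - a%:~R / q%:R|) -> Khinchin_Levy be.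
Proof.
move=> irr dio; split => //.
have key (e : R) (e0 : 0 < e) := next_dirichlet_denominator irr e0 (dio (e / 2) ltac:(lra)).
have nx (n : nat) : exists q : nat, [/\ dirichlet_denominator be q, (n < q)%N &
    forall q', dirichlet_denominator be q' -> (n < q')%N -> (q <= q')%N].
  pose P q := `[< dirichlet_denominator be q /\ (n < q)%N >].
  have exP : exists q, P q.
    have [N hN] := key 1 ltr01; have [q [dq nq _]] := hN (maxn N n) (leq_maxl _ _).
    by exists q; apply/asboolP; split => //; apply: leq_ltn_trans nq; exact: leq_maxr.
  case: (ex_minnP exP) => q /asboolP[dq nq] qmin; exists q; split => // q' dq' nq'.
  by apply: qmin; apply/asboolP.
have [f hf] := choice nx; exists (fun k => iter k.+1 f 0%N).
have inc k : (iter k.+1 f 0%N < iter k.+2 f 0%N)%N by have [] := hf (iter k.+1 f 0%N).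
split.
- by move=> k; have [[]] := hf (iter k f 0%N).
- exact: inc.
- move=> e e0; have [N hN] := key e e0; exists N => n Nn.
  have nle : (n <= iter n.+1 f 0%N)%N.
    by elim: n {Nn} => // n ih; exact: leq_ltn_trans ih (inc n).
  have [q [dq nq qe]] := hN _ (leq_trans (ltnW Nn) nle).
  apply: le_trans qe; rewrite ler_nat; have [_ _] := hf (iter n.+1 f 0%N); exact.
- by move=> k; have [[]] := hf (iter k f 0%N).
Qed.

End DiophantineApproximation.

Section AlmostEveryTime.
Context {R : realType}.
Local Notation mu := (@lebesgue_measure R).
Local Notation beta t := (4 / 27 * (t / (2 * pi)) ^- 2).

(** Cauchy condensation: a dyadic block of the series is at most [M ^ - e], so [dyadic_tail]
    applies. *)
Lemma sum_powRN_bound (e : R) : 0 < e -> exists D : R, forall M : nat, \sum_(1 <= q < M) q%:R `^ (- (1 + e)) <= D.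
Proof.
move=> e0; pose v (M : nat) : R[i] := (\sum_(1 <= q < M) q%:R `^ (- (1 + e)))%:C.
have block M L : (0 < M)%N -> (L <= M)%N -> nc (v (M + L)%N - v M) <= 1 * M%:R `^ (- e).
  move=> M0 LM; have M0' : 0 < M%:R :> R by rewrite ltr0n.
  rewrite /v -realCB nc_real (@big_cat_nat _ _ _ M 1 (M + L))//= ?leq_addr// addrAC subrr add0r.
  rewrite ger0_norm; last by apply: sumr_ge0 => i _; exact: powR_ge0.
  apply: (@le_trans _ _ (\sum_(M <= q < M + L) M%:R `^ (- (1 + e)))).
    by apply: ler_sum_nat => q /andP[Mq _]; apply: powRN_decr; rewrite ?ler_nat//; lra.
  rewrite big_const_nat iter_addr_0 addKn -[leLHS]mulr_natr mul1r.
  apply: (@le_trans _ _ (M%:R `^ (- (1 + e)) * M%:R)); first by rewrite ler_wpM2l ?powR_ge0// ler_nat.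
  rewrite -[X in _ * X](powRr1 (ltW M0')) -powRDp//.
  by rewrite (_ : - (1 + e) + 1 = - e)//; ring.
exists (1 / (1 - 2 `^ (- e))) => M.
have [M1|M1] := leqP M 1.
  by rewrite big_geq//; have := dyadic_tail e0 ler01 block (isT : (0 < 1)%N) (leqnn 1); rewrite subrr nc0 powR1 mulr1.
have := dyadic_tail e0 ler01 block (isT : (0 < 1)%N) (ltnW M1).
rewrite powR1 mulr1 {2}/v big_geq// subr0 nc_real; apply: le_trans; exact: ler_norm.
Qed.


Lemma betaE (s : bool) (w : R) : 0 < sgn_real s * w -> beta w = 16 * pi ^+ 2 / 27 * (sgn_real s * w) ^- 2.
Proof.
move=> w1; have p0 := pi_gt0 R; have w0 : w != 0.
  by apply/eqP => w0; move: w1; rewrite w0 mulr0 ltxx.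
have -> : (sgn_real s * w) ^+ 2 = w ^+ 2 by case: (s); rewrite /=; ring.
by move: (pi : R) p0 => p p0; field; rewrite w0 gt_eqF.
Qed.

(** For [1 / M <= |t| <= M] on one side of 0, [beta] has slope bounded below: its difference
    quotient is a constant times [(X + Y) / (X Y) ^ 2], with [X + Y >= 2 / M] and [X Y <= M ^ 2].
    Preimages of short intervals are therefore short. *)
Lemma beta_close_dist (M x y r z : R) (s : bool) : 0 < M ->
  M^-1 <= sgn_real s * x <= M -> M^-1 <= sgn_real s * y <= M ->
  `|beta x - z| < r -> `|beta y - z| < r -> `|x - y| <= r * (M ^+ 5 * (27 / (16 * pi ^+ 2))).
Proof.
move=> M0 xM yM hx hy; have p0 := pi_gt0 R.
have bE (w : R) : M^-1 <= sgn_real s * w <= M -> beta w = 16 * pi ^+ 2 / 27 * (sgn_real s * w) ^- 2.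
  by move=> /andP[w1 _]; apply: betaE; apply: lt_le_trans w1; rewrite invr_gt0.
rewrite (bE x xM) in hx; rewrite (bE y yM) in hy.
have -> : `|x - y| = `|sgn_real s * x - sgn_real s * y| by rewrite -mulrBr normrM sgn_real_norm mul1r.
move: (sgn_real s * x) (sgn_real s * y) xM yM hx hy => X Y /andP[X1 X2] /andP[Y1 Y2] hx hy.
have M1 : 0 < M^-1 by rewrite invr_gt0.
have X0 : 0 < X by exact: lt_le_trans X1.
have Y0 : 0 < Y by exact: lt_le_trans Y1.
have [K KE] : exists K : R, K = 16 * pi ^+ 2 / 27 by exists (16 * pi ^+ 2 / 27).
have K0 : 0 < K by rewrite KE divr_gt0// mulr_gt0// exprn_gt0.
rewrite -KE in hx; rewrite -KE in hy.
have h : `|K * X ^- 2 - K * Y ^- 2| <= 2 * r.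
  rewrite (_ : _ - _ = (K * X ^- 2 - z) - (K * Y ^- 2 - z)); last by ring.
  by apply: (le_trans (ler_normB _ _)); lra.
have e1 : K * X ^- 2 - K * Y ^- 2 = (Y - X) * (K * (X + Y) / (X * Y) ^+ 2) by field; rewrite !gt_eqF.
have q0 : 0 < K * (X + Y) / (X * Y) ^+ 2 by rewrite divr_gt0 ?exprn_gt0 ?mulr_gt0// addr_gt0.
have q1 : K * (2 / M) / (M * M) ^+ 2 <= K * (X + Y) / (X * Y) ^+ 2.
  apply: ler_pM.
  - by rewrite mulr_ge0 ?divr_ge0 ?(ltW K0) ?(ltW M0).
  - by rewrite invr_ge0 exprn_ge0// mulr_ge0 ?(ltW M0).
  - by rewrite ler_pM2l//; move: X1 Y1; rewrite -[_ / M]/(2 * M^-1); lra.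
  - rewrite lef_pV2 ?posrE ?exprn_gt0 ?mulr_gt0// lerXn2r ?nnegrE ?mulr_ge0 ?(ltW X0) ?(ltW Y0) ?(ltW M0)//.
    by apply: ler_pM; rewrite ?(ltW X0) ?(ltW Y0).
move: h; rewrite e1 normrM (gtr0_norm q0) distrC => h.
have := le_trans (ler_wpM2l (normr_ge0 (X - Y)) q1) h.
have -> : K * (2 / M) / (M * M) ^+ 2 = 2 * (K / M ^+ 5) by field; rewrite gt_eqF.
have -> : M ^+ 5 * (27 / (16 * pi ^+ 2)) = (K / M ^+ 5)^-1.
  by rewrite KE; move: (pi : R) p0 => p p0; field; rewrite !gt_eqF.
by move=> h2; rewrite ler_pdivlMr ?divr_gt0 ?exprn_gt0//; lra.
Qed.

(** Sign, range of [|t|] and excess of the exponent are discretised, so that the exceptional nonzero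
    times form a countable union. *)
Definition well_approximable_time (s : bool) (M k : nat) : set R :=
  [set t | M.+1%:R^-1 <= sgn_real s * t <= M.+1%:R /\
    forall q0 : nat, exists (q : nat) (a : int), [/\ (0 < q)%N, (q0 <= q)%N &
      `|beta t - a%:~R / q%:R| < q%:R `^ (- (2 + k.+1%:R^-1))]].

(** For a given [q] the times with [beta t] close to a fraction [a / q] lie in at most [q W]
    intervals of length [O(q ^ - (2 + e))]; the total length [O(q ^ - (1 + e))] is summable. *)
Lemma well_approximable_time_negligible s M k : mu.-negligible (well_approximable_time s M k).
Proof.
pose e : R := k.+1%:R^-1; have e0 : 0 < e by rewrite invr_gt0 ltr0n.
have p0 := pi_gt0 R; pose m : R := M.+1%:R; have m0 : 0 < m by rewrite ltr0n.
pose A : R := m ^+ 5 * (27 / (16 * pi ^+ 2)).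
have A0 : 0 < A by rewrite mulr_gt0 ?exprn_gt0// divr_gt0// mulr_gt0// exprn_gt0.
pose d (q : nat) : R := q%:R `^ (- (2 + e)) * A.
(* Two more than the maximum of [beta] on the range: an eligible numerator satisfies
   [- q < a < q (W - 1)], so that [i = a + q] is a natural number below [q W]. *)
pose W := (Num.bound (16 * pi ^+ 2 / 27 * m ^+ 2 + 2)).+1.
have WE : 16 * pi ^+ 2 / 27 * m ^+ 2 + 2 < W%:R.
  apply: (lt_trans (archi_boundP _)); last by rewrite ltr_nat.
  by rewrite addr_ge0// mulr_ge0 ?exprn_ge0 ?(ltW m0)// divr_ge0// mulr_ge0// exprn_ge0// ltW.
pose X (q : nat) (i : nat) : set R := [set t | m^-1 <= sgn_real s * t <= m /\
  `|beta t - (i%:R - q%:R) / q%:R| < q%:R `^ (- (2 + e))].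
(* Any point of [X q i] serves as the centre, because two of its points are at distance at most
   [d q]. An empty set gets the centre 0. *)
have cex (qi : nat * nat) : exists c : R, X qi.1 qi.2 `<=` `[c - d qi.1, c + d qi.1]%classic.
  have [[x [x1 x2]]|nX] := pselect (exists x, X qi.1 qi.2 x).
    exists x => y [y1 y2]; rewrite /= in_itv /=.
    have := beta_close_dist m0 x1 y1 x2 y2; rewrite -/A -/(d qi.1) ler_norml => /andP[? ?].
    by apply/andP; split; lra.
  by exists 0 => x Xx; case: nX; exists x.
have [c hc] := choice cex.
pose I (q i : nat) : set R := `[c (q, i) - d q, c (q, i) + d q]%classic.
pose B (q : nat) : set R := \big[setU/set0]_(i < q * W) I q i.
have mB q : measurable (B q) by apply: bigsetU_measurable => i _; exact: measurable_itv.
have muB q : (mu (B q) <= (2 * W%:R * A * q%:R `^ (- (1 + e)))%:E)%E.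
  apply: (le_trans (Boole_inequality _ _)) => [i _|]; first exact: measurable_itv.
  have muI i : mu (I q i) = (2 * d q)%:E.
    rewrite /I lebesgue_measure_itv /= lte_fin.
    have d0 : 0 <= d q by rewrite mulr_ge0 ?powR_ge0// ltW.
    case: ifPn => [_|]; first by rewrite -EFinB; congr EFin; ring.
    by rewrite -leNgt => h; congr EFin; lra.
  rewrite (eq_bigr (fun=> (2 * d q)%:E)) => [|i _]; last exact: muI.
  rewrite sumEFin lee_fin sumr_const card_ord -[leLHS]mulr_natr natrM.
  have [->|q0] := posnP q; first by rewrite mul0r mulr0 mulr_ge0 ?powR_ge0// mulr_ge0// ltW.
  have q0' : 0 < q%:R :> R by rewrite ltr0n.
  rewrite /d (_ : - (1 + e) = - (2 + e) + 1); last by ring.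
  rewrite powRDp// powRr1 ?(ltW q0')// le_eqVlt; apply/orP; left; apply/eqP; ring.
have [D hD] := sum_powRN_bound e0.
have sB : (\sum_(q <oo) mu (B q) < +oo)%E.
  apply: (@le_lt_trans _ _ (2 * W%:R * A * D)%:E); last exact: ltry.
  apply: lime_le; first exact: is_cvg_nneseries.
  apply: nearW => n.
  apply: (@le_trans _ _ (\sum_(0 <= q < n) (2 * W%:R * A * q%:R `^ (- (1 + e)))%:E)%E).
    by apply: lee_sum => q _.
  have WA : 0 < 2 * W%:R * A by apply: mulr_gt0 => //; apply: mulr_gt0 => //; rewrite ltr0n.
  rewrite sumEFin lee_fin -mulr_sumr ler_pM2l//.
  case: n => [|n]; first by rewrite big_geq//; have := hD 0%N; rewrite big_geq.
  rewrite big_ltn// powR0 ?add0r ?hD// oppr_eq0 gt_eqF//; lra.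
exists (lim_sup_set B); split.
- by apply: bigcap_measurable => // n _; apply: bigcup_measurable => j _; exact: mB.
- exact: lim_sup_set_cvg0.
move=> t [tM h] n _; have [q [a [q0 nq qa]]] := h n.
have q0' : 0 < q%:R :> R by rewrite ltr0n.
exists q => //; pose i := `|(a + q%:Z)%R|%N.
have b0 : 0 <= beta t <= 16 * pi ^+ 2 / 27 * m ^+ 2.
  case/andP: (tM) => t1 _; have K0 : 0 < 16 * pi ^+ 2 / 27 :> R by rewrite divr_gt0// mulr_gt0// exprn_gt0.
  have st0 : 0 < sgn_real s * t by apply: lt_le_trans t1; rewrite invr_gt0.
  rewrite (betaE st0) mulr_ge0 ?invr_ge0 ?exprn_ge0 ?(ltW K0) ?(ltW st0)//= ler_pM2l//.
  rewrite -exprVn lerXn2r ?nnegrE ?invr_ge0 ?(ltW st0) ?(ltW m0)//.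
  by rewrite -[leRHS]invrK lef_pV2 ?posrE ?invr_gt0.
have r1 : q%:R `^ (- (2 + e)) <= 1.
  by rewrite powRN invf_le1 ?powR_gt0// powR_ge1 ?ler1n//; lra.
have [b1 b2] : -1 < a%:~R / q%:R :> R /\ a%:~R / q%:R < W%:R - 1 :> R.
  move: qa b0 => /lt_le_trans/(_ r1); rewrite ltr_norml => /andP[? ?] /andP[? ?].
  by move: WE; split; lra.
have a1 : - q%:R < a%:~R :> R by move: b1; rewrite ltr_pdivlMr// mulN1r.
have a2 : a%:~R < q%:R * (W%:R - 1) :> R by move: b2; rewrite ltr_pdivrMr// mulrC.
have iE : i%:R = a%:~R + q%:R :> R.
  rewrite /i natr_absz ger0_norm ?intrD//.
  by rewrite -(@ler0z R) intrD -pmulrn; lra.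
have iW : (i < q * W)%N by rewrite -(ltr_nat R) iE natrM; lra.
rewrite /B -bigcup_mkord; exists i => //; rewrite /I; apply: (hc (q, i)); split => //=.
by rewrite iE addrK.
Qed.

Lemma ae_Khinchin_Levy : {ae mu, forall t : R, t != 0 /\ Khinchin_Levy (beta t)}.
Proof.
pose U := [set 0 : R] `|` (\bigcup_M \bigcup_k well_approximable_time true M k `|` \bigcup_M \bigcup_k well_approximable_time false M k).
have : mu.-negligible U.
  apply: negligibleU.
    by apply/negligibleP => //; exact: lebesgue_measure_set1.
  by apply: negligibleU; apply: negligible_bigcup => M; apply: negligible_bigcup => k; exact: well_approximable_time_negligible.
apply: negligibleS.
move=> t /= ht; apply: contrapT => nU; apply: ht.
have t0 : t != 0 by apply/eqP => t0; apply: nU; left.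
split=> //.
pose s := t < 0.
have st : sgn_real s * t = `|t|.
  by rewrite /s; case: ltP => h; rewrite /= ?mulN1r ?mul1r ?(ltr0_norm h) ?(ger0_norm h).
have tp : 0 < `|t| by rewrite normr_gt0.
pose M := maxn (Num.bound `|t|) (Num.bound `|t|^-1).
have M1 : `|t| <= M.+1%:R.
  apply: (le_trans (ltW (archi_boundP (ltW tp)))); rewrite ler_nat ltnW// ltnS; exact: leq_maxl.
have M2 : M.+1%:R^-1 <= `|t|.
  rewrite -[leRHS]invrK lef_pV2 ?posrE ?invr_gt0 ?ltr0n//.
  apply: (le_trans (ltW (archi_boundP _))); first by rewrite invr_ge0.
  rewrite ler_nat ltnW// ltnS; exact: leq_maxr.
have nE k : exists q0 : nat, forall (q : nat) (a : int), (0 < q)%N -> (q0 <= q)%N ->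
    q%:R `^ (- (2 + k.+1%:R^-1)) <= `|beta t - a%:~R / q%:R|.
  apply: contrapT => h; apply: nU; right.
  have E : well_approximable_time s M k t.
    split; first by rewrite st M1 M2.
    move=> q0; apply: contrapT => hq; apply: h; exists q0 => q a q1 q2.
    by rewrite leNgt; apply/negP => lt; apply: hq; exists q, a.
  by move: E; case: (s) => E; [left|right]; exists M => //; exists k.
apply: Khinchin_Levy_diophantine.
  (* Irrationality follows from the same lower bound: a rational [beta] would equal its fraction
     expanded by [q0.+1], whose denominator is at least [q0]. *)
  move=> [r _ rb]; have [q0 hq0] := nE 0%N.
  pose n := `|denq r|%N; have n0 : (0 < n)%N by rewrite absz_gt0 denq_neq0.
  have := hq0 (n * q0.+1)%N (numq r * q0.+1%:Z); rewrite muln_gt0 n0 /= => /(_ isT).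
  have qq : (q0 <= n * q0.+1)%N by apply: (@leq_trans q0.+1) => //; exact: leq_pmull.
  move=> /(_ qq).
  have -> : (numq r * q0.+1%:Z)%:~R / (n * q0.+1)%:R = beta t.
    rewrite -rb /ratr intrM natrM -pmulrn -mulf_div mulfV ?pnatr_eq0// mulr1; congr (_ / _).
    by rewrite /n natr_absz gtr0_norm ?denq_gt0.
  by rewrite subrr normr0 leNgt powR_gt0// ltr0n muln_gt0 n0.
(* With [k] the bound of [1 / e], the excess [1 / k.+1] is at most [e]. *)
move=> e e0; have [q0 hq0] := nE (Num.bound e^-1).
exists q0 => q a q1 q2; apply: le_trans (hq0 q a q1 q2).
have q1' : 1 <= q%:R :> R by rewrite ler1n.
rewrite ler_powR// lerN2 lerD2l.
rewrite -[leRHS]invrK lef_pV2 ?posrE ?invr_gt0 ?ltr0n//.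
apply: (le_trans (ltW (archi_boundP _))); first by rewrite invr_ge0 ltW.
by rewrite ler_nat.
Qed.

End AlmostEveryTime.

(** Since [evolution] takes the default value 0 when there is no continuous representative,
    existence is asserted along with the bounds. *)
Theorem mainTheorem19 (R : realType) (g : R -> R[i])
    (gBV : BV_torus g) (gH : ~ Sobolev_half_plus g) :
  (forall t : R, t != 0 -> Khinchin_Levy (4 / 27 * (t / (2 * pi)) ^- 2) ->
     (exists u, is_evolution omega32 t g u) /\
     ((11 / 8)%:E <= D_t t omega32 g <= (13 / 8)%:E)%E) /\
  {ae @lebesgue_measure R, forall t : R,
     t != 0 /\ Khinchin_Levy (4 / 27 * (t / (2 * pi)) ^- 2)}.
Proof.
split; last exact: ae_Khinchin_Levy.
move=> t t0 KL; split; first exact: evolution_exists gBV t0 KL.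
by apply/andP; split; [exact: D_t_ge|exact: D_t_le].
Qed.
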